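(* The isomorphism problem for commutative AF algebras is $\Sigma^1_1$ complete: the set of all pairs $(e_0,e_1)\in\mathbb{N}^2$ such that $e_0$ and $e_1$ index c.e. presentations of $*$-isomorphic commutative AF algebras is $\Sigma^1_1$ complete.
   Context: An AF algebra is a C*-algebra isomorphic to an inductive limit of a sequence of finite-dimensional C*-algebras. A presentation $\mathbf{A}^\#$ of a C*-algebra $\mathbf{A}$ is a sequence $(a_0,a_1,\dots)$ in $\mathbf{A}$ (special points) generating a dense $*$-subalgebra; generated points are the values $p(a_0,\dots,a_n)$ of $*$-polynomials with coefficients in $\mathbb{Q}(i)$, effectively listed. $\mathbf{A}^\#$ is c.e. if there is an algorithm that, given a generated point $q$, enumerates a decreasing sequence of rationals converging to $\|q\|$; $e\in\mathbb{N}$ indexes $\mathbf{A}^\#$ if it is a code of such an algorithm. A $\Sigma^1_1$ set is one definable as $\{x:\exists f\,\forall y\,R(x,f,y)\}$ with $f$ ranging over $\mathbb{N}^{\mathbb{N}}$, $y$ over $\mathbb{N}$ (with the usual normal forms of the analytical hierarchy), and $R$ computable. Completeness is with respect to many-one reductions. *)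

(* Defs.v *)
From mathcomp Require Import all_boot all_order all_algebra.
From mathcomp Require Import complex.
From mathcomp Require Import all_classical all_reals all_analysis.
From Stdlib Require Cantor.

Set Implicit Arguments.
Unset Strict Implicit.
Unset Printing Implicit Defensive.

Import Order.TTheory GRing.Theory Num.Theory.
Import numFieldNormedType.Exports.

Local Open Scope classical_set_scope.
Local Open Scope ring_scope.

Definition pairn (x y : nat) : nat := Cantor.to_nat (x, y).
Definition unpairn (n : nat) : nat * nat := Cantor.of_nat n.

Inductive code : Type :=
| CZero | CSucc | CFst | CSnd | COracle
| CPair of code & code
| CComp of code & code
| CPrec of code & code
| CMu of code.

(* [runs f c x y]: the program [c] with oracle [f] halts on input [x] with
   output [y].  [CMu c] on input <x, m> returns the least n >= m such that [c]
   outputs 0 on <x, n>, provided that [c] halts on <x, m>, ..., <x, n>. *)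
Inductive runs (f : nat -> nat) : code -> nat -> nat -> Prop :=
| runs_zero x : runs f CZero x 0
| runs_succ x : runs f CSucc x x.+1
| runs_fst x y : runs f CFst (pairn x y) x
| runs_snd x y : runs f CSnd (pairn x y) y
| runs_oracle x : runs f COracle x (f x)
| runs_pair c d x y z :
    runs f c x y -> runs f d x z -> runs f (CPair c d) x (pairn y z)
| runs_comp c d x y z :
    runs f d x y -> runs f c y z -> runs f (CComp c d) x z
| runs_prec0 c d x y :
    runs f c x y -> runs f (CPrec c d) (pairn x 0) y
| runs_precS c d x n y z :
    runs f (CPrec c d) (pairn x n) y ->
    runs f d (pairn x (pairn n y)) z ->
    runs f (CPrec c d) (pairn x n.+1) z
| runs_mu0 c x n :
    runs f c (pairn x n) 0 -> runs f (CMu c) (pairn x n) n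
| runs_muS c x m v n :
    runs f c (pairn x m) v.+1 ->
    runs f (CMu c) (pairn x m.+1) n ->
    runs f (CMu c) (pairn x m) n.

Fixpoint code_num (c : code) : nat :=
  match c with
  | CZero => pairn 0 0
  | CSucc => pairn 1 0
  | CFst => pairn 2 0
  | CSnd => pairn 3 0
  | COracle => pairn 4 0
  | CPair c d => pairn 5 (pairn (code_num c) (code_num d))
  | CComp c d => pairn 6 (pairn (code_num c) (code_num d))
  | CPrec c d => pairn 7 (pairn (code_num c) (code_num d))
  | CMu c => pairn 8 (code_num c)
  end.

(* [phi e x y]: the e-th partial recursive function maps [x] to [y].
   Computability without an oracle is computability with the zero oracle. *)
Definition phi (e x y : nat) : Prop :=
  exists2 c, code_num c = e & runs (fun=> 0%N) c x y.

Definition computable_fun (g : nat -> nat) : Prop :=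
  exists e, forall x, phi e x (g x).

(* Relations on N x N^N x N decided by a single oracle program which halts for
   every oracle. *)
Definition computable_rel (P : nat -> (nat -> nat) -> nat -> bool) : Prop :=
  exists c, forall x f y, runs f c (pairn x y) (P x f y).

Definition Sigma11 (S : set nat) : Prop :=
  exists2 P : nat -> (nat -> nat) -> nat -> bool, computable_rel P &
    S = [set x | exists f : nat -> nat, forall y, P x f y].

Definition many_one_reducible (S T : set nat) : Prop :=
  exists2 g : nat -> nat, computable_fun g & forall x, S x <-> T (g x).

Definition Sigma11_complete (S : set nat) : Prop :=
  Sigma11 S /\ forall T, Sigma11 T -> many_one_reducible T S.

Definition coded_pairs (S : set (nat * nat)) : set nat := unpairn @^-1` S.

(* Not assumed to be unital.  Over the field R[i] the library norm takes its
   values in R[i]. *)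
Record cstar_alg (R : realType) := CStarAlg {
  cs_car :> completeNormedModType R[i];
  cs_mul : cs_car -> cs_car -> cs_car;
  cs_star : cs_car -> cs_car;
  cs_mulA : associative cs_mul;
  cs_mulDl : left_distributive cs_mul +%R;
  cs_mulDr : right_distributive cs_mul +%R;
  cs_scaleAl : forall (k : R[i]) x y, k *: cs_mul x y = cs_mul (k *: x) y;
  cs_scaleAr : forall (k : R[i]) x y, k *: cs_mul x y = cs_mul x (k *: y);
  cs_starD : {morph cs_star : x y / x + y};
  cs_starZ : forall (k : R[i]) x, cs_star (k *: x) = k^* *: cs_star x;
  cs_starM : forall x y, cs_star (cs_mul x y) = cs_mul (cs_star y) (cs_star x);
  cs_starK : involutive cs_star;
  cs_normM : forall x y, `|cs_mul x y| <= `|x| * `|y|;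
  cs_normC : forall x, `|cs_mul (cs_star x) x| = `|x| ^+ 2 }.

Section CStarTheory.
Variable R : realType.
Implicit Types A B : cstar_alg R.

Definition cs_norm A (x : A) : R := complex.Re `|x|.

Definition is_star_hom A B (h : A -> B) : Prop :=
  [/\ linear h,
      forall x y, h (cs_mul x y) = cs_mul (h x) (h y) &
      forall x, h (cs_star x) = cs_star (h x)].

Definition star_isomorphic A B : Prop :=
  exists2 h : A -> B, is_star_hom h & bijective h.

Definition cs_commutative A : Prop := commutative (@cs_mul R A).

Definition cs_finite_dim A : Prop :=
  exists (n : nat) (b : 'I_n -> A),
    forall x, exists k : 'I_n -> R[i], x = \sum_i k i *: b i.

(* [(A, mu)] is an inductive limit, in the category of C*-algebras and
   *-homomorphisms, of F 0 -> F 1 -> F 2 -> ... with connecting maps [h]. *)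
Definition is_inductive_limit (F : nat -> cstar_alg R)
    (h : forall n, F n -> F n.+1) A (mu : forall n, F n -> A) : Prop :=
  [/\ forall n, is_star_hom (mu n),
      forall n x, mu n.+1 (h n x) = mu n x &
      forall B (la : forall n, F n -> B),
        (forall n, is_star_hom (la n)) ->
        (forall n x, la n.+1 (h n x) = la n x) ->
        exists! u : A -> B,
          is_star_hom u /\ forall n x, u (mu n x) = la n x].

Definition is_AF A : Prop :=
  exists (F : nat -> cstar_alg R) (h : forall n, F n -> F n.+1)
         (L : cstar_alg R) (mu : forall n, F n -> L),
    [/\ forall n, cs_finite_dim (F n), forall n, is_star_hom (h n),
        is_inductive_limit h mu & star_isomorphic A L].

Definition star_subalg_closed A (S : set A) : Prop :=
  [/\ S 0,
      forall x y, S x -> S y -> S (x + y),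
      forall (k : R[i]) x, S x -> S (k *: x),
      forall x y, S x -> S y -> S (cs_mul x y) &
      forall x, S x -> S (cs_star x)].

Definition is_presentation A (a : nat -> A) : Prop :=
  dense (smallest (@star_subalg_closed A) (range a)).

(* Surjections of nat onto rat and onto Q(i). *)
Definition rat_of_nat (n : nat) : rat :=
  let: (m, d) := unpairn n in
  let: (p, q) := unpairn m in (p%:R - q%:R) / d.+1%:R.

Definition gauss_of_nat (n : nat) : R[i] :=
  let: (p, q) := unpairn n in
  (ratr (rat_of_nat p) +i* ratr (rat_of_nat q))%C.

End CStarTheory.

(* Expressions for the *-polynomials over Q(i) in noncommuting variables
   x_0, x_1, ...; as algebras need not be unital there is no constant term.
   The coefficient in [PScale k p] is given by its number in the list
   [gauss_of_nat] of Q(i). *)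
Inductive star_poly : Type :=
| PVar of nat
| PAdd of star_poly & star_poly
| PMul of star_poly & star_poly
| PStar of star_poly
| PScale of nat & star_poly.

Fixpoint star_poly_num (p : star_poly) : nat :=
  match p with
  | PVar i => pairn 0 i
  | PAdd p q => pairn 1 (pairn (star_poly_num p) (star_poly_num q))
  | PMul p q => pairn 2 (pairn (star_poly_num p) (star_poly_num q))
  | PStar p => pairn 3 (star_poly_num p)
  | PScale k p => pairn 4 (pairn k (star_poly_num p))
  end.

Fixpoint star_poly_val (R : realType) (A : cstar_alg R) (a : nat -> A)
    (p : star_poly) : A :=
  match p with
  | PVar i => a i
  | PAdd p q => star_poly_val a p + star_poly_val a q
  | PMul p q => cs_mul (star_poly_val a p) (star_poly_val a q)
  | PStar p => cs_star (star_poly_val a p)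
  | PScale k p => gauss_of_nat R k *: star_poly_val a p
  end.

(* [e] indexes the presentation [a] (which is thereby c.e.): given the number
   of a generated point and k, the e-th algorithm computes the k-th term of a
   decreasing sequence of rationals converging to the norm of that point. *)
Definition indexes (R : realType) (A : cstar_alg R) (a : nat -> A) (e : nat)
    : Prop :=
  forall p : star_poly, exists r : nat -> nat,
    [/\ forall k, phi e (pairn (star_poly_num p) k) (r k),
        decreasing_seq (fun k => rat_of_nat (r k)) &
        (ratr (rat_of_nat (r k)) : R) @[k --> \oo]
          --> cs_norm (star_poly_val a p)].

Definition comm_AF_iso_problem (R : realType) : set (nat * nat) :=
  [set e | exists (A B : cstar_alg R) (a : nat -> A) (b : nat -> B),
     [/\ cs_commutative A /\ is_AF A, cs_commutative B /\ is_AF B,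
         is_presentation a /\ indexes a e.1,
         is_presentation b /\ indexes b e.2 &
         star_isomorphic A B]].

(* Main.v *)
(* Every commutative AF algebra is isomorphic to an algebra Alg R K of functions on nat
   generated by the indicators of the classes of a refining sequence K of finite
   partitions: through each minimal projection of a finite-dimensional stage choose a
   decreasing sequence of minimal projections of the stages; the characters defined by
   these sequences serve as the points. So two c.e. presentations present
   isomorphic commutative AF algebras iff some Alg R K has, for both indices, special
   points given as limits of simple functions whose norms are computed by the index,
   and this is a Sigma^1_1 condition.

   For hardness, let T_x be a computable tree having a path iff x is in a given
   Sigma^1_1 set, and order its nodes by the Kleene-Brouwer order, which is ill-founded
   below the root iff T_x has a path. Consider the forest of finite descending sequences
   in this order, each repeated infinitely often, with one root (respectively two roots),
   and the algebra generated by the indicators of its cones. Both presentations are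
   computable in x. If the order is well-founded, a Cantor-Bendixson analysis counts the
   roots, so the two algebras are not isomorphic. If it is ill-founded, a back-and-forth
   argument matches the clopen sets of the two forests: two sets correspond if both
   contain a node with ill-founded label or if they are homeomorphic. *)

Require Import Defs.
From mathcomp Require Import all_boot all_order all_algebra.
From mathcomp Require Import all_classical all_reals all_analysis.
From HB Require Import structures.
From mathcomp Require Import complex ring lra zify.

Set Implicit Arguments.
Unset Strict Implicit.
Unset Printing Implicit Defensive.

Import Order.TTheory GRing.Theory Num.Theory.
Import numFieldNormedType.Exports.

(** * Computable functionals *)

(** An obstacle shapes the analytic half: the universal property of an inductive limit speaks of
    arbitrary C*-algebras and of homomorphisms with no assumed continuity. Contractivity is
    therefore derived: the function sqrt(1 - t^2) - 1 gives a crude bound, and repeated squaring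
    sharpens it to 1. Countably many characters that determine the norm stand in for the whole
    spectrum, so the representing data become a single element of Baire space. For hardness, the
    Kleene-Brouwer order serves because it is total: an accessible node of the tree lies below every
    inaccessible one, so well-founded cones have copies below every ill-founded node. Repeating
    labels infinitely often keeps a well-founded cone from being covered by finitely many atoms of
    smaller label, which makes the number of roots an invariant. In the ill-founded case no map of
    points is built: two generating sequences of indicators with the same finite membership patterns
    give equal norms to all *-polynomials, and the resulting isometry extends by continuity. *)

Definition p1 n := (unpairn n).1.
Definition p2 n := (unpairn n).2.
Lemma p1_pair x y : p1 (pairn x y) = x.
Proof. by rewrite /p1 /unpairn /pairn Cantor.cancel_of_to. Qed.
Lemma p2_pair x y : p2 (pairn x y) = y.
Proof. by rewrite /p2 /unpairn /pairn Cantor.cancel_of_to. Qed.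
Lemma pair_p n : pairn (p1 n) (p2 n) = n.
Proof. by rewrite /p1 /p2 /pairn /unpairn -surjective_pairing Cantor.cancel_to_of. Qed.
Definition pE := (p1_pair, p2_pair).
Lemma pairn_inj x y x' y' : pairn x y = pairn x' y' -> x = x' /\ y = y'.
Proof. by move=> h; have := congr1 p1 h; have := congr1 p2 h; rewrite !pE. Qed.
Lemma pairn_ge x y : y + x <= pairn x y.
Proof. by apply/ssrnat.leP; exact: Cantor.to_nat_non_decreasing. Qed.
Lemma p1_le n : p1 n <= n.
Proof. by rewrite -{2}(pair_p n); apply: leq_trans (pairn_ge _ _); apply: leq_addl. Qed.
Lemma p2_le n : p2 n <= n.
Proof. by rewrite -{2}(pair_p n); apply: leq_trans (pairn_ge _ _); apply: leq_addr. Qed.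
Lemma pairn_gt x y : 0 < x -> y < pairn x y.
Proof. by move=> x0; apply: leq_trans (pairn_ge x y); rewrite -addn1 leq_add2l. Qed.

Fixpoint natrec (b : nat) (s : nat -> nat -> nat) n := if n is n'.+1 then s n' (natrec b s n') else b.

(** Total functionals only, with one program for all oracles; truth values count as the numbers 0
    and 1. *)
Definition cmp (F : (nat -> nat) -> nat -> nat) := exists c, forall f x, runs f c x (F f x).

Lemma cmp_ext F G : (forall f x, F f x = G f x) -> cmp F -> cmp G.
Proof. by move=> h [c hc]; exists c => f x; rewrite -h. Qed.

Lemma cmp_x : cmp (fun f x => x).
Proof.
exists (CPair CFst CSnd) => f x.
by have := runs_pair (runs_fst f (p1 x) (p2 x)) (runs_snd f (p1 x) (p2 x)); rewrite pair_p.
Qed.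
Lemma cmp_comp G F : cmp G -> cmp F -> cmp (fun f x => G f (F f x)).
Proof. by move=> [c hc] [d hd]; exists (CComp c d) => f x; apply: runs_comp (hd f x) (hc _ _). Qed.
Lemma cmp_const n : cmp (fun f x => n).
Proof.
elim: n => [|n [c hc]]; first by exists CZero => f x; apply: runs_zero.
by exists (CComp CSucc c) => f x; apply: runs_comp (hc f x) _; apply: runs_succ.
Qed.
Lemma cmp_S F : cmp F -> cmp (fun f x => (F f x).+1).
Proof. by apply: (@cmp_comp (fun f x => x.+1)); exists CSucc => f x; apply: runs_succ. Qed.
Lemma cmp_p1 F : cmp F -> cmp (fun f x => p1 (F f x)).
Proof.
apply: (@cmp_comp (fun f x => p1 x)); exists CFst => f x.
by rewrite -{1}(pair_p x); apply: runs_fst.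
Qed.
Lemma cmp_p2 F : cmp F -> cmp (fun f x => p2 (F f x)).
Proof.
apply: (@cmp_comp (fun f x => p2 x)); exists CSnd => f x.
by rewrite -{1}(pair_p x); apply: runs_snd.
Qed.
Lemma cmp_pair F G : cmp F -> cmp G -> cmp (fun f x => pairn (F f x) (G f x)).
Proof. by move=> [c hc] [d hd]; exists (CPair c d) => f x; apply: runs_pair. Qed.
Lemma cmp_oracle F : cmp F -> cmp (fun f x => f (F f x)).
Proof. by apply: (@cmp_comp (fun f x => f x)); exists COracle => f x; apply: runs_oracle. Qed.

Lemma cmp_comp2 (g : (nat -> nat) -> nat -> nat -> nat) F G :
  cmp (fun f z => g f (p1 z) (p2 z)) -> cmp F -> cmp G -> cmp (fun f x => g f (F f x) (G f x)).
Proof.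
move=> hg hF hG; have := cmp_comp hg (cmp_pair hF hG).
by apply: cmp_ext => f x; rewrite !pE.
Qed.
Lemma cmp_comp3 (g : (nat -> nat) -> nat -> nat -> nat -> nat) F G H :
  cmp (fun f z => g f (p1 z) (p1 (p2 z)) (p2 (p2 z))) -> cmp F -> cmp G -> cmp H ->
  cmp (fun f x => g f (F f x) (G f x) (H f x)).
Proof.
move=> hg hF hG hH; have := cmp_comp hg (cmp_pair hF (cmp_pair hG hH)).
by apply: cmp_ext => f x; rewrite !pE.
Qed.

Lemma cmp_rec B (S : (nat -> nat) -> nat -> nat -> nat -> nat) N : cmp B ->
  cmp (fun f z => S f (p1 z) (p1 (p2 z)) (p2 (p2 z))) -> cmp N ->
  cmp (fun f x => natrec (B f x) (fun n r => S f x n r) (N f x)).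
Proof.
move=> [c hc] [d hd] hN.
apply: (@cmp_comp2 (fun f x n => natrec (B f x) (fun n r => S f x n r) n) (fun f x => x)) => //;
  last exact: cmp_x.
exists (CPrec c d) => f z; rewrite -{1}(pair_p z); elim: (p2 z) => [|n IH] /=.
  exact: runs_prec0.
by apply: runs_precS IH _; have := hd f (pairn (p1 z) (pairn n (natrec (B f (p1 z)) (S f (p1 z)) n)));
   rewrite !pE.
Qed.

Create HintDb cmp.
#[global] Hint Constants Opaque : cmp.
#[global] Hint Resolve cmp_x cmp_const cmp_S cmp_p1 cmp_p2 cmp_pair cmp_oracle cmp_rec : cmp.
Ltac cmp := solve [auto 60 with cmp nocore].

Lemma cmp_app2 (g : nat -> nat -> nat) F G : cmp (fun f z => g (p1 z) (p2 z)) ->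
  cmp F -> cmp G -> cmp (fun f x => g (F f x) (G f x)).
Proof. exact: (@cmp_comp2 (fun _ => g)). Qed.

Lemma natrecE (T : Type) (g : nat -> nat) b (s : nat -> nat -> nat) n :
  g 0 = b -> (forall n, g n.+1 = s n (g n)) -> natrec b s n = g n.
Proof. by move=> h0 hS; elim: n => //= n ->. Qed.

Lemma cmp_add F G : cmp F -> cmp G -> cmp (fun f x => F f x + G f x).
Proof.
apply: cmp_app2; apply: (@cmp_ext (fun f z => natrec (p1 z) (fun n r => r.+1) (p2 z))); last by cmp.
by move=> f z; apply: (@natrecE nat (fun n => p1 z + n)) => [|n]; rewrite ?addn0 ?addnS.
Qed.
#[global] Hint Resolve cmp_add : cmp.
Lemma cmp_pred F : cmp F -> cmp (fun f x => (F f x).-1).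
Proof.
apply: (@cmp_comp (fun f x => x.-1)).
by apply: (@cmp_ext (fun f z => natrec 0 (fun n r => n) z)); [move=> f [|z] | cmp].
Qed.
#[global] Hint Resolve cmp_pred : cmp.
Lemma cmp_sub F G : cmp F -> cmp G -> cmp (fun f x => F f x - G f x).
Proof.
apply: cmp_app2; apply: (@cmp_ext (fun f z => natrec (p1 z) (fun n r => r.-1) (p2 z))); last by cmp.
by move=> f z; apply: (@natrecE nat (fun n => p1 z - n)) => [|n]; rewrite ?subn0 ?subnS.
Qed.
Lemma cmp_mul F G : cmp F -> cmp G -> cmp (fun f x => F f x * G f x).
Proof.
apply: cmp_app2; apply: (@cmp_ext (fun f z => natrec 0 (fun n r => r + p1 z) (p2 z))); last by cmp.
by move=> f z; apply: (@natrecE nat (fun n => p1 z * n)) => [|n]; rewrite ?muln0 // mulnS addnC.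
Qed.
#[global] Hint Resolve cmp_sub cmp_mul : cmp.

Lemma cmp_if (b : (nat -> nat) -> nat -> bool) F G : cmp (fun f x => b f x) -> cmp F -> cmp G ->
  cmp (fun f x => if b f x then F f x else G f x).
Proof.
move=> hb hF hG.
apply: (@cmp_ext (fun f x => b f x * F f x + (1 - b f x) * G f x)); last by cmp.
by move=> f x; case: (b f x); rewrite /= ?mul1n ?mul0n ?addn0 ?subn0 ?add0n ?mul1n.
Qed.
Lemma cmp_leq F G : cmp F -> cmp G -> cmp (fun f x => F f x <= G f x).
Proof.
move=> hF hG; apply: (@cmp_ext (fun f x => 1 - (F f x - G f x))); last by cmp.
by move=> f x; rewrite -subn_eq0; case: (F f x - G f x).
Qed.
#[global] Hint Resolve cmp_if cmp_leq : cmp.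
Lemma cmp_and (a b : (nat -> nat) -> nat -> bool) : cmp (fun f x => a f x) -> cmp (fun f x => b f x) ->
  cmp (fun f x => a f x && b f x).
Proof.
move=> ha hb; apply: (@cmp_ext (fun f x => a f x * b f x)); last by cmp.
by move=> f x; case: (a f x); case: (b f x).
Qed.
Lemma cmp_not (a : (nat -> nat) -> nat -> bool) : cmp (fun f x => a f x) -> cmp (fun f x => ~~ a f x).
Proof.
move=> ha; apply: (@cmp_ext (fun f x => 1 - a f x)); last by cmp.
by move=> f x; case: (a f x).
Qed.
#[global] Hint Resolve cmp_and cmp_not : cmp.
Lemma cmp_or (a b : (nat -> nat) -> nat -> bool) : cmp (fun f x => a f x) -> cmp (fun f x => b f x) ->
  cmp (fun f x => a f x || b f x).
Proof.
move=> ha hb; apply: (@cmp_ext (fun f x => ~~ (~~ a f x && ~~ b f x))); last by cmp.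
by move=> f x; rewrite -negb_or negbK.
Qed.
Lemma cmp_eq F G : cmp F -> cmp G -> cmp (fun f x => F f x == G f x).
Proof.
move=> hF hG; apply: (@cmp_ext (fun f x => (F f x <= G f x) && (G f x <= F f x))); last by cmp.
by move=> f x; rewrite -eqn_leq.
Qed.
#[global] Hint Resolve cmp_or cmp_eq : cmp.

Lemma cmp_ifb (b c d : (nat -> nat) -> nat -> bool) : cmp (fun f x => b f x) ->
  cmp (fun f x => c f x) -> cmp (fun f x => d f x) -> cmp (fun f x => if b f x then c f x else d f x : bool).
Proof.
move=> hb hc hd; apply: (@cmp_ext (fun f x => if b f x then (c f x : nat) else d f x)); last by cmp.
by move=> f x; case: (b f x).
Qed.
#[global] Hint Resolve cmp_ifb : cmp.

Definition bex N (P : nat -> bool) : bool := has P (iota 0 N).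
Lemma bexP N (P : nat -> bool) : reflect (exists2 i, i < N & P i) (bex N P).
Proof.
apply: (iffP hasP) => [[j]|[i iN Pi]]; first by rewrite mem_iota /= => jN Pj; exists j.
by exists i; rewrite ?mem_iota.
Qed.
Definition bal N (P : nat -> bool) : bool := all P (iota 0 N).
Lemma balP N (P : nat -> bool) : reflect (forall i, i < N -> P i) (bal N P).
Proof.
apply: (iffP allP) => h i; last by rewrite mem_iota; apply: h.
by move=> iN; apply: h; rewrite mem_iota.
Qed.
Lemma cmp_bex (P : (nat -> nat) -> nat -> nat -> bool) N :
  cmp (fun f z => P f (p1 z) (p2 z)) -> cmp N -> cmp (fun f x => bex (N f x) (fun i => P f x i)).
Proof.
move=> hP hN.
apply: (@cmp_ext (fun f x => natrec 0 (fun n r => (r == 1) || P f x n) (N f x))).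
  move=> f x; apply: (@natrecE nat (fun n => bex n (P f x))) => // n.
  by rewrite /bex -addn1 iotaD has_cat /= orbF; case: (has _ _).
apply: cmp_rec => //; first by cmp.
apply: cmp_or; first by cmp.
by apply: (@cmp_comp2 (fun f a b => P f a b)) => //; cmp.
Qed.
#[global] Hint Resolve cmp_bex : cmp.
Lemma cmp_bal (P : (nat -> nat) -> nat -> nat -> bool) N :
  cmp (fun f z => P f (p1 z) (p2 z)) -> cmp N -> cmp (fun f x => bal (N f x) (fun i => P f x i)).
Proof.
move=> hP hN; apply: (@cmp_ext (fun f x => ~~ bex (N f x) (fun i => ~~ P f x i))); last by cmp.
by move=> f x; rewrite /bex /bal has_predC negbK.
Qed.
#[global] Hint Resolve cmp_bal : cmp.

Lemma cmp_iter (s : (nat -> nat) -> nat -> nat -> nat) N B :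
  cmp (fun f z => s f (p1 z) (p2 z)) -> cmp N -> cmp B ->
  cmp (fun f x => iter (N f x) (fun y => s f x y) (B f x)).
Proof.
move=> hs hN hB; apply: (@cmp_ext (fun f x => natrec (B f x) (fun _ r => s f x r) (N f x))).
  by move=> f x; apply: (@natrecE nat (fun n => iter n (s f x) (B f x))).
apply: cmp_rec => //.
by apply: (@cmp_comp2 s) => //; cmp.
Qed.
#[global] Hint Resolve cmp_iter : cmp.

(* Finite sequences of numbers: 0 is the empty one and <s, a>.+1 is s followed by a. *)
Definition par v := if v is v'.+1 then p1 v' else 0.
Definition lst v := if v is v'.+1 then p2 v' else 0.
Definition snoc s a := (pairn s a).+1.
Lemma par_snoc s a : par (snoc s a) = s. Proof. by rewrite /= p1_pair. Qed.
Lemma lst_snoc s a : lst (snoc s a) = a. Proof. by rewrite /= p2_pair. Qed.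
Lemma snoc_eta v : 0 < v -> snoc (par v) (lst v) = v.
Proof. by case: v => // v _; rewrite /snoc /= pair_p. Qed.
Lemma par_lt v : 0 < v -> par v < v.
Proof. by case: v => //= v _; rewrite ltnS p1_le. Qed.
Lemma par_le v : par v <= v.
Proof. by case: v => // v; apply/ltnW/par_lt. Qed.
Lemma cmp_par F : cmp F -> cmp (fun f x => par (F f x)).
Proof.
move=> hF; apply: (@cmp_ext (fun f x => if F f x == 0 then 0 else p1 (F f x).-1)); last by cmp.
by move=> f x; case: (F f x).
Qed.
Lemma cmp_lst F : cmp F -> cmp (fun f x => lst (F f x)).
Proof.
move=> hF; apply: (@cmp_ext (fun f x => if F f x == 0 then 0 else p2 (F f x).-1)); last by cmp.
by move=> f x; case: (F f x).
Qed.
Lemma cmp_snoc F G : cmp F -> cmp G -> cmp (fun f x => snoc (F f x) (G f x)).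
Proof. by rewrite /snoc => hF hG; cmp. Qed.
#[global] Hint Resolve cmp_par cmp_lst cmp_snoc : cmp.

(** Entries are counted from the end, [lookup h 0] being the last one. *)
Definition lookup h k := lst (iter k par h).
Lemma cmp_lookup F G : cmp F -> cmp G -> cmp (fun f x => lookup (F f x) (G f x)).
Proof. by rewrite /lookup => hF hG; cmp. Qed.
#[global] Hint Resolve cmp_lookup : cmp.

(* Course-of-values recursion: G computes F n from the sequence of the earlier values. *)
Lemma cmp_cov (F : (nat -> nat) -> nat -> nat -> nat) (G : (nat -> nat) -> nat -> nat -> nat -> nat) B N :
  cmp (fun f z => G f (p1 z) (p1 (p2 z)) (p2 (p2 z))) ->
  (forall f x n h, (forall i, i < n -> lookup h (n - i.+1) = F f x i) -> G f x n h = F f x n) ->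
  cmp B -> cmp N -> cmp (fun f y => F f (B f y) (N f y)).
Proof.
move=> hG hF hB hN.
pose hist f x n := natrec 0 (fun n h => snoc h (G f x n h)) n.
(* The history of length n holds the values at 0, ..., n - 1, so the value at i is entry n - i.+1
   from the end. *)
have hh f x n i : i < n -> lookup (hist f x n) (n - i.+1) = F f x i.
  elim: n i => // n IH i; rewrite ltnS leq_eqVlt => /orP[/eqP->|ni].
    by rewrite subnn /lookup /= p2_pair; apply: hF => j; apply: IH.
  have -> : n.+1 - i.+1 = (n - i.+1).+1 by lia.
    by rewrite -(IH i ni) /lookup iterSr -[hist f x n.+1]/(snoc (hist f x n) _) par_snoc.
have cG A B' H : cmp A -> cmp B' -> cmp H -> cmp (fun f x => G f (A f x) (B' f x) (H f x)).
  exact: cmp_comp3.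
have ch : cmp (fun f z => hist f (p1 z) (p2 z)).
  rewrite /hist; apply: (@cmp_rec (fun _ _ => 0) (fun f z n h => snoc h (G f (p1 z) n h))); [by cmp| |by cmp].
  by apply: cmp_snoc; [cmp | apply: cG; cmp].
apply: (@cmp_ext (fun f y => G f (B f y) (N f y) (hist f (B f y) (N f y)))).
  by move=> f y; apply: hF => i; apply: hh.
by apply: cG => //; apply: cmp_comp2.
Qed.

(** * Inversion and determinism of computations *)

Section RunsInv.
Variable f : nat -> nat.
Lemma runs_prec_inv c d w y : runs f (CPrec c d) w y -> exists x n, w = pairn x n /\
  if n is n'.+1 then exists2 y', runs f (CPrec c d) (pairn x n') y' & runs f d (pairn x (pairn n' y')) y
  else runs f c x y.
Proof.
move=> h; inversion h; subst.
- by exists x, 0.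
- by exists x, n.+1; split=> //; exists y0.
Qed.
Lemma runs_mu_inv c w n : runs f (CMu c) w n -> exists x m, [/\ w = pairn x m, m <= n,
  runs f c (pairn x n) 0 & forall i, m <= i < n -> exists v, runs f c (pairn x i) v.+1].
Proof.
move E : (CMu c) => d h; elim: h E => //.
- move=> c' x k h1 _ [ec]; rewrite -ec in h1; exists x, k; split=> // i.
  by case: ltngtP.
- move=> c' x m v k h1 _ h2 IH [ec]; subst c'; have [x' [m' [e mk h0 hi]]] := IH erefl.
  have [? ?] := pairn_inj e; subst x' m'; exists x, m; split=> //; first exact: ltnW.
  move=> i; rewrite leq_eqVlt => /andP[/orP[/eqP<- _|mi ik]]; first by exists v.
  by apply: hi; rewrite mi.
Qed.
Lemma runs_mu_intro c x m n : m <= n -> runs f c (pairn x n) 0 ->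
  (forall i, m <= i < n -> exists v, runs f c (pairn x i) v.+1) -> runs f (CMu c) (pairn x m) n.
Proof.
move=> mn h0 hi; have [k ek] : exists k, n = k + m by exists (n - m); rewrite subnK.
elim: k m ek {mn} hi => [|k IH] m ek hi; first by rewrite ek in h0 *; apply: runs_mu0.
have [v hv] : exists v, runs f c (pairn x m) v.+1 by apply: hi; rewrite leqnn ek /=; lia.
apply: runs_muS hv _; apply: IH; first by rewrite ek; lia.
by move=> i ?; apply: hi; lia.
Qed.

Lemma runs_det c x y y' : runs f c x y -> runs f c x y' -> y = y'.
Proof.
elim: c x y y' => [||||| c IHc d IHd| c IHc d IHd| c IHc d IHd| c IHc] x y y'.
- by move=> h h'; inversion h; inversion h'.
- by move=> h h'; inversion h; inversion h'; subst.
- by move=> h h'; inversion h; inversion h'; subst; have [] := pairn_inj H2.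
- by move=> h h'; inversion h; inversion h'; subst; have [] := pairn_inj H2.
- by move=> h h'; inversion h; inversion h'; subst.
- move=> h h'; inversion h; inversion h'; subst.
  by rewrite (IHc _ _ _ H1 H7) (IHd _ _ _ H4 H10).
- move=> h h'; inversion h; inversion h'; subst.
  by have e := IHd _ _ _ H1 H7; subst; apply: IHc H4 H10.
- rewrite -(pair_p x); elim: (p2 x) y y' => [|n IH] y y' h h'.
    have [a [m [/pairn_inj [<- <-] h1]]] := runs_prec_inv h.
    have [a' [m' [/pairn_inj [<- <-] h1']]] := runs_prec_inv h'.
    exact: IHc h1 h1'.
  have [a [m [/pairn_inj [<- <-] [b h1 h2]]]] := runs_prec_inv h.
  have [a' [m' [/pairn_inj [<- <-] [b' h1' h2']]]] := runs_prec_inv h'.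
  have e := IH _ _ h1 h1'; subst b'; exact: IHd h2 h2'.
- move=> /runs_mu_inv [a [m [-> my h0 hi]]] /runs_mu_inv [a' [m' [/pairn_inj [<- <-] my' h0' hi']]].
  apply/eqP; rewrite eqn_leq; apply/andP; split; rewrite leqNgt; apply/negP => lt.
    have [|v hv] := hi y'; first by rewrite my'.
    by have := IHc _ _ _ h0' hv.
  have [|v hv] := hi' y; first by rewrite my.
  by have := IHc _ _ _ h0 hv.
Qed.
End RunsInv.

Lemma code_num_inj : injective code_num.
Proof.
elim=> [||||| c IHc d IHd| c IHc d IHd| c IHc d IHd| c IHc];
case=> [||||| c' d'| c' d'| c' d'| c'] //= /pairn_inj [] //.
- by move=> _ /pairn_inj [/IHc -> /IHd ->].
- by move=> _ /pairn_inj [/IHc -> /IHd ->].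
- by move=> _ /pairn_inj [/IHc -> /IHd ->].
- by move=> _ /IHc ->.
Qed.

Lemma phi_det e x y y' : phi e x y -> phi e x y' -> y = y'.
Proof.
by move=> [c <- h] [c' /code_num_inj -> h']; apply: runs_det h h'.
Qed.

(** * Substitution of a computed function for the oracle *)

Section Subst.
Variable t : Defs.code.
(* Replaces oracle calls by t, passing the parameter z of <z, x> along. *)
Fixpoint csub (c : Defs.code) : Defs.code :=
  match c with
  | CZero => CZero
  | CSucc => CComp CSucc CSnd
  | CFst => CComp CFst CSnd
  | CSnd => CComp CSnd CSnd
  | COracle => t
  | CPair c d => CPair (csub c) (csub d)
  | CComp c d => CComp (csub c) (CPair CFst (csub d))
  | CPrec c d => CComp (CPrec (csub c)
       (CComp (csub d) (CPair (CComp CFst CFst) (CPair (CComp CSnd CFst) CSnd))))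
       (CPair (CPair CFst (CComp CFst CSnd)) (CComp CSnd CSnd))
  | CMu c => CComp (CMu
       (CComp (csub c) (CPair (CComp CFst CFst) (CPair (CComp CSnd CFst) CSnd))))
       (CPair (CPair CFst (CComp CFst CSnd)) (CComp CSnd CSnd))
  end.

Variables (f g : nat -> nat) (z : nat).
Hypothesis ht : forall q, runs f t (pairn z q) (g q).

(** [CPrec] and [CMu] expect their running variable as second component; regrouping makes z part of
    the parameter that stays fixed during the recursion or search. *)
Lemma runs_assoc x n : runs f (CPair (CPair CFst (CComp CFst CSnd)) (CComp CSnd CSnd))
  (pairn z (pairn x n)) (pairn (pairn z x) n).
Proof.
apply: runs_pair; [apply: runs_pair; [exact: runs_fst|] |];
by apply: runs_comp (runs_snd _ _ _) _; constructor.
Qed.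
Lemma runs_unassoc x n : runs f (CPair (CComp CFst CFst) (CPair (CComp CSnd CFst) CSnd))
  (pairn (pairn z x) n) (pairn z (pairn x n)).
Proof.
apply: runs_pair; first by apply: runs_comp (runs_fst _ _ _) _; constructor.
apply: runs_pair; last exact: runs_snd.
by apply: runs_comp (runs_fst _ _ _) _; constructor.
Qed.

Lemma csub_runs c w y : runs g c w y -> runs f (csub c) (pairn z w) y.
Proof.
elim: c w y => [||||| c IHc d IHd| c IHc d IHd| c IHc d IHd| c IHc] w y h /=.
- by inversion h; apply: runs_zero.
- by inversion h; subst; apply: runs_comp (runs_snd _ _ _) _; apply: runs_succ.
- by inversion h; subst; apply: runs_comp (runs_snd _ _ _) _; apply: runs_fst.
- by inversion h; subst; apply: runs_comp (runs_snd _ _ _) _; apply: runs_snd.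
- by inversion h; subst.
- by inversion h; subst; apply: runs_pair; auto.
- inversion h; subst; apply: runs_comp (IHc _ _ H4).
  by apply: runs_pair (IHd _ _ H1); apply: runs_fst.
- have [x [n [e _]]] := runs_prec_inv h; subst w.
  apply: runs_comp (runs_assoc _ _) _.
  elim: n y h => [|n IH] y /runs_prec_inv [x' [n' [/pairn_inj [<- <-]]]].
    by move=> h; apply: runs_prec0; apply: IHc.
  move=> [y' h1 h2]; apply: runs_precS (IH _ h1) _.
  by apply: runs_comp (runs_unassoc _ _) _; apply: IHd.
- have [x [m [-> my h0 hi]]] := runs_mu_inv h.
  apply: runs_comp (runs_assoc _ _) _; apply: runs_mu_intro => //.
    by apply: runs_comp (runs_unassoc _ _) _; apply: IHc.
  move=> i /hi [v hv]; exists v.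
  by apply: runs_comp (runs_unassoc _ _) _; apply: IHc.
Qed.
End Subst.

(** Witnesses of several function quantifiers are packed into one oracle; this lemma is what allows
    a functional to be run on an unpacked or repacked part of it. *)
Lemma cmp_subst (F : (nat -> nat) -> nat -> nat) (Th : (nat -> nat) -> nat -> nat -> nat) W :
  cmp F -> cmp (fun f z => Th f (p1 z) (p2 z)) -> cmp W ->
  cmp (fun f x => F (fun q => Th f x q) (W f x)).
Proof.
move=> [c hc] [t ht] hW.
apply: (@cmp_comp2 (fun f x => F (Th f x)) (fun f x => x)) => //; last exact: cmp_x.
exists (csub t c) => f z; rewrite -{1}(pair_p z); apply: csub_runs (hc _ _) => q.
by have := ht f (pairn (p1 z) q); rewrite !pE.
Qed.

(** * A clocked evaluator *)

(* Partial values are coded in nat: 0 is undefined and v.+1 is v. *)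
Definition obind (a : nat) (k : nat -> nat) := if a is v.+1 then k v else 0.
Definition evprec (g h : nat -> nat) x := natrec (g (p1 x))
  (fun n r => obind r (fun y => h (pairn (p1 x) (pairn n y)))) (p2 x).
(* search states <0, m>: searching at m; <1, m>: found m; <2, m>: failed *)
Definition evmu_step (g : nat -> nat) x st :=
  if p1 st == 0 then
    if g (pairn x (p2 st)) == 0 then pairn 2 0 else
    if g (pairn x (p2 st)) == 1 then pairn 1 (p2 st) else pairn 0 (p2 st).+1
  else st.
Definition evmu_out st := if p1 st == 1 then (p2 st).+1 else 0.
Definition evmu (g : nat -> nat) s x :=
  evmu_out (iter s (evmu_step g (p1 x)) (pairn 0 (p2 x))).

(** The recursion is structural in the program, so the clock s has to bound only the unbounded
    searches. The oracle [o] is partial, in the same coding of undefined values as the result. *)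
Fixpoint ev (o : nat -> nat) (s : nat) (c : Defs.code) (x : nat) : nat :=
  match c with
  | CZero => 1
  | CSucc => x.+2
  | CFst => (p1 x).+1
  | CSnd => (p2 x).+1
  | COracle => o x
  | CPair c d => obind (ev o s c x) (fun y => obind (ev o s d x) (fun z => (pairn y z).+1))
  | CComp c d => obind (ev o s d x) (ev o s c)
  | CPrec c d => evprec (ev o s c) (ev o s d) x
  | CMu c => evmu (ev o s c) s x
  end.

Lemma evmu_found (g : nat -> nat) s x m : iter s (evmu_step g x) (pairn 1 m) = pairn 1 m.
Proof. by elim: s => //= s ->; rewrite /evmu_step pE. Qed.
Lemma evmu_failed (g : nat -> nat) s x m : iter s (evmu_step g x) (pairn 2 m) = pairn 2 m.
Proof. by elim: s => //= s ->; rewrite /evmu_step pE. Qed.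

Lemma evmu_stepE g x m : evmu_step g x (pairn 0 m) =
  if g (pairn x m) == 0 then pairn 2 0 else if g (pairn x m) == 1 then pairn 1 m else pairn 0 m.+1.
Proof. by rewrite /evmu_step !pE. Qed.

Lemma evmu_sound (g : nat -> nat) s x m n : evmu g s (pairn x m) = n.+1 ->
  [/\ m <= n, g (pairn x n) = 1 & forall i, m <= i < n -> exists v, g (pairn x i) = v.+2].
Proof.
rewrite /evmu !pE; elim: s m => [|s IH] m; first by rewrite /= /evmu_out pE.
rewrite iterSr evmu_stepE; case E : (g (pairn x m)) => [|[|v]] /=.
- by rewrite evmu_failed /evmu_out pE.
- by rewrite evmu_found /evmu_out !pE /= => -[<-]; split=> // i; case: ltngtP.
- move=> /IH [h1 h2 h3]; split=> //; first exact: ltnW.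
  move=> i /andP[]; rewrite leq_eqVlt => /orP[/eqP<- _|mi ik]; first by exists v.
  by apply: h3; rewrite mi.
Qed.
Lemma evmu_complete (g : nat -> nat) s x m n : m <= n -> n < m + s -> g (pairn x n) = 1 ->
  (forall i, m <= i < n -> exists v, g (pairn x i) = v.+2) -> evmu g s (pairn x m) = n.+1.
Proof.
rewrite /evmu !pE; elim: s m => [|s IH] m mn ns g1 gi.
  by move: ns; rewrite addn0 ltnNge mn.
rewrite iterSr evmu_stepE; move: mn; rewrite leq_eqVlt => /orP[/eqP e|mn].
  by rewrite e g1 /= evmu_found /evmu_out !pE.
have [v hv] : exists v, g (pairn x m) = v.+2 by apply: gi; rewrite leqnn.
rewrite hv /=; apply: IH => //; first by lia.
by move=> i /andP[h1 h2]; apply: gi; rewrite h2 andbT; apply: ltnW.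
Qed.

Lemma ev_sound f o s c x y : (forall q v, o q = v.+1 -> f q = v) -> ev o s c x = y.+1 -> runs f c x y.
Proof.
move=> ho; elim: c x y => [||||| c IHc d IHd| c IHc d IHd| c IHc d IHd| c IHc] x y /=.
- by move=> [<-]; apply: runs_zero.
- by move=> [<-]; apply: runs_succ.
- by move=> [<-]; rewrite -{1}(pair_p x); apply: runs_fst.
- by move=> [<-]; rewrite -{1}(pair_p x); apply: runs_snd.
- by move=> /ho <-; apply: runs_oracle.
- case E1 : (ev o s c x) => [//|a] /=; case E2 : (ev o s d x) => [//|b] /= [<-].
  by apply: runs_pair; [apply: IHc | apply: IHd].
- case E1 : (ev o s d x) => [//|a] /= h.
  by apply: runs_comp (IHd _ _ E1) (IHc _ _ h).
- rewrite /evprec; have := pair_p x; move: (p1 x) (p2 x) => a m <- {x}.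
  elim: m y => [|n IH] y /=; first by move=> h; apply: runs_prec0; apply: IHc.
  case E : (natrec _ _ n) => [//|v] /= h.
  by apply: runs_precS (IH _ E) (IHd _ _ h).
- rewrite -(pair_p x) => /evmu_sound [h1 h2 h3]; apply: runs_mu_intro => //; first exact: IHc.
  by move=> i /h3 [v hv]; exists v; apply: IHc.
Qed.

Lemma bounded_ex (P : nat -> nat -> Prop) m n :
  (forall i, m <= i < n -> exists B, forall s, B <= s -> P i s) ->
  exists B, forall i s, m <= i < n -> B <= s -> P i s.
Proof.
elim: n => [|n IH] h; first by exists 0 => i s; rewrite ltn0 andbF.
have [|B hB] := IH; first by move=> i /andP[h1 h2]; apply: h; rewrite h1 ltnW.
have [mn|nm] := leqP m n; last by exists B => i s /andP[h1 h2]; lia.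
have [|B' hB'] := h n; first by rewrite mn /=.
exists (maxn B B') => i s /andP[h1]; rewrite geq_max ltnS leq_eqVlt => /orP[/eqP->|h2] /andP[b1 b2].
  exact: hB'.
by apply: hB => //; rewrite h1.
Qed.

(** The use principle: a halting computation makes finitely many queries and search steps, so a long
    enough finite part of the oracle and a large enough clock reproduce it. *)
Lemma ev_complete f c x y : runs f c x y -> exists B, forall s, B <= s ->
  forall o, (forall q, q < s -> o q = (f q).+1) -> ev o s c x = y.+1.
Proof.
elim: c x y => [||||| c IHc d IHd| c IHc d IHd| c IHc d IHd| c IHc] x y h /=.
- by inversion h; exists 0.
- by inversion h; exists 0.
- by inversion h; exists 0; rewrite pE.
- by inversion h; exists 0; rewrite pE.
- by inversion h; exists x.+1 => s xs o ho; apply: ho.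
- inversion h; subst; have [B hB] := IHc _ _ H1; have [B' hB'] := IHd _ _ H4.
  exists (maxn B B') => s; rewrite geq_max => /andP[b1 b2] o ho.
  by rewrite hB // hB'.
- inversion h; subst; have [B hB] := IHd _ _ H1; have [B' hB'] := IHc _ _ H4.
  exists (maxn B B') => s; rewrite geq_max => /andP[b1 b2] o ho.
  by rewrite hB //= hB'.
- have [a [n [e _]]] := runs_prec_inv h; subst x; rewrite /evprec !pE.
  elim: n y h => [|n IH] y /runs_prec_inv [x' [n' [/pairn_inj [<- <-]]]] /=; first exact: IHc.
  move=> [y' h1 /IHd [B hB]]; have [B' hB'] := IH _ h1.
  exists (maxn B B') => s; rewrite geq_max => /andP[b1 b2] o ho.
  by rewrite (hB' s) // /= hB.
- have [a [m [-> my h0 hi]]] := runs_mu_inv h.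
  have [B hB] := IHc _ _ h0.
  have [|B' hB'] := @bounded_ex (fun i s => forall o, (forall q, q < s -> o q = (f q).+1) ->
     exists v, ev o s c (pairn a i) = v.+2) m y.
    move=> i /hi [v /IHc [D hD]]; exists D => s Ds o ho; exists v; exact: hD.
  exists (maxn (maxn B B') y.+1) => s; rewrite !geq_max => /andP[/andP[b1 b2] b3] o ho.
  apply: evmu_complete => //; first lia.
    exact: hB.
  by move=> i hi'; apply: hB'.
Qed.

Lemma cmp_obind A (K : (nat -> nat) -> nat -> nat -> nat) :
  cmp A -> cmp (fun f z => K f (p1 z) (p2 z)) -> cmp (fun f x => obind (A f x) (fun v => K f x v)).
Proof.
move=> hA hK.
apply: (@cmp_ext (fun f x => if A f x == 0 then 0 else K f x (A f x).-1)).
  by move=> f x; case: (A f x).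
apply: cmp_if; [by cmp | by cmp |].
by apply: (@cmp_comp2 K (fun f x => x)) => //; cmp.
Qed.

Lemma cmp_evprec (g h : (nat -> nat) -> nat -> nat -> nat) X :
  cmp (fun f z => g f (p1 z) (p2 z)) -> cmp (fun f z => h f (p1 z) (p2 z)) -> cmp X ->
  cmp (fun f x => evprec (g f x) (h f x) (X f x)).
Proof.
move=> hg hh hX; apply: cmp_rec; last by cmp.
  by apply: (@cmp_comp2 g (fun f x => x)) => //; cmp.
apply: (@cmp_obind _ (fun f z y => h f (p1 z) (pairn (p1 (X f (p1 z))) (pairn (p1 (p2 z)) y)))); first by cmp.
apply: (@cmp_comp2 h) => //; first by cmp.
apply: cmp_pair; last by cmp.
by apply: cmp_p1; apply: (cmp_comp hX); cmp.
Qed.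
Lemma cmp_evmu (g : (nat -> nat) -> nat -> nat -> nat) S X :
  cmp (fun f z => g f (p1 z) (p2 z)) -> cmp S -> cmp X ->
  cmp (fun f x => evmu (g f x) (S f x) (X f x)).
Proof.
move=> hg hS hX.
have hi : cmp (fun f x => iter (S f x) (evmu_step (g f x) (p1 (X f x))) (pairn 0 (p2 (X f x)))).
  apply: (@cmp_iter (fun f x => evmu_step (g f x) (p1 (X f x)))); [|by cmp|by cmp].
  have hX1 : cmp (fun f z => X f (p1 z)) by apply: (cmp_comp hX); cmp.
  have hG : cmp (fun f z => g f (p1 z) (pairn (p1 (X f (p1 z))) (p2 (p2 z)))).
    by apply: (@cmp_comp2 g) => //; cmp.
  by rewrite /evmu_step; cmp.
by rewrite /evmu /evmu_out; cmp.
Qed.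

Lemma cmp_evS c : cmp (fun f z => ev (fun q => f q) (p1 z) c (p2 z)).
Proof.
elim: c => [||||| c IHc d IHd| c IHc d IHd| c IHc d IHd| c IHc] /=.
1-5: by cmp.
all: have cc A B : cmp A -> cmp B -> cmp (fun f x => ev (fun q => f q) (A f x) c (B f x));
  first by exact: (@cmp_comp2 (fun f a b => ev (fun q => f q) a c b)).
1-3: have cd A B : cmp A -> cmp B -> cmp (fun f x => ev (fun q => f q) (A f x) d (B f x));
  first by exact: (@cmp_comp2 (fun f a b => ev (fun q => f q) a d b)).
- apply: (@cmp_obind _ (fun f z y => obind (ev (fun q => f q) (p1 z) d (p2 z)) (fun v => (pairn y v).+1))).
    by apply: cc; cmp.
  apply: (@cmp_obind _ (fun f z v => (pairn (p2 z) v).+1)); last by cmp.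
  by apply: cd; cmp.
- apply: (@cmp_obind _ (fun f z y => ev (fun q => f q) (p1 z) c y)).
    by apply: cd; cmp.
  by apply: cc; cmp.
- apply: (@cmp_evprec (fun f z => ev (fun q => f q) (p1 z) c) (fun f z => ev (fun q => f q) (p1 z) d)); last by cmp.
    by apply: cc; cmp.
  by apply: cd; cmp.
- apply: (@cmp_evmu (fun f z => ev (fun q => f q) (p1 z) c)); [|by cmp|by cmp].
  by apply: cc; cmp.
Qed.

(* The clocked evaluation of all codes at once, as a table T <e, x> which refers
   to itself at smaller codes only. *)
Fixpoint isc (d e : nat) : bool := if d is d'.+1 then
  let t := p1 e in let a := p2 e in
  if t <= 4 then a == 0 else
  if t <= 7 then isc d' (p1 a) && isc d' (p2 a) else
  (t == 8) && isc d' a else false.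

(** One unfolding of the evaluator for the zero oracle; tag 4 yields 1, which codes the answer 0. As
    the table T is an argument, being a correct table is a universal condition on T with a
    computable matrix. *)
Definition evtab (s : nat) (T : nat -> nat) (e x : nat) : nat :=
  let t := p1 e in let a := p2 e in
  let T1 := fun y => T (pairn (p1 a) y) in let T2 := fun y => T (pairn (p2 a) y) in
  if t == 0 then 1 else if t == 1 then x.+2 else if t == 2 then (p1 x).+1 else
  if t == 3 then (p2 x).+1 else if t == 4 then 1 else
  if t == 5 then obind (T1 x) (fun y => obind (T2 x) (fun z => (pairn y z).+1)) else
  if t == 6 then obind (T2 x) T1 else
  if t == 7 then evprec T1 T2 x else evmu (fun y => T (pairn a y)) s x.

Lemma isc_code d c : code_num c < d -> isc d (code_num c).
Proof.
elim: d c => // d IH; case=> [||||| c1 c2| c1 c2| c1 c2| c1] /=; rewrite ?pE //= => h.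
4: by apply: IH; have := @pairn_gt 8 (code_num c1) isT; lia.
1: have h1 := @pairn_gt 5 (pairn (code_num c1) (code_num c2)) isT.
2: have h1 := @pairn_gt 6 (pairn (code_num c1) (code_num c2)) isT.
3: have h1 := @pairn_gt 7 (pairn (code_num c1) (code_num c2)) isT.
all: have := pairn_ge (code_num c1) (code_num c2) => h2.
all: by rewrite !IH //; lia.
Qed.
Lemma code_isc d e : isc d e -> exists c, code_num c = e.
Proof.
elim: d e => // d IH e /=; have := pair_p e; move: (p1 e) (p2 e) => t a <-.
case: t => [|[|[|[|[|[|[|[|[|t]]]]]]]]] //=.
- by move=> /eqP->; exists CZero. - by move=> /eqP->; exists CSucc.
- by move=> /eqP->; exists CFst. - by move=> /eqP->; exists CSnd.
- by move=> /eqP->; exists COracle.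
- by move=> /andP[/IH [c hc] /IH [c' hc']]; exists (CPair c c'); rewrite /= hc hc' pair_p.
- by move=> /andP[/IH [c hc] /IH [c' hc']]; exists (CComp c c'); rewrite /= hc hc' pair_p.
- by move=> /andP[/IH [c hc] /IH [c' hc']]; exists (CPrec c c'); rewrite /= hc hc' pair_p.
- by move=> /IH [c hc]; exists (CMu c); rewrite /= hc.
Qed.

Lemma evmu_ext g g' s x : g =1 g' -> evmu g s x = evmu g' s x.
Proof.
move=> h; rewrite /evmu; suff -> : iter s (evmu_step g (p1 x)) (pairn 0 (p2 x)) =
  iter s (evmu_step g' (p1 x)) (pairn 0 (p2 x)) by [].
by elim: s => //= s ->; rewrite /evmu_step h.
Qed.
Lemma evprec_ext g g' h h' x : g =1 g' -> h =1 h' -> evprec g h x = evprec g' h' x.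
Proof.
move=> hg hh; rewrite /evprec; elim: (p2 x) => [|n IH] /=; first exact: hg.
by rewrite IH; case: (natrec _ _ n) => //= v; rewrite hh.
Qed.

Lemma evtab_ev s T : (forall e x, T (pairn e x) = evtab s T e x) ->
  forall c x, T (pairn (code_num c) x) = ev (fun=> 1) s c x.
Proof.
move=> hT; elim=> [||||| c IHc d IHd| c IHc d IHd| c IHc d IHd| c IHc] x;
  rewrite hT /evtab; cbn [code_num ev]; rewrite !pE //=.
- by rewrite IHc IHd.
- by rewrite IHd; case: (ev _ _ _ _) => //= v; rewrite IHc.
- by apply: evprec_ext => y; rewrite ?IHc ?IHd.
- by apply: evmu_ext => y; rewrite IHc.
Qed.

Lemma evtab_local s T T' e x : (forall q, p1 q < e -> T q = T' q) -> evtab s T e x = evtab s T' e x.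
Proof.
move=> h; have h8 a y : 0 < p1 e -> a <= p2 e -> T (pairn a y) = T' (pairn a y).
  move=> h1 h2; apply: h; rewrite p1_pair; apply: leq_ltn_trans h2 _.
  by rewrite -{2}(pair_p e); apply: pairn_gt.
rewrite /evtab; case: eqP => // /eqP; rewrite -lt0n => e0.
have E1 y := h8 _ y e0 (p1_le (p2 e)); have E2 y := h8 _ y e0 (p2_le (p2 e)).
have E3 y := h8 _ y e0 (leqnn (p2 e)).
do 4 (case: eqP => // _).
case: eqP => [_|_]; first by rewrite E1 E2.
case: eqP => [_|_]; first by rewrite E2; case: (T' _) => //= v; rewrite E1.
case: eqP => [_|_]; first exact: evprec_ext.
exact: evmu_ext.
Qed.

(** Recursion on the code, with fuel: by [evtab_local] only entries with smaller codes are
    consulted. *)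
Lemma evtab_ex s : exists T, forall e x, T (pairn e x) = evtab s T e x.
Proof.
pose B := fix B d e x := if d is d'.+1 then
  evtab s (fun q => if p1 q < e then B d' (p1 q) (p2 q) else 0) e x else 0.
have BS d e x : B d.+1 e x =
  evtab s (fun q => if p1 q < e then B d (p1 q) (p2 q) else 0) e x by [].
have hB d d' e x : e < d -> e < d' -> B d e x = B d' e x.
  elim: d d' e x => // d IH [//|d'] e x h1 h2; rewrite !BS.
  apply: evtab_local => q qe; rewrite qe; apply: IH; exact: leq_trans qe _.
exists (fun q => B (p1 q).+1 (p1 q) (p2 q)) => e x; rewrite !pE BS.
by apply: evtab_local => q qe; rewrite qe; apply: hB.
Qed.

Lemma phi_table e x y : phi e x y <-> isc e.+1 e /\
  exists s T, (forall e x, T (pairn e x) = evtab s T e x) /\ T (pairn e x) = y.+1.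
Proof.
split=> [[c <- /ev_complete [B hB]]|[/code_isc [c <-] [s [T [hT]]]]].
  split; first exact: isc_code.
  have [T hT] := evtab_ex B; exists B, T; split=> //.
  by rewrite (evtab_ev hT) hB.
by rewrite (evtab_ev hT) => h; exists c => //; apply: ev_sound h => q v [<-].
Qed.

Lemma isc_mono d d' e : e < d -> e < d' -> isc d e = isc d' e.
Proof.
elim: d d' e => // d IH [//|d'] e h h' /=.
have hp := pair_p e; case: ifP => // t4.
have a_e : p2 e < e by rewrite -{2}hp; apply: pairn_gt; lia.
have b1 := p1_le (p2 e); have b2 := p2_le (p2 e).
by rewrite !(IH d') //; lia.
Qed.

Lemma cmp_isc F : cmp F -> cmp (fun f x => isc (F f x).+1 (F f x)).
Proof.
move=> hF; apply: (@cmp_cov (fun f x e => isc e.+1 e) (fun f x e h =>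
  let t := p1 e in let a := p2 e in
  if t <= 4 then a == 0 else
  if t <= 7 then (lookup h (e - (p1 a).+1) == 1) && (lookup h (e - (p2 a).+1) == 1) else
  (t == 8) && (lookup h (e - a.+1) == 1)) (fun f x => 0)); [by cbv zeta; cmp| |by cmp|exact: hF].
move=> f x e h hh; rewrite [in RHS]/=; cbv zeta.
case: ifP => // t4.
have a_e : p2 e < e by rewrite -{2}(pair_p e); apply: pairn_gt; lia.
have b1 := p1_le (p2 e); have b2 := p2_le (p2 e).
have E a : a < e -> (lookup h (e - a.+1) == 1) = isc e a.
  by move=> ae; rewrite hh // (@isc_mono _ e) //; case: (isc e a).
by rewrite !E //; lia.
Qed.

Lemma cmp_evtab : cmp (fun f z => evtab (p1 z) f (p1 (p2 z)) (p2 (p2 z))).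
Proof.
rewrite /evtab.
have co (g : nat -> nat) : cmp (fun _ => g) -> cmp (fun f z => f (pairn (g (p1 (p2 z))) (p2 (p2 z)))).
  by move=> hg; apply: cmp_oracle; apply: cmp_pair; [apply: (cmp_comp hg); cmp | cmp].
have c5 : cmp (fun f z => obind (f (pairn (p1 (p2 (p1 (p2 z)))) (p2 (p2 z))))
    (fun y => obind (f (pairn (p2 (p2 (p1 (p2 z)))) (p2 (p2 z)))) (fun v => (pairn y v).+1))).
  apply: (@cmp_obind _ (fun f z y => obind (f (pairn (p2 (p2 (p1 (p2 z)))) (p2 (p2 z)))) (fun v => (pairn y v).+1))).
    by cmp.
  by apply: (@cmp_obind _ (fun f z v => (pairn (p2 z) v).+1)); cmp.
have c6 : cmp (fun f z => obind (f (pairn (p2 (p2 (p1 (p2 z)))) (p2 (p2 z))))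
    (fun y => f (pairn (p1 (p2 (p1 (p2 z)))) y))).
  by apply: (@cmp_obind _ (fun f z y => f (pairn (p1 (p2 (p1 (p2 z)))) y))); cmp.
have c7 : cmp (fun f z => evprec (fun y => f (pairn (p1 (p2 (p1 (p2 z)))) y))
    (fun y => f (pairn (p2 (p2 (p1 (p2 z)))) y)) (p2 (p2 z))).
  by apply: (@cmp_evprec (fun f z y => f (pairn (p1 (p2 (p1 (p2 z)))) y))
    (fun f z y => f (pairn (p2 (p2 (p1 (p2 z)))) y))); cmp.
have c8 : cmp (fun f z => evmu (fun y => f (pairn (p2 (p1 (p2 z))) y)) (p1 z) (p2 (p2 z))).
  by apply: (@cmp_evmu (fun f z y => f (pairn (p2 (p1 (p2 z))) y))); cmp.
by repeat (apply: cmp_if; [by cmp | by cmp | ]).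
Qed.

(** * Closure properties of Sigma^1_1 predicates *)

Definition jn (f g : nat -> nat) n := if p1 n == 0 then f (p2 n) else g (p2 n).
Definition col (g : nat -> nat) k n := g (pairn k n).
Lemma col_jn0 f g : col (jn f g) 0 = f.
Proof. by apply/funext => n; rewrite /col /jn !pE. Qed.
Lemma col_jn1 f g : col (jn f g) 1 = g.
Proof. by apply/funext => n; rewrite /col /jn !pE. Qed.
Lemma cols_ex (G : nat -> nat -> nat) : exists g, forall k, col g k = G k.
Proof. by exists (fun n => G (p1 n) (p2 n)) => k; apply/funext => n; rewrite /col !pE. Qed.

(** The parameter f holds the functions quantified further out; the witness g joins it as a second
    column, so function quantifiers can be absorbed one at a time. *)
Definition Sig (Q : (nat -> nat) -> nat -> Prop) := exists2 R : (nat -> nat) -> nat -> nat, cmp R &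
  forall f x, Q f x <-> exists g, forall y, R (jn f g) (pairn x y) <> 0.

Lemma Sig_ext Q Q' : (forall f x, Q f x <-> Q' f x) -> Sig Q -> Sig Q'.
Proof. by move=> h [R cR hR]; exists R => // f x; rewrite -h. Qed.

Lemma cmp_jn (A B : (nat -> nat) -> nat -> nat -> nat) :
  cmp (fun f z => A f (p1 z) (p2 z)) -> cmp (fun f z => B f (p1 z) (p2 z)) ->
  cmp (fun f z => jn (A f (p1 z)) (B f (p1 z)) (p2 z)).
Proof.
move=> hA hB; rewrite /jn.
have h (E : (nat -> nat) -> nat -> nat -> nat) : cmp (fun f z => E f (p1 z) (p2 z)) ->
   cmp (fun f z => E f (p1 z) (p2 (p2 z))) by move=> hE; apply: (@cmp_comp2 E) => //; cmp.
by have := h A hA; have := h B hB => h1 h2; cmp.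
Qed.

Lemma Sig_bool (b : (nat -> nat) -> nat -> bool) : cmp (fun f x => b f x) -> Sig (fun f x => b f x).
Proof.
move=> hb; exists (fun h z => b (fun q => h (pairn 0 q)) (p1 z)).
  by apply: (@cmp_subst (fun f x => b f x) (fun h z q => h (pairn 0 q)) (fun h z => p1 z)); cmp.
move=> f x; rewrite -/(col _ 0); split=> [bfx|[g /(_ 0)]].
  by exists (fun=> 0) => y; rewrite -[fun q => _]/(col _ 0) col_jn0 pE bfx.
by rewrite -[fun q => _]/(col _ 0) col_jn0 pE; case: (b f x).
Qed.

Lemma Sig_sub (Q : (nat -> nat) -> nat -> Prop) (Th : (nat -> nat) -> nat -> nat -> nat) W : Sig Q ->
  cmp (fun f z => Th f (p1 z) (p2 z)) -> cmp W -> Sig (fun f x => Q (Th f x) (W f x)).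
Proof.
move=> [R cR hR] hT hW.
exists (fun h z => R (fun q => jn (Th (fun q => h (pairn 0 q)) (p1 z)) (fun q => h (pairn 1 q)) q)
   (pairn (W (fun q => h (pairn 0 q)) (p1 z)) (p2 z))).
  apply: (@cmp_subst R (fun h z q => jn (Th (fun q => h (pairn 0 q)) (p1 z)) (fun q => h (pairn 1 q)) q)) => //.
    apply: (@cmp_jn (fun h z q => Th (fun q => h (pairn 0 q)) (p1 z) q) (fun h z q => h (pairn 1 q))).
      have c1 : cmp (fun h z => h (pairn 0 (p2 z))) by cmp.
      have c2 : cmp (fun h z => pairn (p1 (p1 z)) (p2 z)) by cmp.
      have := @cmp_subst _ (fun h z q => h (pairn 0 q)) _ hT c1 c2.
      by apply: cmp_ext => h z; rewrite !pE.
    by cmp.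
  apply: cmp_pair; last by cmp.
  by apply: (@cmp_subst W (fun h z q => h (pairn 0 q))) => //; cmp.
move=> f x; rewrite hR; split=> -[g hg]; exists g => y; have := hg y;
  by rewrite -[fun q => jn f g (pairn 0 q)]/(col _ 0) -[fun q => jn f g (pairn 1 q)]/(col _ 1) col_jn0 col_jn1 !pE.
Qed.

Lemma Sig_subst (Q : (nat -> nat) -> nat -> Prop) W : Sig Q -> cmp W -> Sig (fun f x => Q f (W f x)).
Proof.
move=> hQ hW; have := @Sig_sub Q (fun f x q => f q) W hQ _ hW.
by apply; cmp.
Qed.

(** A witness is chosen for each n, and all of them are stored as the columns of one function. *)
Lemma Sig_all (Q : (nat -> nat) -> nat -> nat -> Prop) :
  Sig (fun f z => Q f (p1 z) (p2 z)) -> Sig (fun f x => forall n, Q f x n).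
Proof.
move=> [R cR hR].
exists (fun h z => R (fun q => jn (fun q => h (pairn 0 q))
     (fun q => h (pairn 1 (pairn (p1 (p2 z)) q))) q) (pairn (pairn (p1 z) (p1 (p2 z))) (p2 (p2 z)))).
  apply: (@cmp_subst R (fun h z q => jn (fun q => h (pairn 0 q))
     (fun q => h (pairn 1 (pairn (p1 (p2 z)) q))) q)) => //; last by cmp.
  by apply: (@cmp_jn (fun h z q => h (pairn 0 q)) (fun h z q => h (pairn 1 (pairn (p1 (p2 z)) q)))); cmp.
have hQ f x n : Q f x n <-> exists g, forall y, R (jn f g) (pairn (pairn x n) y) <> 0.
  by have := hR f (pairn x n); rewrite !pE.
have E f g k : (fun q => jn f g (pairn 1 (pairn k q))) = col g k.
  by apply/funext => q; rewrite /jn !pE.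
move=> f x; split=> [h|[g hg] n].
  have ex n := iffLR (hQ f x n) (h n).
  have [g hg] := cols_ex (fun n => sval (cid (ex n))).
  exists g => y; rewrite -[fun q => jn f g (pairn 0 q)]/(col _ 0) col_jn0 E hg !pE.
  by case: cid.
apply/hQ; exists (col g n) => y; have := hg (pairn n y).
by rewrite -[fun q => jn f g (pairn 0 q)]/(col _ 0) col_jn0 E !pE.
Qed.

Lemma Sig_exf (Q : (nat -> nat) -> nat -> Prop) : Sig Q -> Sig (fun f x => exists g, Q (jn f g) x).
Proof.
move=> [R cR hR].
exists (fun h z => R (fun q => jn (fun q => jn (fun q => h (pairn 0 q)) (fun q => h (pairn 1 (pairn 0 q))) q)
     (fun q => h (pairn 1 (pairn 1 q))) q) z).
  apply: (@cmp_subst R (fun h z q => jn (fun q => jn (fun q => h (pairn 0 q)) (fun q => h (pairn 1 (pairn 0 q))) q)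
     (fun q => h (pairn 1 (pairn 1 q))) q)) => //; last by cmp.
  apply: (@cmp_jn (fun h z q => jn (fun q => h (pairn 0 q)) (fun q => h (pairn 1 (pairn 0 q))) q)
    (fun h z q => h (pairn 1 (pairn 1 q)))); last by cmp.
  by apply: (@cmp_jn (fun h z q => h (pairn 0 q)) (fun h z q => h (pairn 1 (pairn 0 q)))); cmp.
have E f g k : (fun q => jn f g (pairn 1 (pairn k q))) = col g k.
  by apply/funext => q; rewrite /jn !pE.
move=> f x; split=> [[g /hR [g' hg']]|[g hg]].
  exists (jn g g') => y; rewrite -[fun q => jn f _ (pairn 0 q)]/(col _ 0) col_jn0 !E col_jn0 col_jn1.
  exact: hg'.
exists (col g 0); apply/hR; exists (col g 1) => y; have := hg y.
by rewrite -[fun q => jn f _ (pairn 0 q)]/(col _ 0) col_jn0 !E.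
Qed.

(** The number is quantified as the value at 0 of a function. *)
Lemma Sig_ex (Q : (nat -> nat) -> nat -> nat -> Prop) :
  Sig (fun f z => Q f (p1 z) (p2 z)) -> Sig (fun f x => exists n, Q f x n).
Proof.
move=> hQ; pose Q' (f : nat -> nat) x := Q (fun q => f (pairn 0 q)) x (f (pairn 1 0)).
have hQ' : Sig Q'.
  have h1 : cmp (fun f z => f (pairn 0 (p2 z))) by cmp.
  have h2 : cmp (fun f x => pairn x (f (pairn 1 0))) by cmp.
  have := @Sig_sub _ (fun f x q => f (pairn 0 q)) _ hQ h1 h2.
  by apply: Sig_ext => f x; rewrite !pE.
apply: Sig_ext (Sig_exf hQ') => f x; rewrite /Q'; split=> [[g]|[n hn]].
  by rewrite -[fun q => _]/(col _ 0) col_jn0 => h; exists (jn f g (pairn 1 0)).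
by exists (fun=> n); rewrite -[fun q => _]/(col _ 0) col_jn0 /jn !pE.
Qed.

Lemma Sig_impl (b : (nat -> nat) -> nat -> bool) (Q : (nat -> nat) -> nat -> Prop) :
  cmp (fun f x => b f x) -> Sig Q -> Sig (fun f x => b f x -> Q f x).
Proof.
move=> hb [R cR hR].
exists (fun h z => if b (fun q => h (pairn 0 q)) (p1 z) then R h z else 1).
  apply: cmp_if => //; last by cmp.
  by apply: (@cmp_subst (fun f x => b f x) (fun h z q => h (pairn 0 q)) (fun h z => p1 z)); cmp.
move=> f x; split=> [h|[g hg] bx].
  have [bx|bx] := boolP (b f x).
    have [g hg] := iffLR (hR f x) (h bx); exists g => y.
    by rewrite -[fun q => _]/(col _ 0) col_jn0 pE bx.
  by exists f => y; rewrite -[fun q => _]/(col _ 0) col_jn0 pE (negPf bx).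
apply/hR; exists g => y; have := hg y.
by rewrite -[fun q => _]/(col _ 0) col_jn0 pE bx.
Qed.

Lemma Sig_and Q Q' : Sig Q -> Sig Q' -> Sig (fun f x => Q f x /\ Q' f x).
Proof.
move=> [R cR hR] [R' cR' hR'].
have c k : cmp (fun h z => jn (fun q => h (pairn 0 q)) (fun q => h (pairn 1 (pairn k q))) (p2 z)).
  by apply: (@cmp_jn (fun h z q => h (pairn 0 q)) (fun h z q => h (pairn 1 (pairn k q)))); cmp.
exists (fun h z => R (fun q => jn (fun q => h (pairn 0 q)) (fun q => h (pairn 1 (pairn 0 q))) q) z *
  R' (fun q => jn (fun q => h (pairn 0 q)) (fun q => h (pairn 1 (pairn 1 q))) q) z).
  apply: cmp_mul.
    by apply: (@cmp_subst R (fun h z q => jn (fun q => h (pairn 0 q)) (fun q => h (pairn 1 (pairn 0 q))) q)) => //; cmp.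
  by apply: (@cmp_subst R' (fun h z q => jn (fun q => h (pairn 0 q)) (fun q => h (pairn 1 (pairn 1 q))) q)) => //; cmp.
have E f g k : (fun q => jn f g (pairn 1 (pairn k q))) = col g k.
  by apply/funext => q; rewrite /jn !pE.
move=> f x; rewrite hR hR'; split=> [[[g hg] [g' hg']]|[g hg]].
  exists (jn g g') => y; rewrite -[fun q => jn f _ (pairn 0 q)]/(col _ 0) col_jn0 !E col_jn0 col_jn1.
  by apply/eqP; rewrite muln_eq0 negb_or; apply/andP; split; apply/eqP.
split; [exists (col g 0) | exists (col g 1)] => y; have := hg y;
  by rewrite -[fun q => jn f _ (pairn 0 q)]/(col _ 0) col_jn0 !E => /eqP;
     rewrite muln_eq0 negb_or => /andP[/eqP h /eqP h'].
Qed.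

Lemma Sig_Sigma11 Q : Sig Q -> Sigma11 [set x | Q (fun=> 0) x].
Proof.
move=> [R [c hc] hR].
exists (fun x g y => R (jn (fun=> 0) g) (pairn x y) != 0).
  have [d hd] : cmp (fun h z => R (fun q => jn (fun=> 0) (fun q => h q) q) z != 0).
    apply: cmp_not; apply: cmp_eq; last by cmp.
    apply: (@cmp_subst R (fun h z q => jn (fun=> 0) (fun q => h q) q)); [by exists c| |by cmp].
    by apply: (@cmp_jn (fun h z q => 0) (fun h z q => h q)); cmp.
  by exists d => x f y; have := hd f (pairn x y).
apply/seteqP; split=> x /=; rewrite hR => -[g hg]; exists g => y.
  by apply/eqP; exact: hg.
by apply/eqP; exact: hg.
Qed.

(** By [phi_table], halting with a given value asserts the existence of a clock and a table; the
    table is a function witness, and its defining equations form the universal matrix. *)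
Lemma Sig_phi E X Y : cmp E -> cmp X -> cmp Y -> Sig (fun f x => phi (E f x) (X f x) (Y f x)).
Proof.
move=> hE hX hY.
pose Q (e x y : nat) := isc e.+1 e /\ exists s T, (forall q, T q = evtab s T (p1 q) (p2 q)) /\ T (pairn e x) = y.+1.
have EQ e x y : phi e x y <-> Q e x y.
  rewrite phi_table /Q; split=> -[h1 [s [T [h2 h3]]]]; split=> //; exists s, T; split=> //.
    by move=> q; rewrite -{1}(pair_p q).
  by move=> e' x'; rewrite h2 !pE.
pose Q' (f : nat -> nat) z := Q (p1 z) (p1 (p2 z)) (p2 (p2 z)).
suff hQ : Sig Q'.
  have := Sig_subst hQ (cmp_pair hE (cmp_pair hX hY)).
  by apply: Sig_ext => f x; rewrite EQ /Q' !pE.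
apply: Sig_and; first by apply: Sig_bool; apply: cmp_isc; cmp.
pose B (f : nat -> nat) z := (forall q, f q = evtab (p2 z) f (p1 q) (p2 q)) /\
   f (pairn (p1 (p1 z)) (p1 (p2 (p1 z)))) = (p2 (p2 (p1 z))).+1.
have hB : Sig B.
  apply: Sig_and; last first.
    apply: (@Sig_ext (fun f z => f (pairn (p1 (p1 z)) (p1 (p2 (p1 z)))) == (p2 (p2 (p1 z))).+1)).
      by move=> f z; split=> /eqP.
    by apply: Sig_bool; cmp.
  apply: (@Sig_all (fun f z q => f q = evtab (p2 z) f (p1 q) (p2 q))).
  apply: (@Sig_ext (fun f z => f (p2 z) == evtab (p2 (p1 z)) f (p1 (p2 z)) (p2 (p2 z)))).
    by move=> f z; split=> /eqP.
  apply: Sig_bool; apply: cmp_eq; first by cmp.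
  by apply: (@cmp_comp3 (fun f s e x => evtab s f e x)); [exact: cmp_evtab | cmp..].
have hB' : Sig (fun f z => B (fun q => f (pairn 1 q)) z).
  by apply: (@Sig_sub B (fun f x q => f (pairn 1 q)) (fun f x => x)); [|cmp..].
apply: (@Sig_ext (fun f z => exists s, (fun f z s => exists g, B g (pairn z s)) f z s)).
  by move=> f z; split=> -[s [T h]]; exists s, T; move: h; rewrite /B !pE.
apply: Sig_ex; apply: Sig_ext (Sig_exf hB') => f z; rewrite pair_p; split=> -[g hg]; exists g;
  by move: hg; rewrite -[fun q => _]/(col _ 1) col_jn1.
Qed.

Local Open Scope classical_set_scope.
Local Open Scope ring_scope.

(** * C*-algebras as closed subalgebras *)

Lemma half_pow_small (R : realType) (r : R) : 0 < r -> exists k, 2^-1 ^+ k < r.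
Proof.
move=> r0; have [k hk] : exists k, r^-1 < (2 ^ k)%N%:R.
  have h : r^-1 < (Num.bound r^-1)%:R.
    by apply: archi_boundP; rewrite invr_ge0 ltW.
  exists (Num.bound r^-1); apply: lt_trans h _.
  by rewrite ltr_nat ltn_expl.
exists k; rewrite exprVn -natrX -ltf_pV2 ?posrE ?invr_gt0 ?ltr0n ?expn_gt0 //.
by rewrite invrK.
Qed.
Section SubCS.
Variable R : realType.
Local Notation C := R[i].

(** A C*-algebra cut out of an ambient vector space, on which the axioms hold only inside [sS].
    Completeness is asked for sequences with rate 2^-k, which is how it is verified for function
    algebras and for the closure of a union of levels. *)
Record subcs := SubCS {
  sV : lmodType C;
  sS : set sV;
  sN : sV -> R;
  sM : sV -> sV -> sV;
  sT : sV -> sV;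
  sS0 : sS 0;
  sSD : forall x y, sS x -> sS y -> sS (x + y);
  sSZ : forall (k : C) x, sS x -> sS (k *: x);
  sSM : forall x y, sS x -> sS y -> sS (sM x y);
  sST : forall x, sS x -> sS (sT x);
  sND : forall x y, sS x -> sS y -> sN (x + y) <= sN x + sN y;
  sNZ : forall (k : C) x, sS x -> sN (k *: x) = complex.Re `|k| * sN x;
  sN0 : forall x, sS x -> sN x = 0 -> x = 0;
  sNc : forall u : nat -> sV, (forall n, sS (u n)) ->
     (forall k n, (k <= n)%N -> sN (u n - u k) <= 2^-1 ^+ k) ->
     exists l, sS l /\ forall k, sN (u k - l) <= 2^-1 ^+ k;
  sMA : forall x y z, sS x -> sS y -> sS z -> sM x (sM y z) = sM (sM x y) z;
  sMDl : forall x y z, sS x -> sS y -> sS z -> sM (x + y) z = sM x z + sM y z;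
  sMDr : forall x y z, sS x -> sS y -> sS z -> sM x (y + z) = sM x y + sM x z;
  sMZl : forall (k : C) x y, sS x -> sS y -> k *: sM x y = sM (k *: x) y;
  sMZr : forall (k : C) x y, sS x -> sS y -> k *: sM x y = sM x (k *: y);
  sTD : forall x y, sS x -> sS y -> sT (x + y) = sT x + sT y;
  sTZ : forall (k : C) x, sS x -> sT (k *: x) = k^* *: sT x;
  sTM : forall x y, sS x -> sS y -> sT (sM x y) = sM (sT y) (sT x);
  sTK : forall x, sS x -> sT (sT x) = x;
  sNM : forall x y, sS x -> sS y -> sN (sM x y) <= sN x * sN y;
  sNC : forall x, sS x -> sN (sM (sT x) x) = sN x ^+ 2 }.

Variable D : subcs.
Definition spred : {pred sV D} := fun x => `[< @sS D x >].
Lemma spredE x : reflect (@sS D x) (x \in spred).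
Proof. exact: asboolP. Qed.
Lemma spred_submod : GRing.submod_closed spred.
Proof.
split; first by apply/spredE; exact: sS0.
by move=> k x y /spredE hx /spredE hy; apply/spredE/sSD => //; apply: sSZ.
Qed.
HB.instance Definition _ := GRing.isSubmodClosed.Build C (sV D) spred spred_submod.

Definition scar : Type := {x : sV D | x \in spred}.
HB.instance Definition _ := SubType.on scar.
HB.instance Definition _ := Choice.on scar.
HB.instance Definition _ := [SubChoice_isSubLmodule of scar by <:].

Definition snorm (x : scar) : C := (sN (val x))%:C%C.
Lemma scarP (x : scar) : @sS D (val x).
Proof. exact/spredE/(valP x). Qed.

Lemma snormD x y : snorm (x + y) <= snorm x + snorm y.
Proof. by rewrite /snorm -rmorphD /= lecR; apply: sND; exact: scarP. Qed.
Lemma snormZ (l : C) x : snorm (l *: x) = `|l| * snorm x.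
Proof.
rewrite /snorm /= sNZ; last exact: scarP.
by rewrite rmorphM /=; congr (_ * _); rewrite RRe_real // normr_real.
Qed.
Lemma snorm0 x : snorm x = 0 -> x = 0.
Proof. move=> /complexI h; apply/val_inj => /=; apply: sN0 => //; exact: scarP. Qed.
HB.instance Definition _ := isPointed.Build scar 0.
HB.instance Definition _ := @Lmodule_isNormed.Build C scar snorm snormD snormZ snorm0.
Lemma scar_normE (x : scar) : `|x| = (sN (val x))%:C%C.
Proof. by []. Qed.
Lemma cauchy_seq_fast (F : set_system scar) : ProperFilter F -> cauchy F ->
  exists u : nat -> scar, forall k, F (ball (u k) ((2^-1)^+k)).
Proof.
move=> PF /cauchyP cF.
have h k : exists x : scar, F (ball x ((2^-1 : C)^+k)).
  by apply: cF; rewrite exprn_gt0.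
by exists (fun k => sval (cid (h k))) => k; case: cid.
Qed.

Lemma scar_complete (F : set_system scar) : ProperFilter F -> cauchy F -> cvg F.
Proof.
move=> PF cF; have [u hu] := cauchy_seq_fast PF cF.
(* Two balls with radii at most 2^-(k+1) belong to the filter and hence meet, so their centres are
   2^-k apart; this is the reason for the shift by one. *)
have uB k n : (k <= n)%N -> sN (val (u n.+1) - val (u k.+1)) <= 2^-1 ^+ k.
  move=> kn.
  have [x [hx hy]] := @filter_ex _ _ PF _ (filterI (hu k.+1) (hu n.+1)).
  rewrite -ball_normE /= in hx hy.
  have : `|u n.+1 - u k.+1| <= (2^-1 : C) ^+ k.
    have -> : u n.+1 - u k.+1 = (u n.+1 - x) - (u k.+1 - x).
      by rewrite opprB addrA subrK.
    apply: (le_trans (ler_normB _ _)).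
    apply: (@le_trans _ _ ((2^-1 : C) ^+ n.+1 + 2^-1 ^+ k.+1)).
      by apply: lerD; apply: ltW.
    have : (2^-1 : C) ^+ n.+1 <= 2^-1 ^+ k.+1.
      by apply: ler_wiXn2l; rewrite ?ltnS ?invr_ge0 ?invf_le1 ?ler1n.
    move=> h; apply: (le_trans (lerD h (lexx _))).
    by rewrite exprS -mulrDl -mulr2n -(mulr_natr 2^-1) mulVf ?mul1r ?pnatr_eq0.
  rewrite scar_normE.
  have -> : (2^-1 : C) ^+ k = ((2^-1 : R) ^+ k)%:C%C.
    by rewrite rmorphXn fmorphV rmorph_nat.
  by rewrite lecR.
have [l [Sl hl]] := @sNc D (fun n => val (u n.+1)) (fun n => scarP _) uB.
have ll : l \in spred by apply/spredE.
apply: (cvgP (Sub l ll : scar)).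
apply/cvg_ballP => e e0.
have [k hk] : exists k, (2^-1 : C) ^+ k + 2^-1 ^+ k.+1 < e.
  have /andP[e1 e2] : (complex.Im e == 0) && (0 < complex.Re e).
    by move: e0; rewrite ltcE /= eq_sym.
  have [k hk] := half_pow_small (divr_gt0 e2 (ltr0n _ 2)).
  exists k; have -> : e = (complex.Re e)%:C%C by case: (e) e1 => a b /= /eqP->.
  have E j : (2^-1 : C) ^+ j = ((2^-1 : R) ^+ j)%:C%C.
    by rewrite rmorphXn fmorphV rmorph_nat.
  rewrite !E -rmorphD /= ltcR exprS.
  have h0 : 0 < (2^-1 : R) ^+ k by rewrite exprn_gt0.
  lra.
have := hu k.+1; apply: filterS => x.
rewrite -!ball_normE /= => hx; rewrite distrC.
have -> : x - Sub l ll = (x - u k.+1) + (u k.+1 - Sub l ll) by rewrite addrA subrK.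
apply: (le_lt_trans (ler_normD _ _)); apply: le_lt_trans hk.
rewrite addrC; apply: lerD; last by rewrite distrC; exact: ltW.
rewrite scar_normE /=.
have -> : (2^-1 : C) ^+ k = ((2^-1 : R) ^+ k)%:C%C.
  by rewrite rmorphXn fmorphV rmorph_nat.
rewrite lecR; apply: le_trans (hl k) _; exact: lexx.
Qed.
HB.instance Definition _ := Uniform_isComplete.Build scar scar_complete.
Definition ssub (x : sV D) (h : @sS D x) : scar := exist _ x (introT (spredE x) h).
Definition smul (x y : scar) : scar := ssub (sSM (scarP x) (scarP y)).
Definition sstar (x : scar) : scar := ssub (sST (scarP x)).

Definition cs_of_sub : cstar_alg R.
Proof.
refine (@CStarAlg R scar smul sstar _ _ _ _ _ _ _ _ _ _ _).
- by move=> x y z; apply/val_inj/sMA; exact: scarP.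
- by move=> x y z; apply/val_inj/sMDl; exact: scarP.
- by move=> x y z; apply/val_inj/sMDr; exact: scarP.
- by move=> k x y; apply/val_inj/sMZl; exact: scarP.
- by move=> k x y; apply/val_inj/sMZr; exact: scarP.
- by move=> x y; apply/val_inj/sTD; exact: scarP.
- by move=> k x; apply/val_inj/sTZ; exact: scarP.
- by move=> x y; apply/val_inj/sTM; exact: scarP.
- by move=> x; apply/val_inj/sTK; exact: scarP.
- by move=> x y; rewrite !scar_normE -rmorphM lecR; apply: sNM; exact: scarP.
- by move=> x; rewrite !scar_normE -rmorphXn /= sNC //; exact: scarP.
Defined.
End SubCS.

Section Basics.
Variable R : realType.
Local Notation C := R[i].
Definition cn (z : C) : R := complex.Re `|z|.

Lemma cnE (z : C) : (cn z)%:C%C = `|z|.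
Proof. by rewrite /cn RRe_real. Qed.
Lemma cn_ge0 z : 0 <= cn z.
Proof. by rewrite -lecR ?cnE ?nrmE; exact: normr_ge0. Qed.
Lemma cnD x y : cn (x + y) <= cn x + cn y.
Proof. by rewrite -lecR rmorphD /= !cnE ler_normD. Qed.
Lemma cnM x y : cn (x * y) = cn x * cn y.
Proof. by apply/complexI; rewrite rmorphM /= !cnE normrM. Qed.
Lemma cnN x : cn (- x) = cn x.
Proof. by rewrite /cn normrN. Qed.
Lemma cnB x y : cn (x - y) = cn (y - x).
Proof. by rewrite -cnN opprB. Qed.
Lemma cn0 : cn 0 = 0.
Proof. by rewrite /cn normr0. Qed.
Lemma cn1 : cn 1 = 1.
Proof. by rewrite /cn normr1. Qed.
Lemma cn_eq0 x : cn x = 0 -> x = 0.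
Proof. by move=> h; apply/eqP; rewrite -normr_eq0 -cnE h. Qed.
Lemma cn_real (r : R) : cn r%:C%C = `|r|.
Proof. by rewrite /cn normc_def /= expr0n addr0 sqrtr_sqr. Qed.
Lemma cn_sqr (x : C) : cn x ^+ 2 = complex.Re x ^+ 2 + complex.Im x ^+ 2.
Proof.
case: x => a b; rewrite /cn normc_def /= sqr_sqrtr //.
by rewrite addr_ge0 ?sqr_ge0.
Qed.
Lemma cn_conj (x : C) : cn (x^*) = cn x.
Proof. by rewrite /cn norm_conjC. Qed.
Lemma cn_Re x : `|complex.Re x| <= cn x.
Proof.
rewrite -(@ler_pXn2r _ 2) ?nnegrE ?cn_ge0 // cn_sqr real_normK ?num_real //.
by rewrite lerDl sqr_ge0.
Qed.
Lemma cn_Im x : `|complex.Im x| <= cn x.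
Proof.
rewrite -(@ler_pXn2r _ 2) ?nnegrE ?cn_ge0 // cn_sqr real_normK ?num_real //.
by rewrite lerDr sqr_ge0.
Qed.
Lemma cn_ReIm x : cn x <= `|complex.Re x| + `|complex.Im x|.
Proof.
rewrite -(@ler_pXn2r _ 2) ?nnegrE ?cn_ge0 ?addr_ge0 // cn_sqr sqrrD.
rewrite !real_normK ?num_real // -addrA (addrC (_ *+ 2)) addrA lerDl.
by rewrite mulrn_wge0 // mulr_ge0.
Qed.

Section Norm.
Variable A : cstar_alg R.
Implicit Types x y : A.
Local Notation N := (@cs_norm R A).
Lemma nrmE x : (N x)%:C%C = `|x|.
Proof. by rewrite /cs_norm RRe_real. Qed.
Lemma nrm_ge0 x : 0 <= N x.
Proof. by rewrite -lecR ?cnE ?nrmE; exact: normr_ge0. Qed.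
Lemma nrmD x y : N (x + y) <= N x + N y.
Proof. by rewrite -lecR rmorphD /= !nrmE ler_normD. Qed.
Lemma nrmN x : N (- x) = N x.
Proof. by rewrite /cs_norm normrN. Qed.
Lemma nrmB x y : N (x - y) = N (y - x).
Proof. by rewrite -nrmN opprB. Qed.
Lemma nrm0 : N 0 = 0.
Proof. by rewrite /cs_norm normr0. Qed.
Lemma nrm_eq0 x : N x = 0 -> x = 0.
Proof. by move=> h; apply/eqP; rewrite -normr_eq0 -nrmE h. Qed.
Lemma nrm_gt0 x : x <> 0 -> 0 < N x.
Proof. by move=> h; rewrite lt_def nrm_ge0 andbT; apply/eqP => /nrm_eq0. Qed.
Lemma nrmZ (k : C) x : N (k *: x) = cn k * N x.
Proof. by apply/complexI; rewrite rmorphM /= nrmE cnE nrmE normrZ. Qed.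
Lemma nrmM x y : N (cs_mul x y) <= N x * N y.
Proof. by rewrite -lecR rmorphM /= !nrmE cs_normM. Qed.
Lemma nrmC x : N (cs_mul (cs_star x) x) = N x ^+ 2.
Proof. by apply/complexI; rewrite rmorphXn /= !nrmE cs_normC. Qed.
Lemma nrm_le0 x : N x <= 0 -> x = 0.
Proof. by move=> h; apply/nrm_eq0/le_anti; rewrite h nrm_ge0. Qed.
Lemma nrm_small x : (forall e, 0 < e -> N x <= e) -> x = 0.
Proof.
move=> h; apply: nrm_le0; apply/ler_addgt0Pr => e e0; rewrite add0r; exact: h.
Qed.
Lemma nrmDB x y z : N (x - z) <= N (x - y) + N (y - z).
Proof. by apply: le_trans (nrmD _ _); rewrite addrA subrK. Qed.

Lemma mul0 x : cs_mul 0 x = 0.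
Proof. by rewrite -(scale0r (0 : A)) -cs_scaleAl !scale0r. Qed.
Lemma mulx0 x : cs_mul x 0 = 0.
Proof. by rewrite -(scale0r (0 : A)) -cs_scaleAr !scale0r. Qed.
Lemma mulNx x y : cs_mul (- x) y = - cs_mul x y.
Proof. by rewrite -scaleN1r -cs_scaleAl scaleN1r. Qed.
Lemma mulxN x y : cs_mul x (- y) = - cs_mul x y.
Proof. by rewrite -scaleN1r -cs_scaleAr scaleN1r. Qed.
Lemma mulBx x y z : cs_mul (x - y) z = cs_mul x z - cs_mul y z.
Proof. by rewrite cs_mulDl mulNx. Qed.
Lemma mulxB x y z : cs_mul z (x - y) = cs_mul z x - cs_mul z y.
Proof. by rewrite cs_mulDr mulxN. Qed.
Lemma starN x : cs_star (- x) = - cs_star x.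
Proof. by rewrite -scaleN1r cs_starZ rmorphN1 scaleN1r. Qed.
Lemma starB x y : cs_star (x - y) = cs_star x - cs_star y.
Proof. by rewrite cs_starD starN. Qed.

Lemma nrm_star_le x : N x <= N (cs_star x).
Proof.
have [->|/eqP/nrm_gt0 h] := eqVneq x 0; first by rewrite nrm0 nrm_ge0.
rewrite -(ler_pM2r h) -expr2 -nrmC; exact: nrmM.
Qed.
Lemma nrm_star x : N (cs_star x) = N x.
Proof. by apply/le_anti; rewrite nrm_star_le -{2}(cs_starK x) nrm_star_le. Qed.

Lemma nrm_ball x y (e : R) : ball x e%:C%C y <-> N (x - y) < e.
Proof. by rewrite -ball_normE /= -nrmE ltcR. Qed.

Lemma nrm_complete (u : nat -> A) :
  (forall k n, (k <= n)%N -> N (u n - u k) <= 2^-1 ^+ k) ->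
  exists l, forall k, N (u k - l) <= 2^-1 ^+ k.
Proof.
move=> h.
have cu : cvg (u @ \oo).
  apply/cauchy_cvgP/cauchy_exP => e.
  rewrite ltcE /= => /andP[/eqP e1 e2].
  have [k hk] := half_pow_small e2.
  exists (u k); exists k => // n /= kn.
  have -> : e = (complex.Re e)%:C%C by case: (e) e1 => a b /= ->.
  by apply/nrm_ball; rewrite nrmB; apply: le_lt_trans (h _ _ kn) hk.
exists (lim (u @ \oo)) => k; apply/ler_addgt0Pr => e e0.
have /cvg_ballP/(_ e%:C%C) := cu.
rewrite ltcR => /(_ e0) [n _ hn].
have := hn (maxn n k) (leq_maxl _ _) => /nrm_ball h2.
apply: (le_trans (nrmDB _ (u (maxn n k)) _)).
apply: lerD; first by rewrite nrmB; apply: h; exact: leq_maxr.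
by rewrite nrmB ltW.
Qed.

Definition sdense (S : set A) := forall x e, 0 < e -> exists2 y, S y & N (x - y) < e.
Lemma denseP (S : set A) : dense S <-> sdense S.
Proof.
split=> [h x e e0|h O [x Ox] oO].
  have [||y [/= yO yS]] := h [set y | ball x e%:C%C y].
  - by exists x; apply: ballxx; rewrite ltcR.
  - exact: ball_open.
  - by exists y => //; apply/nrm_ball.
have := oO; rewrite openE => /(_ _ Ox) /nbhs_ballP [e /= + he].
rewrite ltcE /= => /andP[/eqP e1 e2].
have [y Sy hy] := h x _ e2; exists y; split => //; apply: he => /=.
have -> : e = (complex.Re e)%:C%C by case: (e) e1 => a b /= ->.
exact/nrm_ball.
Qed.
End Norm.

Lemma rat_of_nat_surj (q : rat) : exists n, rat_of_nat n = q.
Proof.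
have [d hd] : exists d, denq q = (d.+1)%:Z.
  by have := denq_gt0 q; case: (denq q) => // -[//|d] _; exists d.
have [p [m hpm]] : exists p m : nat, numq q = p%:Z - m%:Z.
  case: (numq q) => n; first by exists n, 0%N; rewrite subr0.
  by exists 0%N, n.+1; rewrite sub0r NegzE.
exists (pairn (pairn p m) d); rewrite /rat_of_nat /unpairn /pairn !Cantor.cancel_of_to.
by rewrite -[RHS]divq_num_den hd hpm rmorphB.
Qed.

Lemma gauss_of_nat_surj (p q : rat) : exists n, gauss_of_nat R n = (ratr p +i* ratr q)%C.
Proof.
have [[n <-] [m <-]] := (rat_of_nat_surj p, rat_of_nat_surj q).
by exists (pairn n m); rewrite /gauss_of_nat /unpairn /pairn Cantor.cancel_of_to.
Qed.

Lemma gauss_dense (z : C) e : 0 < e -> exists n, cn (z - gauss_of_nat R n) < e.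
Proof.
move=> e0; case: z => a b.
have e2 : 0 < e / 2 by rewrite divr_gt0.
have h (r : R) : exists q : rat, `|r - ratr q| < e / 2.
  have [|q] := @rat_in_itvoo R (r - e/2) (r + e/2); first by lra.
  by rewrite in_itv /= => /andP[h1 h2]; exists q; rewrite ltr_norml; lra.
have [[p hp] [q hq]] := (h a, h b).
have [n hn] := gauss_of_nat_surj p q; exists n; rewrite hn.
by apply: (le_lt_trans (cn_ReIm _)) => /=; lra.
Qed.

End Basics.

(** * Extension of homomorphisms by continuity *)

Lemma lt_split (R : realType) (a b : R) : 0 <= a -> 0 < b -> exists2 d, 0 < d & a * d < b.
Proof.
move=> a0 b0; exists (b / (a + 1)); first by rewrite divr_gt0 // ltr_wpDl.
have h : 0 < a + 1 by rewrite ltr_wpDl.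
by rewrite mulrA ltr_pdivrMr // (mulrC a) ltr_pM2l // ltrDl.
Qed.

Section Ext.
Variable R : realType.
Local Notation C := R[i].
Variables A B : cstar_alg R.
Local Notation N := (@cs_norm R _).

(** Homomorphisms are obtained as closures of graphs: G is a densely defined graph, and closeness is
    measured in both coordinates at once. *)
Definition clos (G : A -> B -> Prop) x y :=
  forall e, 0 < e -> exists x' y', [/\ G x' y', N (x - x') < e & N (y - y') < e].

Lemma clos_incl G x y : G x y -> clos G x y.
Proof. by move=> h e e0; exists x, y; rewrite !subrr !nrm0. Qed.

Lemma clos_clos G x y : clos (clos G) x y -> clos G x y.
Proof.
move=> h e e0; have e2 : 0 < e / 2 by rewrite divr_gt0.
have [x' [y' [h1 h2 h3]]] := h _ e2; have [x2 [y2 [h4 h5 h6]]] := h1 _ e2.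
exists x2, y2; split=> //.
  by apply: (le_lt_trans (nrmDB _ x' _)); lra.
by apply: (le_lt_trans (nrmDB _ y' _)); lra.
Qed.

(** Scalars are restricted to Gaussian rationals because values of *-polynomials are closed under no
    others; [closZ] recovers complex scalars after closing. *)
Record opclosed (G : A -> B -> Prop) : Prop := OpClosed {
  oc0 : G 0 0;
  ocD : forall x y x' y', G x y -> G x' y' -> G (x + x') (y + y');
  ocM : forall x y x' y', G x y -> G x' y' -> G (cs_mul x x') (cs_mul y y');
  ocS : forall x y, G x y -> G (cs_star x) (cs_star y);
  ocZ : forall n x y, G x y -> G (gauss_of_nat R n *: x) (gauss_of_nat R n *: y) }.

Lemma mul_close (E : cstar_alg R) (x y : E) e : 0 < e -> exists2 d, 0 < d &
  forall x' y', N (x - x') < d -> N (y - y') < d -> N (cs_mul x y - cs_mul x' y') < e.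
Proof.
move=> e0; pose K := N x + N y + 1.
have K1 : 1 <= K by have := nrm_ge0 x; have := nrm_ge0 y; rewrite /K; lra.
have [d d0 hd] := @lt_split _ (K + K) e (addr_ge0 (le_trans ler01 K1) (le_trans ler01 K1)) e0.
exists (Num.min d 1); first by rewrite lt_min d0 ltr01.
move=> x' y'; rewrite !lt_min => /andP[h1 h2] /andP[h3 h4].
have -> : cs_mul x y - cs_mul x' y' = cs_mul (x - x') y' + cs_mul x (y - y').
  by rewrite mulBx mulxB [RHS]addrC addrA subrK.
apply: (le_lt_trans (nrmD _ _)).
have hy' : N y' <= K.
  have : N y' <= N y + N (y' - y) by rewrite -{1}(subrK y y') addrC; apply: nrmD.
  by rewrite nrmB; have := nrm_ge0 x; rewrite /K; lra.
have hx : N x <= K by have := nrm_ge0 y; rewrite /K; lra.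
apply: (le_lt_trans (lerD (nrmM _ _) (nrmM _ _))).
have b1 : N (x - x') * N y' <= d * K.
  by apply: ler_pM; rewrite ?nrm_ge0 ?(ltW h1) ?(ltW h3).
have b2 : N x * N (y - y') <= K * d by apply: ler_pM; rewrite ?nrm_ge0 ?(ltW h1) ?(ltW h3).
by apply: (le_lt_trans (lerD b1 b2)); rewrite (mulrC d) -mulrDl.
Qed.

Lemma clos_opclosed G : opclosed G -> opclosed (clos G).
Proof.
move=> [g0 gD gM gS gZ]; split; first exact: clos_incl.
- move=> x y x' y' h h' e e0; have e2 : 0 < e / 2 by rewrite divr_gt0.
  have [a [b [h1 h2 h3]]] := h _ e2; have [a' [b' [h1' h2' h3']]] := h' _ e2.
  exists (a + a'), (b + b'); split; first exact: gD.
    by rewrite opprD addrACA; apply: (le_lt_trans (nrmD _ _)); lra.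
  by rewrite opprD addrACA; apply: (le_lt_trans (nrmD _ _)); lra.
- move=> x y x' y' h h' e e0.
  have [d d0 hd] := mul_close x x' e0; have [d' d0' hd'] := mul_close y y' e0.
  have m0 : 0 < Num.min d d' by rewrite lt_min d0.
  have [a [b [h1 + +]]] := h _ m0; have [a' [b' [h1' + +]]] := h' _ m0.
  rewrite !lt_min => /andP[k1 k2] /andP[k3 k4] /andP[k5 k6] /andP[k7 k8].
  by exists (cs_mul a a'), (cs_mul b b'); split; [exact: gM | exact: hd | exact: hd'].
- move=> x y h e e0; have [a [b [h1 h2 h3]]] := h _ e0.
  by exists (cs_star a), (cs_star b); rewrite -!starB !nrm_star; split=> //; apply: gS.
- move=> n x y h e e0; have [d d0 hd] := @lt_split _ _ _ (cn_ge0 (gauss_of_nat R n)) e0.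
  have [a [b [h1 h2 h3]]] := h _ d0.
  exists (gauss_of_nat R n *: a), (gauss_of_nat R n *: b).
  split; [exact: gZ| |]; rewrite -scalerBr nrmZ; apply: le_lt_trans hd;
    by rewrite ler_wpM2l ?cn_ge0 ?(ltW h2) ?(ltW h3).
Qed.

Lemma closZ G (k : C) x y : opclosed G -> clos G x y -> clos G (k *: x) (k *: y).
Proof.
move=> oG h; apply: clos_clos => e e0.
have [d d0 hd] := @lt_split _ (N x + N y) e (addr_ge0 (nrm_ge0 _) (nrm_ge0 _)) e0.
have [n hn] := gauss_dense k d0.
exists (gauss_of_nat R n *: x), (gauss_of_nat R n *: y).
split; first exact: (ocZ (clos_opclosed oG)).
  rewrite -scalerBl nrmZ; apply: le_lt_trans hd; rewrite mulrC.
  by apply: ler_pM; rewrite ?nrm_ge0 ?cn_ge0 ?(ltW hn) // lerDl nrm_ge0.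
rewrite -scalerBl nrmZ; apply: le_lt_trans hd; rewrite mulrC.
by apply: ler_pM; rewrite ?nrm_ge0 ?cn_ge0 ?(ltW hn) // lerDr nrm_ge0.
Qed.

Lemma closB G x y x' y' : opclosed G -> clos G x y -> clos G x' y' -> clos G (x - x') (y - y').
Proof.
move=> oG h h'; apply: (ocD (clos_opclosed oG)) => //.
by rewrite -(scaleN1r x') -(scaleN1r y'); apply: closZ.
Qed.

Variables (G : A -> B -> Prop) (K : R).
Hypothesis oG : opclosed G.
Hypothesis K0 : 0 <= K.
Hypothesis Glip : forall x y, G x y -> N y <= K * N x.
Hypothesis Gdense : forall x e, 0 < e -> exists x' y', G x' y' /\ N (x - x') < e.

Lemma clos_lip x y : clos G x y -> N y <= K * N x.
Proof.
move=> h; apply/ler_addgt0Pr => e e0.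
have [d d0 hd] := @lt_split _ (K + 1) e (addr_ge0 K0 ler01) e0.
have [a [b [h1 h2 h3]]] := h _ d0.
have e1 : N y <= N b + d.
  by rewrite -{1}(subrK b y) addrC; apply: (le_trans (nrmD _ _)); rewrite lerD2l ltW.
have e2 : N a <= N x + d.
  rewrite -{1}(subrK x a) addrC; apply: (le_trans (nrmD _ _)).
  by rewrite lerD2l nrmB ltW.
have e3 := Glip h1.
have e4 : K * N a <= K * (N x + d) by rewrite ler_wpM2l.
move: hd; rewrite mulrDl mul1r => hd; rewrite mulrDr in e4; lra.
Qed.

Lemma clos_fun x y y' : clos G x y -> clos G x y' -> y = y'.
Proof.
move=> h h'; have := clos_lip (closB oG h h'); rewrite subrr nrm0 mulr0 => /nrm_le0/eqP.
by rewrite subr_eq0 => /eqP.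
Qed.

Lemma clos_total x : exists y, clos G x y.
Proof.
(* Approximations of x at rate 2^-k / (4 (K + 1)) differ by twice that, so their images, stretched
   by at most K, form a Cauchy sequence of rate 2^-k. Using K + 1 keeps the divisor nonzero. *)
have K1 : 0 < (K + 1) * 4 by rewrite mulr_gt0 // ltr_wpDl.
have e0 k : 0 < (2^-1 : R) ^+ k / ((K + 1) * 4).
  by rewrite divr_gt0 // exprn_gt0 // invr_gt0.
pose u k := cid (Gdense x (e0 k)).
pose v k := cid (svalP (u k)).
pose a k := sval (u k); pose b k := sval (v k).
have hG k : G (a k) (b k) by have [] := svalP (v k).
have hN k : N (x - a k) < 2^-1 ^+ k / ((K + 1) * 4) by have [] := svalP (v k).
have hmono k n : (k <= n)%N -> (2^-1 : R) ^+ n <= 2^-1 ^+ k.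
  by move=> kn; apply: ler_wiXn2l; rewrite ?invr_ge0 ?invf_le1 ?ler1n.
have hp k : 0 < (2^-1 : R) ^+ k by rewrite exprn_gt0 // invr_gt0.
have hb k n : (k <= n)%N -> N (b n - b k) <= 2^-1 ^+ k.
  move=> kn; have := clos_lip (closB oG (clos_incl (hG n)) (clos_incl (hG k))).
  move/le_trans; apply.
  have h1 : N (a n - a k) <= 2^-1 ^+ k / ((K + 1) * 4) + 2^-1 ^+ k / ((K + 1) * 4).
    apply: (le_trans (nrmDB _ x _)); rewrite nrmB; apply: lerD; last exact/ltW/hN.
    apply/ltW/(lt_le_trans (hN n)); rewrite ler_pM2r ?invr_gt0 //; exact: hmono.
  apply: (@le_trans _ _ ((K + 1) * N (a n - a k))).
    by rewrite ler_wpM2r ?nrm_ge0 // lerDl.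
  rewrite -ler_pdivlMl ?ltr_wpDl //; apply: (le_trans h1).
  rewrite invfM -mulrDr; move: (hp k) => {}hp.
  have : 0 < (K + 1)^-1 by rewrite invr_gt0 ltr_wpDl.
  move: ((K+1)^-1) (2^-1 ^+ k) hp => s t s0 t0; nra.
have [l hl] := nrm_complete hb; exists l; apply: clos_clos => e e00.
have [k hk] := half_pow_small e00.
exists (a k), (b k); split; first exact/clos_incl.
  apply: (lt_trans (hN k)); apply: le_lt_trans hk.
  by rewrite ler_pdivrMr // ler_pMr //; have k0 : 0 <= K by []; lra.
by rewrite nrmB; apply: le_lt_trans (hl k) hk.
Qed.

Lemma extension : exists u : A -> B, [/\ is_star_hom u, forall x y, G x y -> u x = y,
  forall x, clos G x (u x) & forall x, N (u x) <= K * N x].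
Proof.
pose u x := sval (cid (clos_total x)).
have hu x : clos G x (u x) by rewrite /u; case: cid.
exists u; split=> //.
- split.
  + move=> k x y; apply: (clos_fun (hu _)).
    by apply: (ocD (clos_opclosed oG)) => //; exact: closZ.
  + by move=> x y; apply: (clos_fun (hu _)); apply: (ocM (clos_opclosed oG)).
  + by move=> x; apply: (clos_fun (hu _)); apply: (ocS (clos_opclosed oG)).
- by move=> x y h; apply: (clos_fun (hu _)); apply: clos_incl.
- by move=> x; apply: clos_lip.
Qed.
End Ext.

Section HomBasics.
Variables (R : realType) (A B : cstar_alg R) (h : A -> B).
Hypothesis hh : is_star_hom h.
Lemma homD x y : h (x + y) = h x + h y.
Proof. by case: hh => l _ _; rewrite -{1}(scale1r x) l scale1r. Qed.
Lemma hom0 : h 0 = 0.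
Proof. by apply: (addrI (h 0)); rewrite -homD !addr0. Qed.
Lemma homZ (k : R[i]) x : h (k *: x) = k *: h x.
Proof. by case: hh => l _ _; rewrite -{1}(addr0 (k *: x)) l hom0 addr0. Qed.
Lemma homN x : h (- x) = - h x.
Proof. by rewrite -scaleN1r homZ scaleN1r. Qed.
Lemma homB x y : h (x - y) = h x - h y.
Proof. by rewrite homD homN. Qed.
Lemma homM x y : h (cs_mul x y) = cs_mul (h x) (h y).
Proof. by case: hh. Qed.
Lemma homS x : h (cs_star x) = cs_star (h x).
Proof. by case: hh. Qed.
Lemma hom_poly (a : nat -> A) p : h (star_poly_val a p) = star_poly_val (h \o a) p.
Proof.
elim: p => [i|p hp q hq|p hp q hq|p hp|n p hp] //=.
- by rewrite homD hp hq. - by rewrite homM hp hq. - by rewrite homS hp. - by rewrite homZ hp.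
Qed.
End HomBasics.

Lemma star_iso_inv (R : realType) (A B : cstar_alg R) (h : A -> B) :
  is_star_hom h -> bijective h -> exists g, [/\ is_star_hom g, cancel h g & cancel g h].
Proof.
move=> hh [g hg gh]; exists g; split=> //; split.
- by move=> k x y; apply: (can_inj hg); rewrite gh (homD hh) (homZ hh) !gh.
- by move=> x y; apply: (can_inj hg); rewrite (homM hh) !gh.
- by move=> x; apply: (can_inj hg); rewrite (homS hh) !gh.
Qed.

Lemma star_hom_comp (R : realType) (A B E : cstar_alg R) (h : A -> B) (g : B -> E) :
  is_star_hom h -> is_star_hom g -> is_star_hom (g \o h).
Proof.
move=> hh hg; split=> /=.
- by move=> k x y /=; rewrite homD // homD // !homZ.
- by move=> x y; rewrite !homM.
- by move=> x; rewrite !homS.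
Qed.

(** * Presentations and isometries *)

Section Pres.
Variable R : realType.
Local Notation N := (@cs_norm R _).

(** Expressions have no constant term; zero is expressed with the coefficient number 0, which
    denotes 0. *)
Lemma poly_zero (A : cstar_alg R) (a : nat -> A) : star_poly_val a (PScale 0 (PVar 0)) = 0.
Proof.
rewrite /= /gauss_of_nat /rat_of_nat /= subrr mul0r rmorph0.
by have -> : (0 +i* 0)%C = 0 :> R[i] by []; rewrite scale0r.
Qed.

Lemma poly_opclosed (A B : cstar_alg R) (a : nat -> A) (b : nat -> B) :
  opclosed (fun x y => exists p, x = star_poly_val a p /\ y = star_poly_val b p).
Proof.
split.
- by exists (PScale 0 (PVar 0)); rewrite !poly_zero.
- by move=> _ _ _ _ [p [-> ->]] [q [-> ->]]; exists (PAdd p q).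
- by move=> _ _ _ _ [p [-> ->]] [q [-> ->]]; exists (PMul p q).
- by move=> _ _ [p [-> ->]]; exists (PStar p).
- by move=> n _ _ [p [-> ->]]; exists (PScale n p).
Qed.

Definition pdense (A : cstar_alg R) (a : nat -> A) :=
  forall x e, 0 < e -> exists p, N (x - star_poly_val a p) < e.

Lemma star_subalg_poly (A : cstar_alg R) (a : nat -> A) S p :
  star_subalg_closed S -> range a `<=` S -> S (star_poly_val a p).
Proof.
move=> [s0 sD sZ sM sS] ra; elim: p => [i|p hp q hq|p hp q hq|p hp|n p hp] /=.
- by apply: ra; exists i. - exact: sD. - exact: sM. - exact: sS. - exact: sZ.
Qed.

(** The points z for which (z, z) is a limit of pairs of equal polynomial values form a complex
    *-subalgebra containing the special points, hence everything these generate. *)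
Lemma presP (A : cstar_alg R) (a : nat -> A) : is_presentation a <-> pdense a.
Proof.
rewrite /is_presentation denseP; split=> h x e e0; last first.
  have [p hp] := h x e e0; exists (star_poly_val a p) => // S [hS ra].
  exact: star_subalg_poly.
have e2 : 0 < e / 2 by rewrite divr_gt0.
have [y hy xy] := h x _ e2.
pose G (x y : A) := exists p, x = star_poly_val a p /\ y = star_poly_val a p.
have oG : opclosed G by exact: poly_opclosed.
have : clos G y y.
  apply: (hy [set z | clos G z z]); split; last by move=> _ [i _ <-]; apply: clos_incl; exists (PVar i).
  split.
  - exact: (oc0 (clos_opclosed oG)).
  - by move=> *; apply: (ocD (clos_opclosed oG)).
  - by move=> *; apply: closZ.
  - by move=> *; apply: (ocM (clos_opclosed oG)).
  - by move=> *; apply: (ocS (clos_opclosed oG)).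
move=> /(_ _ e2) [_ [_ [[p [-> ->]] hp _]]]; exists p.
by apply: (le_lt_trans (nrmDB _ y _)); lra.
Qed.

(* the isometry p(a) |-> p(b) extends by continuity *)
Lemma norm_equal_iso (A B : cstar_alg R) (a : nat -> A) (b : nat -> B) :
  pdense a -> pdense b -> (forall p, N (star_poly_val a p) = N (star_poly_val b p)) ->
  exists u : A -> B, [/\ is_star_hom u, bijective u & forall i, u (a i) = b i].
Proof.
move=> da db hN.
pose G (A B : cstar_alg R) (a : nat -> A) (b : nat -> B) x y :=
  exists p, x = star_poly_val a p /\ y = star_poly_val b p.
have [|x y [p [-> ->]]|x e e0|u [hu gu cu lu]] := @extension R A B (G A B a b) 1 _ ler01.
- exact: poly_opclosed.
- by rewrite mul1r hN.
- by have [p hp] := da x e e0; exists (star_poly_val a p), (star_poly_val b p); split=> //; exists p.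
have [|x y [p [-> ->]]|x e e0|v [hv gv cv lv]] := @extension R B A (G B A b a) 1 _ ler01.
- exact: poly_opclosed.
- by rewrite mul1r hN.
- by have [p hp] := db x e e0; exists (star_poly_val b p), (star_poly_val a p); split=> //; exists p.
exists u; split=> //; last by move=> i; apply: gu; exists (PVar i).
exists v => x.
  apply/eqP; rewrite -subr_eq0; apply/eqP/nrm_small => e e0.
  have e2 : 0 < e / 2 by rewrite divr_gt0.
  have [p hp] := da x _ e2.
  have e3 : v (u (star_poly_val a p)) = star_poly_val a p.
    by rewrite (gu _ (star_poly_val b p)) ?(gv _ (star_poly_val a p)) //; exists p.
  apply: (le_trans (nrmDB _ (v (u (star_poly_val a p))) _)).
  rewrite -homB // -homB //.
  have := lv (u (x - star_poly_val a p)); have := lu (x - star_poly_val a p).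
  by rewrite e3 !mul1r (nrmB _ x); lra.
apply/eqP; rewrite -subr_eq0; apply/eqP/nrm_small => e e0.
have e2 : 0 < e / 2 by rewrite divr_gt0.
have [p hp] := db x _ e2.
have e3 : u (v (star_poly_val b p)) = star_poly_val b p.
  by rewrite (gv _ (star_poly_val a p)) ?(gu _ (star_poly_val b p)) //; exists p.
apply: (le_trans (nrmDB _ (u (v (star_poly_val b p))) _)).
rewrite -homB // -homB //.
have := lu (v (x - star_poly_val b p)); have := lv (x - star_poly_val b p).
by rewrite e3 !mul1r (nrmB _ x); lra.
Qed.
End Pres.

(** * Algebras of functions on nat *)

Section FunAlg.
Variable R : realType.
Local Notation C := R[i].
Implicit Types x y : nat -> C.

Definition supn x : R := sup [set cn (x n) | n in setT].
Definition bdd x := exists M, forall n, cn (x n) <= M.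

Lemma supn_has x : bdd x -> has_sup [set cn (x n) | n in setT].
Proof.
move=> [M hM]; split; first by exists (cn (x 0%N)), 0%N.
by exists M => _ [n _ <-].
Qed.
Lemma supn_ub x n : bdd x -> cn (x n) <= supn x.
Proof. by move=> /supn_has h; apply: ub_le_sup; [case: h | exists n]. Qed.
Lemma supn_le x M : (forall n, cn (x n) <= M) -> supn x <= M.
Proof. by move=> h; apply: ge_sup; [exists (cn (x 0%N)), 0%N | move=> _ [n _ <-]]. Qed.
Lemma supn_ge0 x : bdd x -> 0 <= supn x.
Proof. by move=> h; apply: le_trans (supn_ub 0 h); apply: cn_ge0. Qed.
Lemma supn_adh x e : bdd x -> 0 < e -> exists n, supn x - e < cn (x n).
Proof.
by move=> h e0; have [_ [n _ <-] hn] := sup_adherent e0 (supn_has h); exists n.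
Qed.

Definition conjf x : nat -> C := fun n => (x n)^*.
Definition mulf x y : nat -> C := fun n => x n * y n.

Record funalg := FunAlg {
  fS : set (nat -> C);
  fS_bdd : forall x, fS x -> bdd x;
  fS0 : fS 0;
  fSD : forall x y, fS x -> fS y -> fS (x + y);
  fSZ : forall (k : C) x, fS x -> fS (k *: x);
  fSM : forall x y, fS x -> fS y -> fS (mulf x y);
  fST : forall x, fS x -> fS (conjf x);
  fSc : forall x, (forall e, 0 < e -> exists2 y, fS y & forall n, cn (x n - y n) <= e) -> fS x }.

Lemma C_complete (u : nat -> C) :
  (forall k n, (k <= n)%N -> cn (u n - u k) <= 2^-1 ^+ k) ->
  exists l, forall k, cn (u k - l) <= 2^-1 ^+ k.
Proof.
move=> h.
have hR (v : nat -> R) : (forall k n, (k <= n)%N -> `|v n - v k| <= 2^-1 ^+ k) ->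
    exists l, forall e, 0 < e -> exists N, forall n, (N <= n)%N -> `|v n - l| < e.
  move=> hv; have cv : cvg (v @ \oo).
    apply/cauchy_cvgP/cauchy_exP => e e0; have [k hk] := half_pow_small e0.
    exists (v k); exists k => // n /= kn; rewrite -ball_normE /= distrC.
    exact: le_lt_trans (hv _ _ kn) hk.
  exists (lim (v @ \oo)) => e e0; have /cvg_ballP/(_ e e0) [n _ hn] := cv.
  by exists n => m nm; have := hn m nm; rewrite -ball_normE /= distrC.
have [|a ha] := hR (fun n => complex.Re (u n)).
  move=> k n kn; apply: le_trans (h _ _ kn).
  by apply: le_trans (cn_Re _); rewrite raddfB.
have [|b hb] := hR (fun n => complex.Im (u n)).
  move=> k n kn; apply: le_trans (h _ _ kn).
  by apply: le_trans (cn_Im _); rewrite raddfB.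
exists (a +i* b)%C => k; apply/ler_addgt0Pr => e e0.
have e2 : 0 < e / 2 by rewrite divr_gt0.
have [N1 h1] := ha _ e2; have [N2 h2] := hb _ e2.
pose n := maxn k (maxn N1 N2).
have kn : (k <= n)%N by rewrite leq_maxl.
have {}h1 := h1 n (leq_trans (leq_maxl _ _) (leq_maxr _ _)).
have {}h2 := h2 n (leq_trans (leq_maxr _ _) (leq_maxr _ _)).
have -> : u k - (a +i* b)%C = (u k - u n) + (u n - (a +i* b)%C) by rewrite addrA subrK.
apply: (le_trans (cnD _ _)); rewrite cnB; apply: lerD; first exact: h.
apply: (le_trans (cn_ReIm _)); move: h1 h2; case: (u n) => c d /=; lra.
Qed.

Lemma funalg_c (D : funalg) (u : nat -> nat -> C) : (forall n, fS D (u n)) ->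
  (forall k n, (k <= n)%N -> supn (u n - u k) <= 2^-1 ^+ k) ->
  exists l, fS D l /\ forall k, supn (u k - l) <= 2^-1 ^+ k.
Proof.
move=> Du h.
have Dd k n : fS D (u n - u k) by rewrite -scaleN1r; apply: fSD => //; apply: fSZ.
have h1 m k n : (k <= n)%N -> cn (u n m - u k m) <= 2^-1 ^+ k.
  move=> kn; apply: le_trans (h _ _ kn); apply: (@supn_ub (u n - u k)).
  exact: fS_bdd (Dd _ _).
pose l m := sval (cid (C_complete (h1 m))).
have hl m k : cn (u k m - l m) <= 2^-1 ^+ k by rewrite /l; case: cid => z /= ->.
exists l; split; last by move=> k; apply: supn_le => n; apply: hl.
apply: fSc => e e0; have [k hk] := half_pow_small e0.
by exists (u k) => // n; rewrite cnB; apply: le_trans (hl n k) (ltW hk).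
Qed.

Definition funalg_sub (D : funalg) : subcs R.
Proof.
refine (@SubCS R (nat -> C) (fS D) supn mulf conjf (@fS0 D) (@fSD D) (@fSZ D) (@fSM D) (@fST D)
  _ _ _ (@funalg_c D) _ _ _ _ _ _ _ _ _ _ _).
- move=> x y /fS_bdd bx /fS_bdd b_y; apply: supn_le => n.
  by apply: (le_trans (cnD _ _)); apply: lerD; apply: supn_ub.
- move=> k x /fS_bdd bx; have [k0|k0] := eqVneq (cn k) 0.
    rewrite -/(cn k) k0 mul0r; apply/le_anti/andP; split.
      by apply: supn_le => n; rewrite cnM k0 mul0r.
    apply: supn_ge0; exists 0 => n; by rewrite cnM k0 mul0r.
  have k1 : 0 < cn k by rewrite lt_def k0 cn_ge0.
  apply/le_anti/andP; split.
    by apply: supn_le => n; rewrite cnM ler_wpM2l ?cn_ge0 ?supn_ub.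
  rewrite mulrC -ler_pdivlMr //; apply: supn_le => n.
  rewrite ler_pdivlMr // mulrC -cnM; apply: (@supn_ub (k *: x)).
  by case: bx => M hM; exists (cn k * M) => m; rewrite cnM ler_wpM2l ?cn_ge0.
- move=> x /fS_bdd bx h; apply/funext => n; apply: cn_eq0; apply/le_anti.
  by rewrite cn_ge0 andbT -h supn_ub.
- by move=> x y z _ _ _; apply/funext => n; rewrite /mulf mulrA.
- by move=> x y z _ _ _; apply/funext => n; rewrite /mulf -mulrDl.
- by move=> x y z _ _ _; apply/funext => n; rewrite /mulf -mulrDr.
- by move=> k x y _ _; apply/funext => n; rewrite /mulf; exact: scalerAl.
- by move=> k x y _ _; apply/funext => n; rewrite /mulf; exact: (mulrCA k).
- by move=> x y _ _; apply/funext => n; rewrite /conjf; exact: rmorphD.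
- by move=> k x _; apply/funext => n; rewrite /conjf; exact: rmorphM.
- by move=> x y _ _; apply/funext => n; rewrite /conjf /mulf rmorphM mulrC.
- by move=> x _; apply/funext => n; rewrite /conjf; exact: conjCK.
- move=> x y /fS_bdd bx /fS_bdd b_y; apply: supn_le => n; rewrite cnM.
  by apply: ler_pM; rewrite ?cn_ge0 ?supn_ub.
- move=> x /fS_bdd bx.
  have E n : cn (mulf (conjf x) x n) = cn (x n) ^+ 2 by rewrite cnM cn_conj.
  have b2 : bdd (mulf (conjf x) x).
    case: bx => M hM; exists (M ^+ 2) => n; rewrite E.
    by rewrite ler_pXn2r ?nnegrE ?cn_ge0 // (le_trans _ (hM n)) ?cn_ge0.
  apply/le_anti/andP; split.
    by apply: supn_le => n; rewrite E ler_pXn2r ?nnegrE ?cn_ge0 ?supn_ge0 ?supn_ub.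
  rewrite -(@sqr_sqrtr _ (supn (mulf (conjf x) x))) ?supn_ge0 //.
  rewrite ler_pXn2r ?nnegrE ?sqrtr_ge0 ?supn_ge0 //; apply: supn_le => n.
  rewrite -(@ler_pXn2r _ 2) ?nnegrE ?cn_ge0 ?sqrtr_ge0 // sqr_sqrtr ?supn_ge0 // -E.
  exact: supn_ub.
Defined.

Definition alg (D : funalg) : cstar_alg R := cs_of_sub (funalg_sub D).

Section AlgTheory.
Variable D : funalg.
Definition fv (x : alg D) : nat -> C := val x.
Definition mkf (x : nat -> C) (h : fS D x) : alg D := @ssub R (funalg_sub D) x h.
Lemma fv_mkf x (h : fS D x) : fv (mkf h) = x. Proof. by []. Qed.
Lemma fvP (x : alg D) : fS D (fv x). Proof. exact: (@scarP R (funalg_sub D)). Qed.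
Lemma fv_inj (x y : alg D) : (forall n, fv x n = fv y n) -> x = y.
Proof. by move=> h; apply/val_inj/funext. Qed.
Lemma fvD (x y : alg D) n : fv (x + y) n = fv x n + fv y n. Proof. by []. Qed.
Lemma fvZ (k : C) (x : alg D) n : fv (k *: x) n = k * fv x n. Proof. by []. Qed.
Lemma fvN (x : alg D) n : fv (- x) n = - fv x n. Proof. by []. Qed.
Lemma fv0 n : fv 0 n = 0. Proof. by []. Qed.
Lemma fvM (x y : alg D) n : fv (cs_mul x y) n = fv x n * fv y n. Proof. by []. Qed.
Lemma fvS (x : alg D) n : fv (cs_star x) n = (fv x n)^*. Proof. by []. Qed.
Lemma fv_sum I (r : seq I) (F : I -> alg D) n : fv (\sum_(i <- r) F i) n = \sum_(i <- r) fv (F i) n.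
Proof. by elim/big_rec2: _ => [//|i y x _ <-]; rewrite fvD. Qed.
Lemma alg_normE (x : alg D) : cs_norm x = supn (fv x).
Proof. by rewrite /cs_norm scar_normE. Qed.
Lemma alg_norm_ub (x : alg D) n : cn (fv x n) <= cs_norm x.
Proof. by rewrite alg_normE; apply/supn_ub/fS_bdd/fvP. Qed.
Lemma alg_norm_le (x : alg D) M : (forall n, cn (fv x n) <= M) -> cs_norm x <= M.
Proof. by rewrite alg_normE; apply: supn_le. Qed.
Lemma alg_norm_adh (x : alg D) e : 0 < e -> exists n, cs_norm x - e < cn (fv x n).
Proof. by move=> e0; rewrite alg_normE; apply: supn_adh => //; apply/fS_bdd/fvP. Qed.
Lemma alg_comm : cs_commutative (alg D).
Proof. by move=> x y; apply: fv_inj => n; rewrite !fvM mulrC. Qed.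
End AlgTheory.
End FunAlg.

(** * Contractivity of homomorphisms *)

Section Power.
Variable R : realType.
(** Otherwise the powers of a / b are unbounded by Bernoulli's inequality. Only exponents 2^k
    appear, since the C*-identity evaluates the norms of iterated squares. *)
Lemma pow2_le (a b K : R) : 0 <= a -> 0 <= b -> 0 <= K ->
  (forall k, a ^+ (2 ^ k) <= K * b ^+ (2 ^ k)) -> a <= b.
Proof.
move=> a0 b0 K0 h; rewrite leNgt; apply/negP => ba.
have {}a0 : 0 < a by apply: le_lt_trans ba.
have [b1|b1] := eqVneq b 0.
  have := h 0%N; rewrite b1 expn0 !expr1 mulr0; lra.
have {b1} b1 : 0 < b by rewrite lt_def b1.
pose t := a / b; have t1 : 0 < t - 1 by rewrite subr_gt0 ltr_pdivlMr // mul1r.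
have bern n : n%:R * (t - 1) <= t ^+ n.
  elim: n => [|n IH]; first by rewrite mul0r.
  have tp : 1 <= t ^+ n by apply: exprn_ege1; lra.
  have : t ^+ n.+1 = t ^+ n + (t - 1) * t ^+ n by rewrite exprS; ring.
  move=> ->; rewrite -natr1 mulrDl mul1r; apply: lerD => //.
  by rewrite ler_peMr // ltW.
have hk k : t ^+ (2 ^ k) <= K.
  by rewrite /t expr_div_n ler_pdivrMr ?exprn_gt0.
have hK := archi_boundP (divr_ge0 K0 (ltW t1)).
have := bern (2 ^ Num.bound (K / (t - 1)))%N; apply/negP; rewrite -ltNge.
apply: (le_lt_trans (hk _)).
move: hK; rewrite ltr_pdivrMr // => hK; apply: (lt_trans hK).
by rewrite ltr_pM2r // ltr_nat ltn_expl.
Qed.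

Lemma sqrtr_dist (a b : R) : 0 <= a -> 0 <= b ->
  `|Num.sqrt a - Num.sqrt b| <= Num.sqrt `|a - b|.
Proof.
wlog ab : a b / b <= a => [hw a0 b0|a0 b0].
  have [h|/ltW h] := leP b a; first exact: hw.
  by rewrite distrC (distrC a); apply: hw.
have hab : 0 <= a - b by rewrite subr_ge0.
rewrite !ger0_norm ?subr_ge0 ?ler_sqrt //.
rewrite lerBlDr -(@ler_pXn2r _ 2) ?nnegrE ?addr_ge0 ?sqrtr_ge0 //.
rewrite sqrrD !sqr_sqrtr // addrAC subrK lerDl mulrn_wge0 // mulr_ge0 ?sqrtr_ge0 //.
Qed.
End Power.

Section BoundedHom.
Variables (R : realType) (A B : cstar_alg R) (h : A -> B) (K : R).
Hypothesis hh : is_star_hom h.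
Hypothesis K0 : 0 <= K.
Hypothesis hK : forall x, cs_norm (h x) <= K * cs_norm x.

Fixpoint sqk (E : cstar_alg R) (y : E) k := if k is k'.+1 then cs_mul (sqk y k') (sqk y k') else y.
Lemma sqk_sa (E : cstar_alg R) (y : E) k : cs_star y = y -> cs_star (sqk y k) = sqk y k.
Proof. by move=> hy; elim: k => //= k IH; rewrite cs_starM IH. Qed.
Lemma sqk_norm (E : cstar_alg R) (y : E) k : cs_star y = y ->
  cs_norm (sqk y k) = cs_norm y ^+ (2 ^ k).
Proof.
move=> hy; elim: k => [|k IH] /=; first by rewrite expn0 expr1.
by rewrite -{1}(sqk_sa k hy) nrmC IH -exprM expnS mulnC.
Qed.
(** For self-adjoint y the norm of the k-th iterated square is exactly the 2^k-th power of the norm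
    of y, so the constant K is lost on taking roots. The C*-identity reduces x to the self-adjoint
    element x*x. *)
Lemma bounded_hom_contr x : cs_norm (h x) <= cs_norm x.
Proof.
have sa y : cs_star y = y -> cs_norm (h y) <= cs_norm y.
  move=> hy; have hhy : cs_star (h y) = h y by rewrite -homS // hy.
  have hs k : h (sqk y k) = sqk (h y) k by elim: k => //= k IH; rewrite homM // IH.
  apply: (@pow2_le _ _ _ K) => [||//|k]; rewrite ?nrm_ge0 //.
  by rewrite -!sqk_norm // -hs; apply: hK.
rewrite -(@ler_pXn2r _ 2) ?nnegrE ?nrm_ge0 // -!nrmC -homS // -homM //.
by apply: sa; rewrite cs_starM cs_starK.
Qed.
End BoundedHom.

Section Calc.
Variable R : realType.
Local Notation C := R[i].
Local Notation N := (@cs_norm R _).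

(** Subtracting 1 makes the function vanish at 0, as functional calculus in an algebra without unit
    requires. *)
Definition gcalc (r : R) : R := Num.sqrt (1 - r ^+ 2) - 1.
Definition fcalc (D : funalg R) := forall x, fS D x -> (forall n, x n = (complex.Re (x n))%:C%C) ->
  (forall n, cn (x n) <= 1) -> fS D (fun n => (gcalc (complex.Re (x n)))%:C%C).

Variables (D : funalg R) (B : cstar_alg R) (h : alg D -> B).
Hypothesis hD : fcalc D.
Hypothesis hh : is_star_hom h.

Lemma conjC_real (r : R) : (r%:C%C)^* = r%:C%C :> C.
Proof. by apply/CrealP; rewrite complex_real. Qed.

(* V = x + i(sqrt(1 - x^2) - 1) satisfies V*V + iV* - iV = 0, since V + i is unitary. *)
Lemma hom_bound2 (x : alg D) : cs_star x = x -> N x <= 1 -> N (h x) <= 2.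
Proof.
move=> xs x1.
have xr n : fv x n = (complex.Re (fv x n))%:C%C.
  by rewrite RRe_real //; apply/CrealP; rewrite -fvS xs.
have xn n : cn (fv x n) <= 1 by apply: le_trans (alg_norm_ub _ _) x1.
pose g : alg D := mkf (hD (fvP x) xr xn).
pose V : alg D := x + 'i%C *: g.
have hV : cs_mul (cs_star V) V = 'i%C *: (V - cs_star V).
  apply: fv_inj => n; rewrite fvM fvS fvZ fvD fvN fvS fvD fvZ fv_mkf xr.
  set r := complex.Re _; rewrite /gcalc; set s := Num.sqrt _.
  have s2 : s ^+ 2 = 1 - r ^+ 2.
    rewrite sqr_sqrtr // subr_ge0 -(@ler_sqrt _ _ 1) ?sqr_ge0 ?ltr01 // sqrtr1 sqrtr_sqr.
    by rewrite -cn_real -xr.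
  rewrite -[(_)^*]/(conjc _); simpc; congr (_ +i* _)%C; move: s2; lra.
have V2 : N (h V) <= 2.
  (* Applying h to the identity for V*V bounds the square of the norm of h V by a multiple of the
     norm itself; no bound on h enters. *)
  have e1 : N (h V) ^+ 2 <= 2 * N (h V).
    rewrite -nrmC -homS // -homM // hV homZ // nrmZ homB // homS //.
    have -> : cn ('i%C : C) = 1 by rewrite /cn normCi.
    rewrite mul1r; apply: (le_trans (nrmD _ _)).
    by rewrite nrmN nrm_star mulr_natl mulr2n.
  have [->|/eqP h0] := eqVneq (N (h V)) 0; first by rewrite ler0n.
  have h1 : 0 < N (h V) by rewrite lt_def nrm_ge0 andbT; apply/eqP.
  by rewrite -(ler_pM2r h1) -expr2.
have -> : x = (2^-1 : C) *: (V + cs_star V).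
  apply: fv_inj => n; rewrite fvZ fvD fvS fvD fvZ fv_mkf xr.
  set r := complex.Re _; move: (gcalc _) => s.
  have -> : 2^-1 = (2^-1 : R)%:C%C by rewrite fmorphV rmorph_nat.
  rewrite -[(_)^*]/(conjc _); simpc; congr (_ +i* _)%C; lra.
rewrite homZ // nrmZ homD // homS //.
have -> : cn (2^-1 : C) = 2^-1.
  by rewrite -[X in cn X](_ : (2^-1 : R)%:C%C = _) ?cn_real ?ger0_norm // fmorphV rmorph_nat.
have := nrmD (h V) (cs_star (h V)); rewrite nrm_star; lra.
Qed.

Lemma hom_bound_sa (x : alg D) : cs_star x = x -> N (h x) <= 2 * N x.
Proof.
move=> xs; have [->|/eqP x0] := eqVneq x 0; first by rewrite hom0 // !nrm0 mulr0.
have h0 : 0 < N x by apply: nrm_gt0.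
have hc : cn ((N x)^-1)%:C%C = (N x)^-1 by rewrite cn_real ger0_norm // invr_ge0 ltW.
have := @hom_bound2 (((N x)^-1)%:C%C *: x).
rewrite cs_starZ conjC_real xs homZ // !nrmZ hc mulVf ?gt_eqF // => /(_ erefl (lexx _)).
by rewrite mulrC ler_pdivrMr.
Qed.

(** Real and imaginary parts contribute 2 each. Any finite constant will do, as [bounded_hom_contr]
    lowers it to 1. *)
Lemma hom_bound4 (x : alg D) : N (h x) <= 4 * N x.
Proof.
pose y := (2^-1 : C) *: (x + cs_star x).
pose z := (- 2^-1 * 'i%C : C) *: (x - cs_star x).
have e2 : (2^-1 : C) = (2^-1 : R)%:C%C by rewrite fmorphV rmorph_nat.
have c2 : cn (2^-1 : C) = 2^-1 by rewrite e2 cn_real ger0_norm.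
have ci : cn ('i%C : C) = 1 by rewrite /cn normCi.
have ys : cs_star y = y by rewrite /y cs_starZ e2 conjC_real cs_starD cs_starK addrC.
have zs : cs_star z = z.
  rewrite /z cs_starZ starB cs_starK e2 -opprB scalerN -scaleNr; congr (_ *: _).
  by rewrite -[(_)^*]/(conjc _); simpc.
have hx : x = y + 'i%C *: z.
  have ii : 'i%C * (- 2^-1 * 'i%C) = 2^-1 :> C.
    by rewrite mulrCA -expr2 sqr_i; ring.
  have xx : x + x = (2 : C) *: x by rewrite scaler_nat mulr2n.
  rewrite /y /z scalerA ii -scalerDr addrACA subrr addr0 xx scalerA.
  by rewrite mulVf ?scale1r // pnatr_eq0.
have hs : N (cs_star x) = N x := nrm_star x.
have ny : N y <= N x.
  rewrite nrmZ c2; have := nrmD x (cs_star x); lra.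
have nz : N z <= N x.
  rewrite nrmZ cnM cnN c2 ci; have := nrmD x (- cs_star x); rewrite nrmN; lra.
have -> : h x = h y + 'i%C *: h z by rewrite {1}hx homD // homZ.
apply: (le_trans (nrmD _ _)); rewrite nrmZ ci mul1r.
have := hom_bound_sa ys; have := hom_bound_sa zs; lra.
Qed.

Lemma alg_hom_contr (x : alg D) : N (h x) <= N x.
Proof. by apply: (@bounded_hom_contr _ _ _ _ 4) => // y; exact: hom_bound4. Qed.
End Calc.

(* kap m n is the class of the point n in the m-th of a refining sequence of finite
   partitions. Class 0 collects the points at which the functions of level m vanish,
   so that no unit is forced. *)
Record kappa := Kappa {
  kap :> nat -> nat -> nat;
  kap_fin : forall m, exists M, forall n, (kap m n < M)%N;
  kap_ref : forall m n n', kap m.+1 n = kap m.+1 n' -> kap m n = kap m n';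
  kap_ref0 : forall m n, kap m.+1 n = 0%N -> kap m n = 0%N }.

(** * The algebra of a refining sequence of partitions *)

Section KappaAlg.
Variable R : realType.
Variable K : kappa.
Local Notation C := R[i].
Local Notation N := (@cs_norm R _).

Definition Fk m : set (nat -> C) := [set x |
  (forall n n', K m n = K m n' -> x n = x n') /\ forall n, K m n = 0%N -> x n = 0].
Definition Sk : set (nat -> C) := [set x | forall e : R, 0 < e ->
  exists m y, Fk m y /\ forall n, cn (x n - y n) <= e].

Lemma kap_refle m m' n n' : (m <= m')%N -> K m' n = K m' n' -> K m n = K m n'.
Proof.
move=> /subnK <-; elim: (m' - m)%N => //= j IH; rewrite addSn => /kap_ref; exact: IH.
Qed.
Lemma kap_ref0le m m' n : (m <= m')%N -> K m' n = 0%N -> K m n = 0%N.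
Proof.
move=> /subnK <-; elim: (m' - m)%N => //= j IH; rewrite addSn => /kap_ref0; exact: IH.
Qed.
Lemma Fk_mono m m' x : (m <= m')%N -> Fk m x -> Fk m' x.
Proof.
move=> mm [h1 h2]; split=> [n n' h|n h]; first exact/h1/(kap_refle mm).
exact/h2/(kap_ref0le mm).
Qed.
Lemma Fk_Sk m x : Fk m x -> Sk x.
Proof. by move=> h e e0; exists m, x; split=> // n; rewrite subrr cn0 ltW. Qed.

Definition krep m c : nat := if pselect (exists n, K m n = c) is left h then sval (cid h) else 0%N.
Lemma krepP m n : K m (krep m (K m n)) = K m n.
Proof.
rewrite /krep; case: pselect => [h|[]]; last by exists n.
by case: cid.
Qed.

Lemma Fk_bdd m x : Fk m x -> bdd x.
Proof.
move=> [h1 _]; have [M hM] := kap_fin K m.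
exists (\sum_(c < M) cn (x (krep m c))) => n.
rewrite (h1 n (krep m (K m n))) ?krepP // (bigD1 (Ordinal (hM n))) //=.
by rewrite lerDl sumr_ge0 // => *; apply: cn_ge0.
Qed.

Lemma Sk_bdd x : Sk x -> bdd x.
Proof.
move=> /(_ 1 ltr01) [m [y [/Fk_bdd [M hM] hy]]]; exists (1 + M) => n.
by rewrite -(subrK (y n) (x n)); apply: (le_trans (cnD _ _)); apply: lerD.
Qed.

Definition FA_F (m : nat) : funalg R.
Proof.
refine (@FunAlg R (Fk m) (@Fk_bdd m) _ _ _ _ _ _).
- by split.
- move=> x y [a b] [c d]; split=> [n n' h|n h].
    by rewrite -[LHS]/(x n + y n) (a n n') ?(c n n').
  by rewrite -[LHS]/(x n + y n) b ?d ?addr0.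
- move=> k x [a b]; split=> [n n' h|n h].
    by rewrite -[LHS]/(k * x n) (a n n').
  by rewrite -[LHS]/(k * x n) b ?mulr0.
- move=> x y [a b] [c d]; split=> [n n' h|n h].
    by rewrite /mulf (a n n') ?(c n n').
  by rewrite /mulf b ?mul0r.
- move=> x [a b]; split=> [n n' h|n h]; first by rewrite /conjf (a n n').
  by rewrite /conjf b ?conjC0.
- move=> x hx; split=> [n n' h|n h].
    apply/eqP; rewrite -subr_eq0; apply/eqP/cn_eq0/le_anti; rewrite cn_ge0 andbT.
    apply/ler_addgt0Pr => e e0; rewrite add0r.
    have [|y [a b] hy] := hx (e / 2); first by rewrite divr_gt0.
    have -> : x n - x n' = (x n - y n) - (x n' - y n').
      by rewrite opprB addrA (a n n') // subrK.
    apply: (le_trans (cnD _ _)); rewrite cnN; have := hy n; have := hy n'; lra.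
  apply: cn_eq0; apply/le_anti; rewrite cn_ge0 andbT.
  apply/ler_addgt0Pr => e e0; rewrite add0r; have [y [a b] hy] := hx _ e0.
  by have := hy n; rewrite (b n) // subr0.
Defined.

Definition FA_S : funalg R.
Proof.
refine (@FunAlg R Sk Sk_bdd _ _ _ _ _ _).
- exact: (@Fk_Sk 0%N _ (@fS0 _ (FA_F 0))).
- move=> x y hx hy e e0; have e2 : 0 < e / 2 by rewrite divr_gt0.
  have [m [x' [h1 h2]]] := hx _ e2; have [m' [y' [h1' h2']]] := hy _ e2.
  exists (maxn m m'), (x' + y'); split.
    by apply: (@fSD _ (FA_F (maxn m m'))); [apply: Fk_mono h1 | apply: Fk_mono h1'];
      rewrite ?leq_maxl ?leq_maxr.
  move=> n; rewrite -[(x + y) n]/(x n + y n) -[(x' + y') n]/(x' n + y' n).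
  rewrite opprD addrACA; apply: (le_trans (cnD _ _)); have := h2 n; have := h2' n; lra.
- move=> k x hx e e0; have [d d0 hd] := lt_split (cn_ge0 k) e0.
  have [m [x' [h1 h2]]] := hx _ d0; exists m, (k *: x'); split.
    exact: (@fSZ _ (FA_F m)).
  move=> n; rewrite -[(k *: x) n]/(k * x n) -[(k *: x') n]/(k * x' n) -mulrBr cnM.
  by apply: le_trans (ltW hd); rewrite ler_wpM2l ?cn_ge0.
- move=> x y hx hy e e0; have [M hM] := Sk_bdd hx; have [M' hM'] := Sk_bdd hy.
  have M0 : 0 <= M by apply: le_trans (hM 0%N); apply: cn_ge0.
  have M0' : 0 <= M' by apply: le_trans (hM' 0%N); apply: cn_ge0.
  have [d d0 hd] := @lt_split _ (M + (M' + 1)) e (addr_ge0 M0 (addr_ge0 M0' ler01)) e0.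
  pose dd := Num.min d 1; have dd0 : 0 < dd by rewrite lt_min d0 ltr01.
  have [m [x' [h1 h2]]] := hx _ dd0; have [m' [y' [h1' h2']]] := hy _ dd0.
  exists (maxn m m'), (mulf x' y'); split.
    by apply: (@fSM _ (FA_F (maxn m m'))); [apply: Fk_mono h1 | apply: Fk_mono h1'];
      rewrite ?leq_maxl ?leq_maxr.
  move=> n; rewrite /mulf.
  have -> : x n * y n - x' n * y' n = x n * (y n - y' n) + (x n - x' n) * y' n by ring.
  apply: (le_trans (cnD _ _)); rewrite !cnM.
  have q1 : cn (y' n) <= M' + 1.
    rewrite -(subrK (y n) (y' n)); apply: (le_trans (cnD _ _)); rewrite cnB addrC.
    apply: lerD => //; apply: le_trans (h2' n) _; by rewrite ge_min lexx orbT.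
  have q2 : cn (y n - y' n) <= d by apply: le_trans (h2' n) _; rewrite ge_min lexx.
  have q3 : cn (x n - x' n) <= d by apply: le_trans (h2 n) _; rewrite ge_min lexx.
  apply: le_trans (ltW hd); rewrite mulrDl (mulrC (M' + 1)).
  by apply: lerD; apply: ler_pM; rewrite ?cn_ge0.
- move=> x hx e e0; have [m [x' [h1 h2]]] := hx _ e0; exists m, (conjf x'); split.
    exact: (@fST _ (FA_F m)).
  by move=> n; rewrite /conjf -rmorphB cn_conj.
- move=> x hx e e0; have e2 : 0 < e / 2 by rewrite divr_gt0.
  have [y /(_ _ e2) [m [z [h1 h2]]] h3] := hx _ e2; exists m, z; split=> // n.
  have -> : x n - z n = (x n - y n) + (y n - z n) by rewrite addrA subrK.
  apply: (le_trans (cnD _ _)); have := h2 n; have := h3 n; lra.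
Defined.

Lemma FA_F_calc m : fcalc (FA_F m).
Proof.
move=> x [a b] _ _; split=> [n n' h|n h]; first by rewrite (a n n').
by rewrite b //= /gcalc expr0n subr0 sqrtr1 subrr.
Qed.

(** A simple function close to x may leave the interval [-1, 1] in which the square root is
    meaningful; clipping brings it back without moving it away from x. *)
Definition clip (r : R) : R := Num.max (-1) (Num.min 1 r).
Lemma clip_le1 r : `|clip r| <= 1.
Proof.
rewrite /clip ler_norml le_max lexx ge_max ge_min lexx /= andbT; lra.
Qed.
Lemma clip_dist r s : `|r| <= 1 -> `|r - clip s| <= `|r - s|.
Proof.
rewrite ler_norml => /andP[h1 h2]; rewrite /clip maxEle minEle; case: (leP 1 s) => h.
  have -> : (-1 <= 1 :> R) = true by lra.
  by rewrite !ler0_norm; lra.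
have [h'|h'] := leP (-1) s; first exact: lexx.
rewrite !ger0_norm; lra.
Qed.

Lemma FA_S_calc : fcalc FA_S.
Proof.
move=> x hx xr x1 e e0.
(* Square roots differ by at most the root of the difference, here (y' - r)(y' + r), whose second
   factor is at most 2; a distance e^2 / 2 therefore yields e. *)
have d0 : 0 < e ^+ 2 / 2 by rewrite divr_gt0 // exprn_gt0.
have [m [y [[a b] hy]]] := hx _ d0.
pose y' n := clip (complex.Re (y n)).
exists m, (fun n => (gcalc (y' n))%:C%C); split.
  split=> [n n' h|n h]; first by rewrite /y' (a n n').
  rewrite /y' b //= /clip min_r ?ler01 // max_r ?lerN10 //.
  by rewrite /gcalc expr0n subr0 sqrtr1 subrr.
move=> n; rewrite -rmorphB /= cn_real /gcalc; set r := complex.Re (x n).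
have r1 : `|r| <= 1 by rewrite -cn_real -xr.
have y1 : `|y' n| <= 1 by apply: clip_le1.
have hd : `|r - y' n| <= e ^+ 2 / 2.
  apply: (le_trans (clip_dist _ r1)); apply: le_trans (hy n).
  by apply: le_trans (cn_Re _); rewrite raddfB.
have sq1 (s : R) : `|s| <= 1 -> 0 <= 1 - s ^+ 2.
  by move=> s1; rewrite subr_ge0 -real_normK ?num_real // exprn_ile1.
rewrite opprB addrA subrK.
apply: (le_trans (sqrtr_dist (sq1 _ r1) (sq1 _ y1))).
rewrite -[leRHS](ger0_norm (ltW e0)) -[leRHS]sqrtr_sqr ler_sqrt ?sqr_ge0 //.
have -> : 1 - r ^+ 2 - (1 - y' n ^+ 2) = (y' n - r) * (y' n + r) by ring.
rewrite normrM distrC.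
apply: (@le_trans _ _ (e ^+ 2 / 2 * 2)); last by rewrite mulfVK ?pnatr_eq0.
apply: ler_pM => //; apply: (le_trans (ler_normD _ _)); lra.
Qed.

Definition Alg := alg FA_S.
Definition Flev m := alg (FA_F m).
Definition inF m m' (mm : (m <= m')%N) (x : Flev m) : Flev m' :=
  @mkf R (FA_F m') (fv x) (Fk_mono mm (fvP x)).
Definition inS m (x : Flev m) : Alg := @mkf R FA_S (fv x) (Fk_Sk (fvP x)).

Lemma inS_hom m : is_star_hom (@inS m).
Proof. split=> [k x y|x y|x]; apply: fv_inj => n.
- by rewrite fvD fvZ !fv_mkf fvD fvZ.
- by rewrite -[LHS]/(fv x n * fv y n).
- by rewrite -[LHS]/(fv x n)^*. Qed.
Lemma inF_hom m m' (mm : (m <= m')%N) : is_star_hom (inF mm).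
Proof. split=> [k x y|x y|x]; apply: fv_inj => n.
- by rewrite fvD fvZ !fv_mkf fvD fvZ.
- by rewrite -[LHS]/(fv x n * fv y n).
- by rewrite -[LHS]/(fv x n)^*. Qed.

Lemma Alg_approx (x : Alg) e : 0 < e -> exists m (z : Flev m), N (x - inS z) < e.
Proof.
move=> e0; have [m [y [h1 h2]]] := (fvP x : Sk (fv x)) _ (divr_gt0 e0 (ltr0n _ 2)).
exists m, (@mkf R (FA_F m) y h1).
apply: (@le_lt_trans _ _ (e / 2)); last lra.
by apply: alg_norm_le.
Qed.

Lemma Flev_fin m : cs_finite_dim (Flev m).
Proof.
have [M hM] := kap_fin K m.
have hb (c : 'I_M) : Fk m (fun n => ((K m n == c) && (K m n != 0%N))%:R).
  by split=> [n n' -> //|n ->]; rewrite eqxx andbF.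
exists M, (fun c => @mkf R (FA_F m) _ (hb c)) => x.
exists (fun c => fv x (krep m c)); apply: fv_inj => n; rewrite fv_sum.
have [h1 h2] := fvP x.
rewrite (bigD1 (Ordinal (hM n))) //= big1 ?addr0 => [|c hc]; last first.
  rewrite fvZ fv_mkf; case: eqP => [e|_]; last by rewrite mulr0.
  by case/eqP: hc; apply/val_inj; rewrite /= e.
rewrite fvZ fv_mkf eqxx /=; case: eqP => [e|_] /=; first by rewrite mulr0; apply: h2.
by rewrite mulr1; apply: h1; rewrite krepP.
Qed.

(** A cocone is contractive on each level by [alg_hom_contr], so the map it induces on the dense
    union extends. Two extensions are again contractive and agree on that union, which gives
    uniqueness. *)
Lemma Alg_limit : @is_inductive_limit R Flev (fun n => inF (leqnSn n)) Alg (fun n => @inS n).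
Proof.
split; [exact: inS_hom | by move=> n x; apply: fv_inj |].
move=> B la hla hc.
have lift n m (nm : (n <= m)%N) (z : Flev n) : la m (inF nm z) = la n z.
  have [j hj] : exists j, m = (j + n)%N by exists (m - n)%N; rewrite subnK.
  move: nm; rewrite {}hj; elim: j => [|j IH] nm.
    by apply: (f_equal (la _)); apply: fv_inj.
  have E : inF nm z = inF (leqnSn (j + n)) (inF (leq_addl j n) z) by apply: fv_inj.
  by rewrite E hc.
pose G (x : Alg) (y : B) := exists m (z : Flev m), x = inS z /\ y = la m z.
have oG : opclosed G.
  split.
  - by exists 0%N, 0; rewrite (hom0 (inS_hom _)) (hom0 (hla _)).
  - move=> _ _ _ _ [m [z [-> ->]]] [m' [z' [-> ->]]].
    exists (maxn m m'), (inF (leq_maxl _ _) z + inF (leq_maxr _ _) z').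
    by rewrite (homD (hla _)) !lift; split=> //; apply: fv_inj.
  - move=> _ _ _ _ [m [z [-> ->]]] [m' [z' [-> ->]]].
    exists (maxn m m'), (cs_mul (inF (leq_maxl _ _) z) (inF (leq_maxr _ _) z')).
    by rewrite (homM (hla _)) !lift; split=> //; apply: fv_inj.
  - move=> _ _ [m [z [-> ->]]]; exists m, (cs_star z).
    by rewrite (homS (hla _)); split=> //; apply: fv_inj.
  - move=> n _ _ [m [z [-> ->]]]; exists m, (gauss_of_nat R n *: z).
    by rewrite (homZ (hla _)) (homZ (inS_hom _)).
have [x y [m [z [-> ->]]]|x e e0|u [hu gu _ _]] := @extension R Alg B G 1 oG ler01.
- rewrite mul1r; apply: le_trans (alg_hom_contr (@FA_F_calc m) (hla m) _) _.
  by apply: alg_norm_le => n; apply: (alg_norm_ub (inS z)).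
- by have [m [z hz]] := Alg_approx x e0; exists (inS z), (la m z); split=> //; exists m, z.
exists u; split; first by split=> // n x; apply: gu; exists n, x.
move=> v [hv gv]; apply/funext => x; apply/eqP; rewrite -subr_eq0; apply/eqP/nrm_small => e e0.
have e2 : 0 < e / 2 by rewrite divr_gt0.
have [m [z hz]] := Alg_approx x e2.
have -> : u x - v x = u (x - inS z) - v (x - inS z).
  rewrite (homB hu) (homB hv) gv (gu (inS z) (la m z)); last by exists m, z.
  by rewrite opprB addrA subrK.
apply: (le_trans (nrmD _ _)); rewrite nrmN.
have := alg_hom_contr FA_S_calc hu (x - inS z).
have := alg_hom_contr FA_S_calc hv (x - inS z); lra.
Qed.

Lemma Alg_AF : is_AF Alg.
Proof.
exists Flev, (fun n => inF (leqnSn n)), Alg, (fun n => @inS n); split.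
- exact: Flev_fin.
- by move=> n; apply: inF_hom.
- exact: Alg_limit.
- by exists id; [split | exists id].
Qed.
End KappaAlg.

(** * Commutative AF algebras as algebras of functions *)

Section LimDense.
Variables (R : realType) (F : nat -> cstar_alg R) (h : forall n, F n -> F n.+1).
Variables (L : cstar_alg R) (mu : forall n, F n -> L).
Local Notation N := (@cs_norm R _).
Arguments h : clear implicits.
Arguments mu : clear implicits.
Hypothesis lim : is_inductive_limit h mu.

Lemma lim_up n m (x : F n) : (n <= m)%N -> exists y : F m, mu m y = mu n x.
Proof.
move=> /subnK <-; elim: (m - n)%N => [|j [y hy]]; first by exists x.
by case: lim => _ hc _; exists (h _ y); rewrite hc.
Qed.

Definition limG (x y : L) := x = y /\ exists n (z : F n), x = mu n z.
Lemma limG_opclosed : opclosed limG.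
Proof.
case: lim => hmu _ _; split.
- by split=> //; exists 0%N, 0; rewrite (hom0 (hmu _)).
- move=> x _ x' _ [<- [n [z ->]]] [<- [n' [z' ->]]]; split=> //.
  have [a ha] := lim_up z (leq_maxl n n'); have [b hb] := lim_up z' (leq_maxr n n').
  by exists (maxn n n'), (a + b); rewrite (homD (hmu _)) ha hb.
- move=> x _ x' _ [<- [n [z ->]]] [<- [n' [z' ->]]]; split=> //.
  have [a ha] := lim_up z (leq_maxl n n'); have [b hb] := lim_up z' (leq_maxr n n').
  by exists (maxn n n'), (cs_mul a b); rewrite (homM (hmu _)) ha hb.
- by move=> x _ [<- [n [z ->]]]; split=> //; exists n, (cs_star z); rewrite (homS (hmu _)).
- move=> k x _ [<- [n [z ->]]]; split=> //; exists n, (gauss_of_nat R k *: z).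
  by rewrite (homZ (hmu _)).
Qed.

Definition limS : set L := [set x | clos limG x x].

Lemma limS_complete (u : nat -> L) : (forall n, limS (u n)) ->
  (forall k n, (k <= n)%N -> N (u n - u k) <= 2^-1 ^+ k) ->
  exists l, limS l /\ forall k, N (u k - l) <= 2^-1 ^+ k.
Proof.
move=> hS hu; have [l hl] := nrm_complete hu; exists l; split=> //.
apply: clos_clos => e e0; have [k hk] := half_pow_small e0; exists (u k), (u k).
by rewrite nrmB; split; [exact: hS | |]; apply: le_lt_trans (hl k) hk.
Qed.

Definition lim_sub : subcs R.
Proof.
pose oc := clos_opclosed limG_opclosed.
refine (@SubCS R L limS (fun x => N x) (@cs_mul R L) (@cs_star R L) (oc0 oc) _ _ _ _ _ _ _ limS_complete
  _ _ _ _ _ _ _ _ _ _ _).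
- by move=> x y hx hy; apply: (ocD oc).
- by move=> k x hx; apply: (closZ _ limG_opclosed).
- by move=> x y hx hy; apply: (ocM oc).
- by move=> x hx; apply: (ocS oc).
- by move=> x y _ _; apply: nrmD.
- by move=> k x _; apply: nrmZ.
- by move=> x _; apply: nrm_eq0.
- by move=> *; apply: cs_mulA.
- by move=> *; apply: cs_mulDl.
- by move=> *; apply: cs_mulDr.
- by move=> *; apply: cs_scaleAl.
- by move=> *; apply: cs_scaleAr.
- by move=> *; apply: cs_starD.
- by move=> *; apply: cs_starZ.
- by move=> *; apply: cs_starM.
- by move=> *; apply: cs_starK.
- by move=> *; apply: nrmM.
- by move=> *; apply: nrmC.
Defined.

(* the closure of the union is a C*-algebra through which the limit property
   factors the identity *)
Lemma lim_dense (x : L) e : 0 < e -> exists n (z : F n), N (x - mu n z) < e.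
Proof.
case: lim => hmu hc univ e0.
have hS n (z : F n) : @sS _ lim_sub (mu n z) by apply: clos_incl; split=> //; exists n, z.
pose la n (z : F n) : cs_of_sub lim_sub := @ssub _ lim_sub _ (hS n z).
have hla n : is_star_hom (la n).
  split=> [k y z|y z|y]; apply/val_inj => /=.
  - by rewrite (homD (hmu _)) (homZ (hmu _)).
  - by rewrite (homM (hmu _)).
  - by rewrite (homS (hmu _)).
have hlac n (z : F n) : la n.+1 (h n z) = la n z by apply/val_inj; exact: hc.
have [u [[hu uE] _]] := univ (cs_of_sub lim_sub) la hla hlac.
have [v [_ vU]] := univ L mu hmu hc.
pose w (y : L) : L := val (u y).
have hw : is_star_hom w.
  split=> [k y z|y z|y]; rewrite /w.
  - by rewrite (homD hu) (homZ hu).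
  - by rewrite (homM hu).
  - by rewrite (homS hu).
have e1 : v = w by apply: vU; split=> // n z; rewrite /w uE.
have e2 : v = id by apply: vU; split.
have wx : w x = x by rewrite -e1 e2.
have := @scarP _ lim_sub (u x); rewrite -[val _]/(w x) wx => /(_ e e0).
by move=> [_ [_ [[_ [n [z ->]]] hz _]]]; exists n, z.
Qed.
End LimDense.

(** * Minimal projections of finite-dimensional commutative algebras *)

Section FinProj.
Variables (R : realType) (L : cstar_alg R).
Local Notation C := R[i].
Local Notation N := (@cs_norm R _).
Local Notation "x ** y" := (cs_mul x y) (at level 40, left associativity).
Hypothesis comm : cs_commutative L.

Lemma lin_dep n (b : 'I_n -> L) (v : 'I_n.+1 -> L) :
  (forall j, exists k : 'I_n -> C, v j = \sum_i k i *: b i) ->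
  exists c : 'I_n.+1 -> C, (exists j, c j != 0) /\ \sum_j c j *: v j = 0.
Proof.
move=> h; pose k j := sval (cid (h j)).
have hk j : v j = \sum_i k j i *: b i by rewrite /k; case: cid.
pose M : 'M[C]_(n.+1, n) := \matrix_(j, i) k j i.
have : kermx M != 0.
  by rewrite -mxrank_eq0 mxrank_ker subn_eq0 -ltnNge ltnS rank_leq_col.
move=> /rowV0Pn [r /sub_kermxP rM r0]; exists (fun j => r 0 j); split.
  apply: contrapT => hn; case/eqP: r0; apply/rowP => j; rewrite mxE; apply/eqP.
  by apply: contrapT => /negP rj; apply: hn; exists j.
under eq_bigr do rewrite hk scaler_sumr.
rewrite exchange_big big1 //= => i _.
have := congr1 (fun A : 'rV_n => A 0 i) rM; rewrite !mxE => e.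
under eq_bigr do rewrite scalerA.
rewrite -scaler_suml; rewrite (_ : \sum_(j < n.+1) _ = 0) ?scale0r //.
by rewrite -[RHS]e; apply: eq_bigr => j _; rewrite mxE.
Qed.

(** This is P(y)w. For lack of a unit P(y) itself need not exist, but the constant term can still
    act on w. *)
Definition actp (y w : L) n (P : {poly C}) : L := \sum_(i < n) P`_i *: iter i (cs_mul y) w.

Lemma actp_factor y w n (Q : {poly C}) r : (size Q <= n)%N ->
  actp y w n.+1 (('X - r%:P) * Q) = y ** actp y w n Q - r *: actp y w n Q.
Proof.
move=> sQ; rewrite /actp mulrBl.
under eq_bigr do rewrite coefB coefXM coefCM scalerBl -scalerA.
rewrite big_split /= sumrN -scaler_sumr; congr (_ - _ *: _).
  rewrite big_ord_recl /= scale0r add0r.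
  have mulsum (r' : seq 'I_n) (F : 'I_n -> L) :
    y ** (\sum_(i <- r') F i) = \sum_(i <- r') y ** F i.
    elim: r' => [|a l IH]; first by rewrite !big_nil mulx0.
    by rewrite !big_cons cs_mulDr IH.
  by rewrite mulsum; apply: eq_bigr => i _; rewrite cs_scaleAr.
by rewrite big_ord_recr /= nth_default // scale0r addr0.
Qed.

Variables (W : set L) (n : nat) (b : 'I_n -> L).
Hypothesis W0 : W 0.
Hypothesis WD : forall x y, W x -> W y -> W (x + y).
Hypothesis WZ : forall (k : C) x, W x -> W (k *: x).
Hypothesis WM : forall x y, W x -> W y -> W (x ** y).
Hypothesis WS : forall x, W x -> W (cs_star x).
Hypothesis Wb : forall i, W (b i).
Hypothesis Wspan : forall x, W x -> exists k : 'I_n -> C, x = \sum_i k i *: b i.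

Section Ideal.
Variable M : set L.
Hypothesis MW : M `<=` W.
Hypothesis M0 : M 0.
Hypothesis MD : forall x y, M x -> M y -> M (x + y).
Hypothesis MZ : forall (k : C) x, M x -> M (k *: x).
Hypothesis MM : forall x y, W x -> M y -> M (x ** y).

Lemma M_iter y w i : W y -> M w -> M (iter i (cs_mul y) w).
Proof. by move=> hy hw; elim: i => //= i IH; apply: MM. Qed.
Lemma M_actp y w m P : W y -> M w -> M (actp y w m P).
Proof.
move=> hy hw; rewrite /actp; elim/big_ind: _ => // i _; apply/MZ/M_iter => //.
Qed.
Lemma actp_eig y w m P z (l : C) : z ** w = l *: w -> z ** actp y w m P = l *: actp y w m P.
Proof.
move=> hz; rewrite /actp scaler_sumr.
have hi i : z ** iter i (cs_mul y) w = l *: iter i (cs_mul y) w.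
  elim: i => //= i IH; rewrite cs_mulA (comm z) -cs_mulA IH.
  by rewrite -cs_scaleAr.
elim: m => [|m IH]; first by rewrite !big_ord0 mulx0.
by rewrite !big_ord_recr /= cs_mulDr IH -cs_scaleAr hi !scalerA mulrC.
Qed.

(** The vectors y^j w with j <= n are dependent, so some P <> 0 satisfies P(y)w = 0. Splitting off a
    root, P = (X - r)Q, either Q(y)w = 0 and the degree has dropped, or Q(y)w is an eigenvector. By
    commutativity it keeps the eigenvalues w already had, so the step can be iterated over a
    basis. *)
Lemma eigen1 y w : W y -> M w -> w <> 0 -> exists w', [/\ M w', w' <> 0,
  (exists l : C, y ** w' = l *: w') &
  forall z (l : C), z ** w = l *: w -> z ** w' = l *: w'].
Proof.
move=> hy hw w0.
have [c [[j cj] hc]] : exists c : 'I_n.+1 -> C,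
    (exists j, c j != 0) /\ \sum_j c j *: iter j (cs_mul y) w = 0.
  by apply: (@lin_dep _ b) => j; apply/Wspan/MW/M_iter.
pose P := \poly_(i < n.+1) c (inord i).
have P0 : P != 0.
  apply/eqP => /(congr1 (fun p : {poly C} => p`_j)); rewrite coef_poly ltn_ord inord_val coef0.
  exact/eqP.
have aP : actp y w n.+1 P = 0.
  rewrite -[RHS]hc /actp; apply: eq_bigr => i _.
  by rewrite coef_poly ltn_ord inord_val.
have : (size P <= n.+1)%N by apply: size_poly.
move: P0 aP; move: P => P; move: n.+1 => m.
elim: m P => [|m IH] P P0 aP; first by rewrite leqn0 size_poly_eq0 (negPf P0).
move=> sP; have [s1|s1] := eqVneq (size P) 1%N.
  move/eqP/size_poly1P: s1 => [a a0 eP]; case: w0.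
  move: aP; rewrite eP /actp big_ord_recl big1 ?addr0 => [|i _]; last first.
    by rewrite coefC scale0r.
  rewrite coefC /= => /(congr1 (GRing.scale a^-1)).
  by rewrite scalerA mulVf // scale1r scaler0.
have [r hr] := closed_rootP _ s1.
have [Q eP] : exists Q, P = ('X - r%:P) * Q.
  by have /factor_theorem [Q ->] := hr; exists Q; rewrite mulrC.
have Q0 : Q != 0 by apply: contraNneq P0 => q; rewrite eP q mulr0.
have sQ : (size Q <= m)%N.
  by move: sP; rewrite eP size_monicM ?monicXsubC // size_XsubC.
rewrite eP actp_factor // in aP.
have [q0|/eqP q0] := eqVneq (actp y w m Q) 0; first exact: (IH Q).
exists (actp y w m Q); split=> //; first exact: M_actp.
  by exists r; apply/eqP; rewrite -subr_eq0 aP.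
by move=> z l; apply: actp_eig.
Qed.

Lemma common_eigen w : M w -> w <> 0 -> exists w', [/\ M w', w' <> 0 &
  forall x, W x -> exists l : C, x ** w' = l *: w'].
Proof.
move=> hw w0.
have [w' [h1 h2 h3]] : exists w', [/\ M w', w' <> 0 &
    forall i, exists l : C, b i ** w' = l *: w'].
  suff H (s : seq 'I_n) : exists w', [/\ M w', w' <> 0 &
    forall i, i \in s -> exists l : C, b i ** w' = l *: w'].
    have [w' [a1 a2 a3]] := H (enum 'I_n); exists w'; split=> // i; apply: a3.
    by rewrite mem_enum.
  elim: s => [|i s [w1 [a1 a2 a3]]]; first by exists w.
  have [w2 [b1 b2 b3 b4]] := eigen1 (Wb i) a1 a2; exists w2; split=> // j.
  by rewrite inE => /orP[/eqP-> //|/a3 [l /b4 hl]]; exists l.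
exists w'; split=> // x /Wspan [k ->].
pose l i := sval (cid (h3 i)).
exists (\sum_i k i * l i); rewrite scaler_suml.
have mulsum (r' : seq 'I_n) (F : 'I_n -> L) :
  (\sum_(i <- r') F i) ** w' = \sum_(i <- r') F i ** w'.
  elim: r' => [|a s IH]; first by rewrite !big_nil mul0.
  by rewrite !big_cons cs_mulDl IH.
rewrite mulsum; apply: eq_bigr => i _; rewrite -cs_scaleAl -scalerA; congr (_ *: _).
by rewrite /l; case: cid.
Qed.

(* if w is a common eigenvector, so is w*w, which is a multiple of a projection *)
Lemma min_proj w : M w -> w <> 0 -> exists p, [/\ M p, p <> 0, p ** p = p, cs_star p = p &
  forall x, W x -> exists l : C, x ** p = l *: p].
Proof.
move=> /common_eigen h /h [{h}w1 [h1 h2 h3]].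
pose v := cs_star w1 ** w1.
have vM : M v by apply: MM => //; apply/WS/MW.
have v0 : v <> 0.
  move=> e; apply/h2/nrm_eq0/eqP; rewrite -sqrf_eq0 -nrmC -/v e nrm0 //.
have vs : cs_star v = v by rewrite /v cs_starM cs_starK.
have ve x : W x -> exists l : C, x ** v = l *: v.
  move=> /h3 [l hl]; exists l; rewrite /v cs_mulA (comm x) -cs_mulA hl.
  by rewrite -cs_scaleAr.
have [l hl] := ve _ (MW vM).
have l0 : l != 0.
  apply/eqP => e; apply/v0/nrm_eq0/eqP; rewrite -sqrf_eq0 -nrmC vs hl e scale0r nrm0 //.
have lr : l^* = l.
  have := congr1 (@cs_star R L) hl; rewrite cs_starM cs_starZ !vs hl => /eqP.
  rewrite -subr_eq0 -scalerBl scaler_eq0 subr_eq0 => /orP[/eqP //|/eqP //].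
exists (l^-1 *: v); split.
- exact: MZ.
- by move=> /eqP; rewrite scaler_eq0 invr_eq0 (negPf l0) /= => /eqP.
- by rewrite -cs_scaleAl -cs_scaleAr hl !scalerA -mulrA mulVf // mulr1.
- by rewrite cs_starZ vs; congr (_ *: _); rewrite -[RHS](congr1 GRing.inv lr); exact: fmorphV.
- by move=> x /ve [k hk]; exists k; rewrite -cs_scaleAr hk !scalerA mulrC.
Qed.
End Ideal.

(** Clause [prE] expresses minimality: multiplication by e i makes W one-dimensional. *)
Record projs k (e : nat -> L) : Prop := Projs {
  prW : forall i, (i < k)%N -> W (e i);
  pr0 : forall i, (i < k)%N -> e i <> 0;
  prM : forall i, (i < k)%N -> e i ** e i = e i;
  prS : forall i, (i < k)%N -> cs_star (e i) = e i;
  prO : forall i j, (i < k)%N -> (j < k)%N -> i <> j -> e i ** e j = 0;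
  prE : forall i x, (i < k)%N -> W x -> exists l : C, x ** e i = l *: e i }.

Lemma projs_bound k e : projs k e -> (k <= n)%N.
Proof.
move=> pe; rewrite leqNgt; apply/negP => kn.
have [c [[j cj] hc]] : exists c : 'I_n.+1 -> C, (exists j, c j != 0) /\ \sum_j c j *: e j = 0.
  by apply: (@lin_dep _ b) => j; apply/Wspan/(prW pe)/(leq_trans _ kn).
have ik (i : 'I_n.+1) : (i < k)%N by apply: leq_trans kn.
have : (\sum_i c i *: e i) ** e j = 0 by rewrite hc mul0.
have mulsum (r' : seq 'I_n.+1) (F : 'I_n.+1 -> L) w' :
  (\sum_(i <- r') F i) ** w' = \sum_(i <- r') F i ** w'.
  elim: r' => [|a s IH]; first by rewrite !big_nil mul0.
  by rewrite !big_cons cs_mulDl IH.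
rewrite mulsum (bigD1 j) //= big1 ?addr0 => [|i /eqP ij]; last first.
  rewrite -cs_scaleAl (prO pe) ?scaler0 // => /val_inj; exact: ij.
rewrite -cs_scaleAl (prM pe) // => /eqP; rewrite scaler_eq0 (negPf cj) /= => /eqP.
exact: (pr0 pe).
Qed.

Lemma projs_extend k e p : projs k e -> W p -> p <> 0 -> p ** p = p -> cs_star p = p ->
  (forall i, (i < k)%N -> p ** e i = 0) ->
  (forall x, W x -> exists l : C, x ** p = l *: p) ->
  projs k.+1 (fun i => if (i < k)%N then e i else p).
Proof.
move=> pe pW p0 pM pS po pE; split=> [i|i|i|i|i j|i x]; rewrite ltnS => ik.
- by case: ifP => // h; exact: (prW pe).
- by case: ifP => // h; exact: (pr0 pe).
- by case: ifP => // h; exact: (prM pe).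
- by case: ifP => // h; exact: (prS pe).
- rewrite ltnS => jk ij; case: ifP => hi; case: ifP => hj.
  + exact: (prO pe).
  + by rewrite comm po.
  + exact: po.
  + by case: ij; move/negbT: hi; move/negbT: hj; rewrite -!leqNgt => h1 h2; lia.
- by case: ifP => // h hx; [exact: (prE pe) | exact: pE].
Qed.

(** As long as the annihilator of the projections found so far is nonzero, it is an ideal and
    contains a further minimal projection by [min_proj]; [projs_bound] stops this after at most n
    steps. *)
Lemma fd_projs : exists k e, projs k e /\
  forall x, W x -> (forall i, (i < k)%N -> x ** e i = 0) -> x = 0.
Proof.
suff H d k e : projs k e -> (n - k < d)%N -> exists k e, projs k e /\
    forall x, W x -> (forall i, (i < k)%N -> x ** e i = 0) -> x = 0.
  by apply: (H n.+1 0%N (fun=> 0)); rewrite ?subn0 //; split.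
elim: d k e => [//|d IH] k e pe hd.
have [|hn] := pselect (exists x, [/\ W x, forall i, (i < k)%N -> x ** e i = 0 & x <> 0]);
  last first.
  by exists k, e; split=> // x hx h0; apply: contrapT => x0; apply: hn; exists x.
move=> [x [hx h0 x0]]; pose M := [set z | W z /\ forall i, (i < k)%N -> z ** e i = 0].
have MW : M `<=` W by move=> z [].
have MZ (a : C) z : M z -> M (a *: z).
  move=> [h1 h2]; split; first exact: WZ.
  by move=> i ik; rewrite -cs_scaleAl h2 // scaler0.
have M0 : M 0 by split=> // i _; rewrite mul0.
have MD y z : M y -> M z -> M (y + z).
  move=> [h1 h2] [h3 h4]; split; first exact: WD.
  by move=> i ik; rewrite cs_mulDl h2 // h4 // addr0.
have MM y z : W y -> M z -> M (y ** z).
  move=> hy [h1 h2]; split; first exact: WM.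
  by move=> i ik; rewrite -cs_mulA h2 // mulx0.
have [p [[pW po] p0 pM pS pE]] := min_proj MW M0 MD MZ MM (conj hx h0) x0.
have pe' := projs_extend pe pW p0 pM pS po pE.
apply: (IH _ _ pe'); have := projs_bound pe'; lia.
Qed.
End FinProj.

(** * Threads through an inverse system of finite sets *)

Section Threads.
Variables (Pi : nat -> nat -> nat) (k : nat -> nat).
Hypothesis Pisurj : forall m l, (l <= k m)%N -> exists l', (l' <= k m.+1)%N /\ Pi m l' = l.

Let up1 m l : {l' | (l <= k m)%N -> (l' <= k m.+1)%N /\ Pi m l' = l}.
Proof.
apply: cid; have [h|h] := boolP (l <= k m)%N; last by exists 0%N.
by have [l' ?] := Pisurj h; exists l'.
Qed.
Fixpoint thread_up m l j := if j is j'.+1 then sval (up1 (j' + m) (thread_up m l j')) else l.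
Fixpoint thread_down d j l := if d is d'.+1 then Pi j (thread_down d' j.+1 l) else l.

Lemma thread_up_le m l j : (l <= k m)%N -> (thread_up m l j <= k (j + m))%N.
Proof.
move=> h; elim: j => //= j IH; case: up1 => l' /= H; have [] := H IH; by rewrite addSn.
Qed.
Lemma thread_upP m l j : (l <= k m)%N -> Pi (j + m) (thread_up m l j.+1) = thread_up m l j.
Proof. by move=> h /=; case: up1 => l' /= H; have [] := H (thread_up_le j h). Qed.
Lemma thread_downS d j l : thread_down d.+1 j l = thread_down d j (Pi (j + d) l).
Proof.
elim: d j l => [|d IH] j l; first by rewrite /= addn0.
by rewrite -[LHS]/(Pi j (thread_down d.+1 j.+1 l)) IH addSnnS.
Qed.
Lemma thread_down_up m l d : (l <= k m)%N -> thread_down d m (thread_up m l d) = l.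
Proof.
by move=> h; elim: d => // d IH; rewrite thread_downS addnC thread_upP.
Qed.

Lemma thread_ex m l : (l <= k m)%N -> exists t : nat -> nat,
  t m = l /\ forall j, t j = Pi j (t j.+1).
Proof.
(* From level m the thread climbs j steps through chosen preimages and then descends m steps to
   level j; one formula so covers the levels below and above m. *)
move=> h; exists (fun j => thread_down m j (thread_up m l j)).
split; first exact: thread_down_up.
by move=> j; rewrite -[RHS]/(thread_down m.+1 j _) thread_downS addnC -{1}(thread_upP j h) addnC.
Qed.
End Threads.

Section Levels.
Variables (R : realType) (L : cstar_alg R).
Local Notation C := R[i].
Local Notation N := (@cs_norm R _).
Local Notation "x ** y" := (cs_mul x y) (at level 40, left associativity).
Hypothesis comm : cs_commutative L.
Variables (W : nat -> set L) (k : nat -> nat) (e : nat -> nat -> L).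
Hypothesis W0 : forall m, W m 0.
Hypothesis WD : forall m x y, W m x -> W m y -> W m (x + y).
Hypothesis WZ : forall m (c : C) x, W m x -> W m (c *: x).
Hypothesis WM : forall m x y, W m x -> W m y -> W m (x ** y).
Hypothesis WS : forall m x, W m x -> W m (cs_star x).
Hypothesis Wup : forall m x, W m x -> W m.+1 x.
Hypothesis Wdense : forall x eps, 0 < eps -> exists m y, W m y /\ N (x - y) < eps.
Hypothesis pe : forall m, projs (W m) (k m) (e m).
Hypothesis complete_e : forall m x, W m x -> (forall i, (i < k m)%N -> x ** e m i = 0) -> x = 0.

Lemma We m i : (i < k m)%N -> W m (e m i).
Proof. by move=> h; apply: (prW (pe m)). Qed.

Lemma scal_proj_inj m i (c d : C) : (i < k m)%N -> c *: e m i = d *: e m i -> c = d.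
Proof.
move=> ik /eqP; rewrite -subr_eq0 -scalerBl scaler_eq0 subr_eq0 => /orP[/eqP //|/eqP h].
by case: (pr0 (pe m) ik).
Qed.

(** Minimality makes the product a multiple of the later projection, and idempotence forces the
    factor to be 0 or 1. *)
Lemma proj01 m i i' : (i < k m)%N -> (i' < k m.+1)%N ->
  e m i ** e m.+1 i' = 0 \/ e m i ** e m.+1 i' = e m.+1 i'.
Proof.
move=> ik ik'; have [l hl] := prE (pe m.+1) ik' (Wup (We ik)).
have : e m i ** (e m i ** e m.+1 i') = e m i ** e m.+1 i' by rewrite cs_mulA (prM (pe m)).
rewrite hl -cs_scaleAr hl scalerA => /(scal_proj_inj ik')/eqP; rewrite -subr_eq0 -{3}(mulr1 l) -mulrBr mulf_eq0 subr_eq0.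
by move=> /orP[/eqP l0|/eqP l1]; [left | right]; rewrite ?l0 ?l1 ?scale0r ?scale1r.
Qed.

Definition is_par m i i' := (i < k m)%N /\ e m i ** e m.+1 i' = e m.+1 i'.
(** Labels are shifted by one: i.+1 names the i-th minimal projection, and 0 stands for lying
    outside all of them. Parent 0 is a real possibility, since the projections of level m need not
    dominate those of the next level. *)
Definition parent m l : nat := if l is i'.+1 then
  (if (i' < k m.+1)%N then
   if pselect (exists i, is_par m i i') is left h then (sval (cid h)).+1 else 0%N else 0%N) else 0%N.

Lemma parent_le m l : (parent m l <= k m)%N.
Proof.
case: l => //= i'; case: ifP => // _; case: pselect => // h.
by case: cid => i [].
Qed.
Lemma parentS m i' i : parent m i'.+1 = i.+1 -> is_par m i i'.
Proof.
rewrite /=; case: ifP => // _; case: pselect => // h [<-].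
by case: cid.
Qed.
Lemma parentE m i' i : (i' < k m.+1)%N -> is_par m i i' -> parent m i'.+1 = i.+1.
Proof.
move=> ik' h; rewrite /= ik'; case: pselect => [h'|[]]; last by exists i.
case: cid => j /= [jk hj]; case: h => ik hi; congr _.+1; apply: contrapT => ij.
apply: (pr0 (pe m.+1) ik'); rewrite -hj -hi cs_mulA (prO (pe m)) ?mul0 //.
Qed.
Lemma parent0 m i' i : (i' < k m.+1)%N -> parent m i'.+1 = 0%N -> (i < k m)%N ->
  e m i ** e m.+1 i' = 0.
Proof.
move=> ik' h ik; case: (proj01 ik ik') => // h1.
by rewrite (@parentE m i' i) in h.
Qed.
(** A projection with no successor below it would annihilate all projections of the next level, and
    so be zero by completeness. *)
Lemma parent_surj m l : (l <= k m)%N -> exists l', (l' <= k m.+1)%N /\ parent m l' = l.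
Proof.
case: l => [|i] ik; first by exists 0%N.
apply: contrapT => hn; apply: (pr0 (pe m) ik); apply: (complete_e (Wup (We ik))) => i' ik'.
case: (proj01 ik ik') => // h1; case: hn; exists i'.+1; split=> //.
exact: parentE.
Qed.

(** Points are codes of a level and a label there, so that a thread passes through every minimal
    projection; an impossible label is replaced by 0. *)
Definition chain_lab n : nat := if ((unpairn n).2 <= k (unpairn n).1)%N then (unpairn n).2 else 0%N.
Lemma lab_le n : (chain_lab n <= k (unpairn n).1)%N.
Proof. by rewrite /chain_lab; case: ifP. Qed.
Definition thr n : nat -> nat := sval (cid (thread_ex parent_surj (lab_le n))).
Lemma thrP n j : thr n j = parent j (thr n j.+1).
Proof. by rewrite /thr; case: cid => t []. Qed.
Lemma thr_chain_lab n : thr n (unpairn n).1 = chain_lab n.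
Proof. by rewrite /thr; case: cid => t []. Qed.
Lemma thr_le n j : (thr n j <= k j)%N.
Proof. by rewrite thrP parent_le. Qed.

Definition lev_kappa : kappa.
Proof.
refine (@Kappa (fun m n => thr n m) _ _ _).
- by move=> m; exists (k m).+1 => n; rewrite ltnS thr_le.
- by move=> m n n' h; rewrite !(thrP _ m) h.
- by move=> m n h; rewrite thrP h.
Defined.

Lemma lev_surj m i : (i < k m)%N -> exists n, lev_kappa m n = i.+1.
Proof.
move=> ik; exists (pairn m i.+1).
have := thr_chain_lab (pairn m i.+1); rewrite /chain_lab /unpairn /pairn Cantor.cancel_of_to /= ik.
by [].
Qed.
Notation rep m i := (krep lev_kappa m i.+1).
Lemma lev_rep m i : (i < k m)%N -> lev_kappa m (rep m i) = i.+1.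
Proof. by move=> /lev_surj [n <-]; rewrite krepP. Qed.

(** The inverse of the Gelfand transform of the m-th level: each value is attached to the minimal
    projection of its class. *)
Definition psi m (z : Flev R lev_kappa m) : L := \sum_(i < k m) fv z (rep m i) *: e m i.

Lemma mulsum (I : Type) (r : seq I) (F : I -> L) w :
  (\sum_(i <- r) F i) ** w = \sum_(i <- r) F i ** w.
Proof.
elim: r => [|a s IH]; first by rewrite !big_nil mul0.
by rewrite !big_cons cs_mulDl IH.
Qed.

Lemma psi_e m (z : Flev R lev_kappa m) i : (i < k m)%N ->
  psi z ** e m i = fv z (rep m i) *: e m i.
Proof.
move=> ik; rewrite /psi mulsum (bigD1 (Ordinal ik)) //= big1 ?addr0 => [|j /eqP ij].
  by rewrite -cs_scaleAl (prM (pe m)).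
rewrite -cs_scaleAl (prO (pe m)) ?scaler0 // => /= h; apply: ij; exact/val_inj.
Qed.

Lemma psi_W m (z : Flev R lev_kappa m) : W m (psi z).
Proof. by rewrite /psi; elim/big_ind: _ => // [|i _]; [exact: WD | apply/WZ/We]. Qed.

Lemma W_eq m x y : W m x -> W m y -> (forall i, (i < k m)%N -> x ** e m i = y ** e m i) -> x = y.
Proof.
move=> hx hy h; apply/eqP; rewrite -subr_eq0; apply/eqP/(@complete_e m).
  by rewrite -scaleN1r; apply: WD => //; apply: WZ.
by move=> i ik; rewrite mulBx h // subrr.
Qed.

Lemma psi_hom m : is_star_hom (@psi m).
Proof.
split=> [c x y|x y|x].
- apply: (@W_eq m); [exact: psi_W | apply: WD; [apply: WZ|]; exact: psi_W |] => i ik.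
  rewrite (psi_e (c *: x + y) ik) cs_mulDl -cs_scaleAl (psi_e x ik) (psi_e y ik).
  by rewrite scalerA -scalerDl fvD fvZ.
- apply: (@W_eq m); [exact: psi_W | apply: WM; exact: psi_W |] => i ik.
  by rewrite -cs_mulA !psi_e // -cs_scaleAr psi_e // scalerA mulrC.
- apply: (@W_eq m); [exact: psi_W | apply: WS; exact: psi_W |] => i ik.
  rewrite psi_e // -{2}(prS (pe m) ik) -cs_starM comm psi_e // cs_starZ (prS (pe m)) //.
Qed.

Lemma psi_up m (z : Flev R lev_kappa m) : psi (inF (leqnSn m) z) = psi z.
Proof.
apply: (@W_eq m.+1); [exact: psi_W | apply/Wup/psi_W |] => i' ik'; rewrite psi_e //.
have hn := lev_rep ik'; have hp := thrP (rep m.+1 i') m; rewrite -/(lev_kappa m _) in hp.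
have [z1 z0] := fvP z.
rewrite -[thr _ m.+1]/(lev_kappa m.+1 _) hn in hp.
case E : (parent m i'.+1) => [|i].
  rewrite E in hp; rewrite fv_mkf z0 // scale0r /psi mulsum big1 // => i _.
  by rewrite -cs_scaleAl (parent0 ik' E) ?scaler0.
have [ik hi] := parentS E; rewrite E in hp.
rewrite -{2}hi cs_mulA psi_e // -cs_scaleAl hi; congr (_ *: _).
by rewrite fv_mkf; apply: z1; exact: (etrans hp (esym (lev_rep ik))).
Qed.

Lemma e_norm m i : (i < k m)%N -> N (e m i) = 1.
Proof.
move=> ik; have := nrmC (e m i); rewrite (prS (pe m)) // (prM (pe m)) // expr2 => h.
have h0 : N (e m i) != 0.
  by apply/eqP => /nrm_eq0; exact: (pr0 (pe m)).
by apply: (mulfI h0); rewrite mulr1 -h.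
Qed.

Lemma psi_isom m (z : Flev R lev_kappa m) : N z <= N (psi z).
Proof.
apply: alg_norm_le => n; have [z1 z0] := fvP z.
case E : (lev_kappa m n) => [|i]; first by rewrite z0 // cn0 nrm_ge0.
have ik : (i < k m)%N by have := thr_le n m; rewrite -[thr n m]/(lev_kappa m n) E.
rewrite (z1 n (rep m i)) ?lev_rep //.
by have := nrmM (psi z) (e m i); rewrite psi_e // nrmZ e_norm // !mulr1.
Qed.

Lemma psi_onto m x : W m x -> exists z, @psi m z = x.
Proof.
move=> hx; have hc i : (i < k m)%N -> exists l : C, x ** e m i = l *: e m i.
  by move=> ik; apply: (prE (pe m)).
pose c i : C := if pselect (exists l : C, x ** e m i = l *: e m i) is left h
  then sval (cid h) else 0.
have hcc i : (i < k m)%N -> x ** e m i = c i *: e m i.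
  by move=> /hc h; rewrite /c; case: pselect => // h'; case: cid.
have hz : Fk (R:=R) lev_kappa m (fun n => if lev_kappa m n is i.+1 then c i else 0).
  by split=> [n n' -> //|n ->].
exists (@mkf R (FA_F R lev_kappa m) _ hz); apply: (W_eq (psi_W _) hx) => i ik.
by rewrite psi_e // hcc // fv_mkf lev_rep.
Qed.

(** The map given by the universal property is contractive, and it does not decrease norms because
    no [psi] does on its level. Its range is then closed, and it contains the dense union of the
    levels. *)
Lemma lev_iso : exists u : Alg R lev_kappa -> L, is_star_hom u /\ bijective u.
Proof.
have [_ _ univ] := Alg_limit R lev_kappa.
have [u [[hu uE] _]] := univ L psi psi_hom psi_up.
have con := alg_hom_contr (@FA_S_calc R lev_kappa) hu.
have iso x : N x <= N (u x).
  apply/ler_addgt0Pr => eps e0; have e2 : 0 < eps / 2 by rewrite divr_gt0.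
  have [m [z hz]] := Alg_approx x e2.
  have h1 : N x <= N z + eps / 2.
    rewrite -{1}(subrK (inS z) x) addrC; apply: (le_trans (nrmD _ _)).
    by apply: lerD; [apply: alg_norm_le => n; exact: alg_norm_ub z n | exact: ltW].
  have h2 : N (psi z) <= N (u x) + eps / 2.
    rewrite -(uE m z) -{1}(subrK (u x) (u (inS z))) addrC; apply: (le_trans (nrmD _ _)).
    rewrite nrmB -(homB hu); apply: lerD => //; apply: (le_trans (con _)); exact: ltW.
  have := psi_isom z; lra.
have surj y : exists x, u x = y.
  have hp (j : nat) : 0 < (2^-1 : R) ^+ j by rewrite exprn_gt0 // invr_gt0.
  have ex j : exists x, N (y - u x) <= 2^-1 ^+ j / 2.
    have [|m [w [hw hy]]] := @Wdense y (2^-1 ^+ j / 2); first by rewrite divr_gt0.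
    by have [z hz] := psi_onto hw; exists (inS z); rewrite uE hz; exact: ltW.
  pose v j := sval (cid (ex j)); have hv j : N (y - u (v j)) <= 2^-1 ^+ j / 2.
    by rewrite /v; case: cid.
  have [|x hx] := @nrm_complete R _ v.
    move=> j n jn; apply: (le_trans (iso _)); rewrite homB //.
    apply: (le_trans (nrmDB _ y _)); rewrite nrmB.
    have : (2^-1 : R) ^+ n <= 2^-1 ^+ j.
      by apply: ler_wiXn2l; rewrite ?invr_ge0 ?invf_le1 ?ler1n.
    have := hv n; have := hv j; lra.
  exists x; apply/eqP; rewrite -subr_eq0; apply/eqP/nrm_small => eps e0.
  have [j hj] := half_pow_small (divr_gt0 e0 (ltr0n _ 2)).
  apply: (le_trans (nrmDB _ (u (v j)) _)); rewrite -homB //.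
  have := con (x - v j); have := hx j; have := hv j; have := hp j.
  rewrite (nrmB x) (nrmB y); lra.
exists u; split=> //.
pose g y := sval (cid (surj y)); have hg y : u (g y) = y by rewrite /g; case: cid.
exists g => // x; apply/eqP; rewrite -subr_eq0; apply/eqP/nrm_le0.
by apply: (le_trans (iso _)); rewrite homB // hg subrr nrm0.
Qed.
End Levels.

(** * Representation of commutative AF algebras; isometry *)

Section Repr.
Variables (R : realType).
Local Notation N := (@cs_norm R _).

Lemma AF_kappa (A : cstar_alg R) : cs_commutative A -> is_AF A ->
  exists K (u : Alg R K -> A), is_star_hom u /\ bijective u.
Proof.
move=> cA [F [h [L [mu [fF hh lim [th hth bth]]]]]].
have [g [hg thg gth]] := star_iso_inv hth bth.
have cL : cs_commutative L.
  by move=> x y; rewrite -(gth x) -(gth y) -!(homM hth) cA.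
have [hmu hc _] := lim.
(* The connecting maps need not be injective; taking the images inside the limit as levels makes the
   sequence increasing. *)
pose W m : set L := range (mu m).
have W0 m : W m 0 by exists 0 => //; rewrite (hom0 (hmu _)).
have WD m x y : W m x -> W m y -> W m (x + y).
  by move=> [a _ <-] [b _ <-]; exists (a + b) => //; rewrite (homD (hmu _)).
have WZ m (c : R[i]) x : W m x -> W m (c *: x).
  by move=> [a _ <-]; exists (c *: a) => //; rewrite (homZ (hmu _)).
have WM m x y : W m x -> W m y -> W m (cs_mul x y).
  by move=> [a _ <-] [b _ <-]; exists (cs_mul a b) => //; rewrite (homM (hmu _)).
have WS m x : W m x -> W m (cs_star x).
  by move=> [a _ <-]; exists (cs_star a) => //; rewrite (homS (hmu _)).
have Wup m x : W m x -> W m.+1 x by move=> [a _ <-]; exists (h m a).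
have P m : exists k e, projs (W m) k e /\
    forall x, W m x -> (forall i, (i < k)%N -> cs_mul x (e i) = 0) -> x = 0.
  have [n [b hb]] := fF m.
  apply: (@fd_projs R L cL (W m) n (fun i => mu m (b i))) => //.
  - exact: WD. - exact: WZ. - exact: WM. - exact: WS.
  - by move=> i; exists (b i).
  - move=> _ [a _ <-]; have [c ->] := hb a; exists c.
    elim/big_rec2: _ => [|i y x _ <-]; first by rewrite (hom0 (hmu _)).
    by rewrite (homD (hmu _)) (homZ (hmu _)).
pose k m := sval (cid (P m)); pose e m := sval (cid (svalP (cid (P m)))).
have he m : projs (W m) (k m) (e m) /\
    forall x, W m x -> (forall i, (i < k m)%N -> cs_mul x (e m i) = 0) -> x = 0.
  exact: (svalP (cid (svalP (cid (P m))))).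
have [|u [hu bu]] := @lev_iso R L cL W k e W0 WD WZ WM WS Wup _ (fun m => (he m).1) (fun m => (he m).2).
  by move=> x eps e0; have [n [z hz]] := lim_dense lim x e0; exists n, (mu n z); split=> //; exists z.
exists (lev_kappa Wup (fun m => (he m).1) (fun m => (he m).2)), (g \o u); split.
  exact: star_hom_comp.
by apply: bij_comp => //; exists th.
Qed.

Lemma sqk_norm_le (A : cstar_alg R) (y : A) j : N (sqk y j) <= N y ^+ (2 ^ j).
Proof.
elim: j => [|j IH] /=; first by rewrite expn0 expr1.
apply: (le_trans (nrmM _ _)); rewrite expnS mulnC exprM expr2.
by apply: ler_pM; rewrite ?nrm_ge0.
Qed.

(* if chi(y) = 1 and |y| <= 1/2, then z = y + yz has a solution, so chi(z) = 1 + chi(z) *)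
Lemma char_contr (A : cstar_alg R) (chi : A -> R[i]) :
  (forall x y, chi (x + y) = chi x + chi y) -> (forall k x, chi (k *: x) = k * chi x) ->
  (forall x y, chi (cs_mul x y) = chi x * chi y) -> forall x, cn (chi x) <= N x.
Proof.
move=> cD cZ cM x; rewrite leNgt; apply/negP => h.
have c0 : 0 < cn (chi x) by apply: le_lt_trans h; apply: nrm_ge0.
have chi0 : chi x != 0 by apply: contraTneq c0 => ->; rewrite cn0 ltxx.
pose y0 := (chi x)^-1 *: x.
have y01 : chi y0 = 1 by rewrite cZ mulVf.
have ny0 : N y0 < 1.
  rewrite nrmZ; have -> : cn (chi x)^-1 = (cn (chi x))^-1.
    by apply: (mulfI (lt0r_neq0 c0)); rewrite -cnM mulfV // cn1 mulfV // gt_eqF.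
  by rewrite mulrC ltr_pdivrMr // mul1r.
(* Squaring preserves the value 1 of the character, while it drives a norm below 1 under 1/2. *)
have [j hj] : exists j, N y0 ^+ (2 ^ j) <= 2^-1.
  apply: contrapT => hn; have : 1 <= N y0; last by rewrite leNgt ny0.
  apply: (@pow2_le _ _ _ 2) => //; first exact: nrm_ge0.
  move=> j; rewrite expr1n leNgt; apply/negP => hj; apply: hn; exists j; lra.
pose y := sqk y0 j.
have cy : chi y = 1 by rewrite /y; elim: (j) => //= i IH; rewrite cM IH mulr1.
have ny : N y <= 2^-1 by apply: le_trans (sqk_norm_le _ _) hj.
(* These are the partial sums y + y^2 + ... + y^n; their limit is the announced solution z. *)
pose u := fix u n := if n is n'.+1 then y + cs_mul y (u n') else (0 : A).
have du n : N (u n.+1 - u n) <= 2^-1 ^+ n.+1.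
  elim: n => [|n IH]; first by rewrite /= mulx0 addr0 subr0 expr1.
  have -> : u n.+2 - u n.+1 = cs_mul y (u n.+1 - u n).
    by rewrite mulxB /= opprD addrACA subrr add0r.
  apply: (le_trans (nrmM _ _)); rewrite [in leRHS]exprS.
  by apply: ler_pM; rewrite ?nrm_ge0.
have uc m d : N (u (d + m)%N - u m) <= 2^-1 ^+ m - 2^-1 ^+ (d + m).
  elim: d => [|d IH]; first by rewrite !subrr nrm0.
  apply: (le_trans (nrmDB _ (u (d + m)%N) _)); have := du (d + m)%N.
  rewrite addSn [in X in _ <= X -> _]exprS [in X in _ -> _ <= X]exprS; move: IH.
  set a := N _; set b := N _; lra.
have [|z hz] := @nrm_complete R A u.
  move=> m n mn; rewrite -(subnK mn); apply: (le_trans (uc _ _)).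
  by rewrite lerBlDr lerDl exprn_ge0 // invr_ge0.
have zE : z = y + cs_mul y z.
  apply/eqP; rewrite -subr_eq0; apply/eqP/nrm_small => eps e0.
  have [m hm] := half_pow_small (divr_gt0 e0 (ltr0n _ 2)).
  have -> : z - (y + cs_mul y z) = (z - u m.+1) + cs_mul y (u m - z).
    by rewrite -[u m.+1]/(y + cs_mul y (u m)) mulxB !opprD !addrA subrK.
  apply: (le_trans (nrmD _ _)); have h1 := hz m.+1; have h2 := hz m.
  have h3 := nrmM y (u m - z).
  have h4 : N y * N (u m - z) <= 2^-1 * 2^-1 ^+ m by apply: ler_pM; rewrite ?nrm_ge0.
  rewrite nrmB; rewrite exprS in h1; have : 0 < (2^-1 : R) ^+ m by rewrite exprn_gt0 // invr_gt0.
  move: h1 h2 h3 h4 hm; set t := 2^-1 ^+ m; lra.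
have := congr1 chi zE; rewrite cD cM cy mul1r => /eqP; rewrite -subr_eq0 opprD addrCA subrr addr0.
by rewrite oppr_eq0 oner_eq0.
Qed.

(** Evaluation at a point, composed with the inverse isomorphism, is a character of A and hence
    contractive by [char_contr]; the norm of [Alg] is the supremum over such evaluations. *)
Lemma Alg_iso_isometric K (A : cstar_alg R) (u : Alg R K -> A) :
  is_star_hom u -> bijective u -> forall x, N (u x) = N x.
Proof.
move=> hu bu x; apply/le_anti/andP; split.
  exact: (alg_hom_contr (@FA_S_calc R K) hu).
have [g [hg ug gu]] := star_iso_inv hu bu.
apply: alg_norm_le => n; rewrite -{1}(ug x); move: (u x) => {}x.
apply: (@char_contr A (fun y => fv (g y) n)) => [y z|k y|y z].
- by rewrite (homD hg).
- by rewrite (homZ hg).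
- by rewrite (homM hg).
Qed.
End Repr.

(** * Codes of Gaussian rationals and of presentations *)

Section Codes.
Local Open Scope nat_scope.
Definition mkr p q d := pairn (pairn p q) d.
Definition rp n := p1 (p1 n).
Definition rq n := p2 (p1 n).
Definition rd n := (p2 n).+1.
Definition radd a b := mkr (rp a * rd b + rp b * rd a) (rq a * rd b + rq b * rd a) (rd a * rd b).-1.
Definition rneg a := mkr (rq a) (rp a) (p2 a).
Definition rmul a b := mkr (rp a * rp b + rq a * rq b) (rp a * rq b + rq a * rp b) (rd a * rd b).-1.
Definition rle a b := rp a * rd b + rq b * rd a <= rp b * rd a + rq a * rd b.
Definition reps m := mkr 1 0 m.

Definition gadd a b := pairn (radd (p1 a) (p1 b)) (radd (p2 a) (p2 b)).
Definition gneg a := pairn (rneg (p1 a)) (rneg (p2 a)).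
Definition gmul a b := pairn (radd (rmul (p1 a) (p1 b)) (rneg (rmul (p2 a) (p2 b))))
  (radd (rmul (p1 a) (p2 b)) (rmul (p2 a) (p1 b))).
Definition gconj a := pairn (p1 a) (rneg (p2 a)).
Definition gn2 a := radd (rmul (p1 a) (p1 a)) (rmul (p2 a) (p2 a)).
Definition gone := pairn (mkr 1 0 0) 0.
(** The modulus of a Gaussian rational need not be rational, so squares are compared; this requires
    a test of the sign of q. *)
Definition cle z q := rle 0 q && rle (gn2 z) (rmul q q).
Definition cge z q := rle q 0 || rle (rmul q q) (gn2 z).

(* value of the polynomial with number n at the point with coordinates gauss (f i);
   d bounds the recursion depth *)
Fixpoint evp d (f : nat -> nat) n := if d is d'.+1 then
  let t := p1 n in let a := p2 n in
  if t == 0 then f a else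
  if t == 1 then gadd (evp d' f (p1 a)) (evp d' f (p2 a)) else
  if t == 2 then gmul (evp d' f (p1 a)) (evp d' f (p2 a)) else
  if t == 3 then gconj (evp d' f a) else gmul (p1 a) (evp d' f (p2 a)) else 0.
Definition evalp f n := evp n.+1 f n.

Fixpoint isp d n : bool := if d is d'.+1 then
  let t := p1 n in let a := p2 n in
  if t == 0 then true else
  if t <= 2 then isp d' (p1 a) && isp d' (p2 a) else
  if t == 3 then isp d' a else (t == 4) && isp d' (p2 a) else false.
Definition ispoly n := isp n.+1 n.

Lemma cmp_mkr A B D : cmp A -> cmp B -> cmp D -> cmp (fun f x => mkr (A f x) (B f x) (D f x)).
Proof. by rewrite /mkr => *; cmp. Qed.
Lemma cmp_rp A : cmp A -> cmp (fun f x => rp (A f x)). Proof. by rewrite /rp => *; cmp. Qed.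
Lemma cmp_rq A : cmp A -> cmp (fun f x => rq (A f x)). Proof. by rewrite /rq => *; cmp. Qed.
Lemma cmp_rd A : cmp A -> cmp (fun f x => rd (A f x)). Proof. by rewrite /rd => *; cmp. Qed.
#[local] Hint Resolve cmp_mkr cmp_rp cmp_rq cmp_rd : cmp.
Lemma cmp_radd A B : cmp A -> cmp B -> cmp (fun f x => radd (A f x) (B f x)).
Proof. by rewrite /radd => *; cmp. Qed.
Lemma cmp_rneg A : cmp A -> cmp (fun f x => rneg (A f x)).
Proof. by rewrite /rneg => *; cmp. Qed.
Lemma cmp_rmul A B : cmp A -> cmp B -> cmp (fun f x => rmul (A f x) (B f x)).
Proof. by rewrite /rmul => *; cmp. Qed.
Lemma cmp_rle A B : cmp A -> cmp B -> cmp (fun f x => rle (A f x) (B f x)).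
Proof. by rewrite /rle => *; cmp. Qed.
Lemma cmp_reps A : cmp A -> cmp (fun f x => reps (A f x)).
Proof. by rewrite /reps => *; cmp. Qed.
#[local] Hint Resolve cmp_radd cmp_rneg cmp_rmul cmp_rle cmp_reps : cmp.
Lemma cmp_gadd A B : cmp A -> cmp B -> cmp (fun f x => gadd (A f x) (B f x)).
Proof. by rewrite /gadd => *; cmp. Qed.
Lemma cmp_gneg A : cmp A -> cmp (fun f x => gneg (A f x)).
Proof. by rewrite /gneg => *; cmp. Qed.
Lemma cmp_gmul A B : cmp A -> cmp B -> cmp (fun f x => gmul (A f x) (B f x)).
Proof. by rewrite /gmul => *; cmp. Qed.
Lemma cmp_gconj A : cmp A -> cmp (fun f x => gconj (A f x)).
Proof. by rewrite /gconj => *; cmp. Qed.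
Lemma cmp_gn2 A : cmp A -> cmp (fun f x => gn2 (A f x)).
Proof. by rewrite /gn2 => *; cmp. Qed.
#[local] Hint Resolve cmp_gadd cmp_gneg cmp_gmul cmp_gconj cmp_gn2 : cmp.
Lemma cmp_cle A B : cmp A -> cmp B -> cmp (fun f x => cle (A f x) (B f x)).
Proof. by rewrite /cle => *; cmp. Qed.
Lemma cmp_cge A B : cmp A -> cmp B -> cmp (fun f x => cge (A f x) (B f x)).
Proof. by rewrite /cge => *; cmp. Qed.

Lemma tag_lt e : p1 e != 0 -> p2 e < e.
Proof. by rewrite -lt0n => h; rewrite -{2}(pair_p e); apply: pairn_gt. Qed.

Lemma evp_mono d d' f n : n < d -> n < d' -> evp d f n = evp d' f n.
Proof.
elim: d d' n => // d IH [//|d'] n h h' /=; case: ifP => // /negbT/tag_lt t0.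
have b1 := p1_le (p2 n); have b2 := p2_le (p2 n).
rewrite (IH d' (p1 (p2 n))) ?(IH d' (p2 (p2 n))) ?(IH d' (p2 n)) //; lia.
Qed.
Lemma isp_mono d d' n : n < d -> n < d' -> isp d n = isp d' n.
Proof.
elim: d d' n => // d IH [//|d'] n h h' /=; case: ifP => // /negbT/tag_lt t0.
have b1 := p1_le (p2 n); have b2 := p2_le (p2 n).
rewrite (IH d' (p1 (p2 n))) ?(IH d' (p2 (p2 n))) ?(IH d' (p2 n)) //; lia.
Qed.

Lemma evalpE f n : evalp f n =
  if p1 n == 0 then f (p2 n) else
  if p1 n == 1 then gadd (evalp f (p1 (p2 n))) (evalp f (p2 (p2 n))) else
  if p1 n == 2 then gmul (evalp f (p1 (p2 n))) (evalp f (p2 (p2 n))) else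
  if p1 n == 3 then gconj (evalp f (p2 n)) else gmul (p1 (p2 n)) (evalp f (p2 (p2 n))).
Proof.
rewrite {1}/evalp [LHS]/=; case: ifP => // /negbT/tag_lt t0.
have b1 := leq_ltn_trans (p1_le (p2 n)) t0; have b2 := leq_ltn_trans (p2_le (p2 n)) t0.
have E a : a < n -> evp n f a = evalp f a by move=> an; apply: evp_mono.
by rewrite !E.
Qed.
Lemma cmp_evalp0 : cmp (fun f n => evalp f n).
Proof.
apply: (@cmp_cov (fun f x n => evalp f n) (fun f x n h =>
  if p1 n == 0 then f (p2 n) else
  if p1 n == 1 then gadd (lookup h (n - (p1 (p2 n)).+1)) (lookup h (n - (p2 (p2 n)).+1)) else
  if p1 n == 2 then gmul (lookup h (n - (p1 (p2 n)).+1)) (lookup h (n - (p2 (p2 n)).+1)) else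
  if p1 n == 3 then gconj (lookup h (n - (p2 n).+1)) else
  gmul (p1 (p2 n)) (lookup h (n - (p2 (p2 n)).+1))) (fun f x => 0) (fun f x => x)); [by cmp| |by cmp|by cmp].
move=> f x n h hh; rewrite [RHS]evalpE; case: ifP => // /negbT/tag_lt t0.
have b1 := leq_ltn_trans (p1_le (p2 n)) t0; have b2 := leq_ltn_trans (p2_le (p2 n)) t0.
by rewrite !hh.
Qed.
Lemma cmp_ispoly A : cmp A -> cmp (fun f x => ispoly (A f x)).
Proof.
apply: (@cmp_cov (fun f x n => ispoly n) (fun f x n h =>
  if p1 n == 0 then true else
  if p1 n <= 2 then (lookup h (n - (p1 (p2 n)).+1) == 1) && (lookup h (n - (p2 (p2 n)).+1) == 1) else
  if p1 n == 3 then lookup h (n - (p2 n).+1) == 1 else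
  (p1 n == 4) && (lookup h (n - (p2 (p2 n)).+1) == 1)) (fun f x => 0)).
- repeat (apply: cmp_ifb; first by cmp); try by cmp.
- move=> f x n h hh; rewrite /ispoly [in RHS]/=; case: ifP => // /negbT/tag_lt t0.
  have b1 := p1_le (p2 n); have b2 := p2_le (p2 n).
  have E a : a < n -> (lookup h (n - a.+1) == 1) = isp n a.
    by move=> an; rewrite hh // (@isp_mono n a.+1) // /ispoly; case: (isp _ _).
  by rewrite !E //; lia.
- by cmp.
Qed.
Lemma cmp_evalp (Th : (nat -> nat) -> nat -> nat -> nat) W :
  cmp (fun f z => Th f (p1 z) (p2 z)) -> cmp W -> cmp (fun f x => evalp (Th f x) (W f x)).
Proof. exact: (cmp_subst cmp_evalp0). Qed.

Lemma isp_num d p : star_poly_num p < d -> isp d (star_poly_num p).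
Proof.
elim: d p => // d IH; case=> [i|p q|p q|p|k p] /=; rewrite ?pE //= => h.
- have h1 := @pairn_gt 1 (pairn (star_poly_num p) (star_poly_num q)) isT.
  have h2 := pairn_ge (star_poly_num p) (star_poly_num q).
  by rewrite !IH //; lia.
- have h1 := @pairn_gt 2 (pairn (star_poly_num p) (star_poly_num q)) isT.
  have h2 := pairn_ge (star_poly_num p) (star_poly_num q).
  by rewrite !IH //; lia.
- by have h1 := @pairn_gt 3 (star_poly_num p) isT; rewrite !IH //; lia.
- have h1 := @pairn_gt 4 (pairn k (star_poly_num p)) isT.
  have h2 := pairn_ge k (star_poly_num p).
  by rewrite !IH //; lia.
Qed.
Lemma ispoly_num p : ispoly (star_poly_num p).
Proof. exact: isp_num. Qed.
Lemma num_isp d n : isp d n -> exists p, star_poly_num p = n.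
Proof.
elim: d n => // d IH n /=; have := pair_p n; move: (p1 n) (p2 n) => t a <-.
case: t => [|[|[|[|[|t]]]]] //=.
- by exists (PVar a).
- by move=> /andP[/IH [c hc] /IH [c' hc']]; exists (PAdd c c'); rewrite /= hc hc' pair_p.
- by move=> /andP[/IH [c hc] /IH [c' hc']]; exists (PMul c c'); rewrite /= hc hc' pair_p.
- by move=> /IH [c hc]; exists (PStar c); rewrite /= hc.
- by move=> /IH [c hc]; exists (PScale (p1 a) c); rewrite /= hc pair_p.
Qed.

Lemma evalp_var f i : evalp f (star_poly_num (PVar i)) = f i.
Proof. by rewrite evalpE; cbn [star_poly_num]; rewrite !pE. Qed.
Lemma evalp_add f p q : evalp f (star_poly_num (PAdd p q)) =
  gadd (evalp f (star_poly_num p)) (evalp f (star_poly_num q)).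
Proof. by rewrite evalpE; cbn [star_poly_num]; rewrite !pE. Qed.
Lemma evalp_mul f p q : evalp f (star_poly_num (PMul p q)) =
  gmul (evalp f (star_poly_num p)) (evalp f (star_poly_num q)).
Proof. by rewrite evalpE; cbn [star_poly_num]; rewrite !pE. Qed.
Lemma evalp_star f p : evalp f (star_poly_num (PStar p)) = gconj (evalp f (star_poly_num p)).
Proof. by rewrite evalpE; cbn [star_poly_num]; rewrite !pE. Qed.
Lemma evalp_scale f k p : evalp f (star_poly_num (PScale k p)) = gmul k (evalp f (star_poly_num p)).
Proof. by rewrite evalpE; cbn [star_poly_num]; rewrite !pE. Qed.
End Codes.
#[global] Hint Resolve cmp_mkr cmp_rp cmp_rq cmp_rd cmp_radd cmp_rneg cmp_rmul cmp_rle cmp_reps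
  cmp_gadd cmp_gneg cmp_gmul cmp_gconj cmp_gn2 cmp_cle cmp_cge cmp_ispoly : cmp.

Section CodeVal.
Variable R : realType.
Local Notation C := R[i].
Local Notation rn := rat_of_nat.
Definition rv n : R := ratr (rat_of_nat n).
Definition gv n : C := gauss_of_nat R n.

Lemma rnE n : rn n = ((rp n)%:R - (rq n)%:R) / (rd n)%:R.
Proof.
rewrite /rat_of_nat /rp /rq /rd /p1 /p2; case: (unpairn n) => m d /=.
by case: (unpairn m).
Qed.
Lemma rvE n : rv n = ((rp n)%:R - (rq n)%:R) / (rd n)%:R.
Proof. by rewrite /rv rnE fmorph_div rmorphB !rmorph_nat. Qed.
Lemma rd_neq0 n : (rd n)%:R != 0 :> R.
Proof. by rewrite pnatr_eq0. Qed.
Lemma rv_mkr p q d : rv (mkr p q d) = (p%:R - q%:R) / d.+1%:R.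
Proof. by rewrite rvE /rp /rq /rd /mkr !pE. Qed.
Lemma rv_radd a b : rv (radd a b) = rv a + rv b.
Proof.
rewrite rv_mkr prednK // !natrD !natrM !rvE.
have := rd_neq0 a; have := rd_neq0 b; move: (rd a)%:R (rd b)%:R => x y x0 y0.
by field; rewrite x0 y0.
Qed.
Lemma rv_rneg a : rv (rneg a) = - rv a.
Proof. by rewrite rv_mkr rvE -mulNr opprB. Qed.
Lemma rv_rmul a b : rv (rmul a b) = rv a * rv b.
Proof.
rewrite rv_mkr prednK // !natrD !natrM !rvE.
have := rd_neq0 a; have := rd_neq0 b; move: (rd a)%:R (rd b)%:R => x y x0 y0.
by field; rewrite x0 y0.
Qed.
Lemma rv0 : rv 0 = 0.
Proof. by rewrite rvE /rp /rq /= subrr mul0r. Qed.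
Lemma rv_reps m : rv (reps m) = m.+1%:R^-1.
Proof. by rewrite rv_mkr subr0 mul1r. Qed.
Lemma rleP a b : rle a b = (rv a <= rv b).
Proof.
have ha : 0 < (rd a)%:R :> R by rewrite ltr0n.
have hb : 0 < (rd b)%:R :> R by rewrite ltr0n.
rewrite !rvE ler_pdivrMr // mulrAC ler_pdivlMr // !mulrBl.
rewrite lerBlDr addrAC lerBrDr -!natrM -!natrD ler_nat /rle.
by congr (_ <= _)%N; rewrite addnC // addnC.
Qed.
Lemma rn_le a b : (rn a <= rn b) = (rv a <= rv b).
Proof. by rewrite /rv ler_rat. Qed.

Lemma gvE n : gv n = (rv (p1 n) +i* rv (p2 n))%C.
Proof. by rewrite /gv /gauss_of_nat /p1 /p2 /rv; case: (unpairn n). Qed.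
Lemma gv_pair a b : gv (pairn a b) = (rv a +i* rv b)%C.
Proof. by rewrite gvE !pE. Qed.
Lemma gv_gadd a b : gv (gadd a b) = gv a + gv b.
Proof. by rewrite gv_pair !rv_radd !gvE; simpc. Qed.
Lemma gv_gneg a : gv (gneg a) = - gv a.
Proof. by rewrite gv_pair !rv_rneg !gvE; simpc. Qed.
Lemma gv_gmul a b : gv (gmul a b) = gv a * gv b.
Proof. by rewrite gv_pair !rv_radd rv_rneg !rv_rmul !gvE; simpc. Qed.
Lemma gv_gconj a : gv (gconj a) = (gv a)^*.
Proof. by rewrite gv_pair rv_rneg gvE. Qed.
Lemma gv0 : gv 0 = 0.
Proof. by rewrite gvE rv0. Qed.
Lemma gv_gone : gv gone = 1.
Proof. by rewrite gv_pair rv_mkr rv0 subr0 divr1. Qed.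
Lemma rv_gn2 a : rv (gn2 a) = cn (gv a) ^+ 2.
Proof. by rewrite cn_sqr rv_radd !rv_rmul gvE /= !expr2. Qed.
Lemma cleP z q : cle z q = (cn (gv z) <= rv q).
Proof.
rewrite /cle !rleP rv0 rv_gn2 rv_rmul -expr2.
have [h|h] /= := leP 0 (rv q); first by rewrite ler_pXn2r ?nnegrE ?cn_ge0.
by apply/esym/negbTE; rewrite -ltNge; apply: lt_le_trans h (cn_ge0 _).
Qed.
Lemma cgeP z q : cge z q = (rv q <= cn (gv z)).
Proof.
rewrite /cge !rleP rv0 rv_gn2 rv_rmul -expr2.
have [h|h] /= := leP (rv q) 0; first by rewrite (le_trans h (cn_ge0 _)).
by rewrite ler_pXn2r ?nnegrE ?cn_ge0 // ltW.
Qed.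

Fixpoint cval (z : nat -> C) (p : star_poly) : C :=
  match p with
  | PVar i => z i
  | PAdd p q => cval z p + cval z q
  | PMul p q => cval z p * cval z q
  | PStar p => (cval z p)^*
  | PScale k p => gv k * cval z p
  end.

Lemma gv_evalp f p : gv (evalp f (star_poly_num p)) = cval (gv \o f) p.
Proof.
elim: p => [i|p hp q hq|p hp q hq|p hp|k p hp].
- by rewrite evalp_var.
- by rewrite evalp_add gv_gadd hp hq.
- by rewrite evalp_mul gv_gmul hp hq.
- by rewrite evalp_star gv_gconj hp.
- by rewrite evalp_scale gv_gmul hp.
Qed.

Lemma cval_ext z z' p : z =1 z' -> cval z p = cval z' p.
Proof. by move=> /funext ->. Qed.

Definition evt (P : nat -> Prop) := exists K, forall k, (K <= k)%N -> P k.
Lemma evt_and P Q : evt P -> evt Q -> evt (fun k => P k /\ Q k).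
Proof.
move=> [K hK] [K' hK']; exists (maxn K K') => k; rewrite geq_max => /andP[h h'].
by split; [exact: hK | exact: hK'].
Qed.

Lemma cval_cont (zk : nat -> nat -> C) (z : nat -> C) p :
  (forall i e, 0 < e -> evt (fun k => cn (zk k i - z i) <= e)) ->
  forall e, 0 < e -> evt (fun k => cn (cval (zk k) p - cval z p) <= e).
Proof.
move=> hz; elim: p => [i|p hp q hq|p hp q hq|p hp|n p hp] e e0 /=.
- exact: hz.
- have e2 : 0 < e / 2 by rewrite divr_gt0.
  have [K hK] := evt_and (hp _ e2) (hq _ e2); exists K => k /hK [h1 h2].
  by rewrite opprD addrACA; apply: (le_trans (cnD _ _)); lra.
- set a := cval z p; set b := cval z q.
  have M0 : 0 <= cn a + (cn b + 1) by rewrite !addr_ge0 ?cn_ge0.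
  have [d d0 hd] := lt_split M0 e0.
  have m0 : 0 < Num.min d 1 by rewrite lt_min d0 ltr01.
  have [K hK] := evt_and (hp _ m0) (hq _ m0); exists K => k /hK.
  rewrite -/a -/b; set a' := cval _ p; set b' := cval _ q; rewrite !le_min.
  move=> [/andP[h1 h2] /andP[h3 h4]].
  have -> : a' * b' - a * b = (a' - a) * b' + a * (b' - b) by ring.
  apply: (le_trans (cnD _ _)); rewrite !cnM.
  have hb : cn b' <= cn b + 1.
    by rewrite -(subrK b b') addrC; apply: (le_trans (cnD _ _)); rewrite lerD2l.
  apply: le_trans (ltW hd); rewrite mulrDl addrC; apply: lerD.
    by rewrite ler_wpM2l ?cn_ge0.
  by rewrite mulrC; apply: ler_pM; rewrite ?cn_ge0.
- have [K hK] := hp _ e0; exists K => k /hK; by rewrite -rmorphB cn_conj.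
- have [d d0 hd] := lt_split (cn_ge0 (gv n)) e0.
  have [K hK] := hp _ d0; exists K => k /hK h; rewrite -mulrBr cnM.
  by apply: le_trans (ltW hd); rewrite ler_wpM2l ?cn_ge0.
Qed.
End CodeVal.

(** * Presentations described by sequences of simple functions *)

Section Data.
Local Open Scope nat_scope.
Variables (K : nat -> nat -> nat) (s : nat -> nat -> nat -> nat) (e : nat).

Definition dat_simple := forall i k, exists m, (forall n n', K m n = K m n' -> s i k n = s i k n') /\
  forall n, K m n = 0 -> s i k n = 0.
Definition dat_cauchy := forall i k l n, k <= l -> cle (gadd (s i k n) (gneg (s i l n))) (reps k).
(** Indicators of the classes c > 0 span the levels, so approximating these suffices. The bound k0
    may depend on n: the condition is about the limits k -> oo, and uniformity in n lies in the
    choice of p. *)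
Definition dat_dense := forall m c, 0 < c -> forall j, exists p, ispoly p /\ forall n, exists k0,
  forall k, k0 <= k ->
  cle (gadd (evalp (fun i => s i k n) p) (gneg (if K m n == c then gone else 0))) (reps j).
(** The last two clauses express that the values r k converge to the norm without mentioning a real
    number: every limiting value of the modulus is at most each r k, and some r k comes within
    1/(j+1) of such a value. *)
Definition dat_index := forall p, ispoly p -> exists r : nat -> nat, [/\ forall k, phi e (pairn p k) (r k),
  forall k, ~~ rle (r k) (r k.+1),
  forall n k j, exists k0, forall k', k0 <= k' -> cle (evalp (fun i => s i k' n) p) (radd (r k) (reps j)) &
  forall j, exists k n k0, forall k', k0 <= k' ->
    cge (evalp (fun i => s i k' n) p) (radd (r k) (rneg (reps j)))].
(* s i k is a sequence of simple functions with Gaussian rational values converging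
   uniformly to the i-th special point of a presentation of Alg K indexed by e. *)
Definition Dat := [/\ dat_simple, dat_cauchy, dat_dense & dat_index].
End Data.

Section DataPres.
Variables (R : realType) (K : kappa).
Local Notation C := R[i].
Local Notation N := (@cs_norm R _).
Local Notation gv := (gv R).
Local Notation rv := (rv R).

Lemma fv_poly (a : nat -> Alg R K) p n : fv (star_poly_val a p) n = cval (fun i => fv (a i) n) p.
Proof.
elim: p => [i|p hp q hq|p hp q hq|p hp|k p hp] //=.
- by rewrite fvD hp hq.
- by rewrite fvM hp hq.
- by rewrite fvS hp.
- by rewrite fvZ hp.
Qed.

Lemma reps_small (d : R) : 0 < d -> exists j, rv (reps j) < d.
Proof.
move=> d0; have h := archi_boundP (ltW (divr_gt0 ltr01 d0)).
exists (Num.bound (1 / d)); rewrite rv_reps -div1r ltr_pdivrMr ?ltr0n //.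
rewrite ltr_pdivrMr // in h; apply: lt_trans h _.
by rewrite mulrC ltr_pM2l // ltr_nat.
Qed.
Lemma reps_gt0 j : 0 < rv (reps j).
Proof. by rewrite rv_reps invr_gt0 ltr0n. Qed.
Lemma reps_mono j k : (j <= k)%N -> rv (reps k) <= rv (reps j).
Proof. by move=> jk; rewrite !rv_reps lef_pV2 ?posrE ?ltr0n // ler_nat. Qed.

(** Each level is spanned by the indicators of its classes c > 0, and the union of the levels is
    dense. *)
Lemma pres_ind (a : nat -> Alg R K) :
  (forall m c, (0 < c)%N -> forall eps : R, 0 < eps -> exists p, forall n,
    cn (cval (fun i => fv (a i) n) p - (K m n == c)%:R) <= eps) -> is_presentation a.
Proof.
move=> h; apply/presP; pose G (x y : Alg R K) := exists p, x = star_poly_val a p /\ y = star_poly_val a p.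
have oG : opclosed G by exact: poly_opclosed.
suff H m (z : Flev R K m) : clos G (inS z) (inS z).
  move=> x eps e0; have e2 : 0 < eps / 2 by rewrite divr_gt0.
  have [m [z hz]] := Alg_approx x e2.
  have [_ [_ [[p [-> _]] hp _]]] := H m z _ e2; exists p.
  by apply: (le_lt_trans (nrmDB _ (inS z) _)); lra.
have hb c : Fk (R:=R) K m (fun n => ((K m n == c) && (0 < c)%N)%:R).
  split=> [n n' -> //|n ->].
  by case: eqP => // <-.
pose b c : Flev R K m := @mkf R (FA_F R K m) _ (hb c).
have Gb c : clos G (inS (b c)) (inS (b c)).
  have [->|c0] := posnP c.
    have -> : inS (b 0%N) = 0 :> Alg R K.
      by apply: fv_inj => n; rewrite !fv_mkf andbF.
    exact: (oc0 (clos_opclosed oG)).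
  move=> eps e0; have [p hp] := h m c c0 (eps / 2) (divr_gt0 e0 (ltr0n _ 2)).
  exists (star_poly_val a p), (star_poly_val a p).
  have hN : N (inS (b c) - star_poly_val a p) < eps.
    apply: (@le_lt_trans _ _ (eps / 2)); last by lra.
    apply: alg_norm_le => n; rewrite fvD fvN fv_poly !fv_mkf c0 andbT cnB; exact: hp.
  by split=> //; exists p.
have [M hM] := kap_fin K m; have [z1 z0] := fvP z.
have -> : inS z = \sum_(c < M) fv z (krep K m c) *: inS (b c).
  apply: fv_inj => n; rewrite fv_sum (bigD1 (Ordinal (hM n))) //= big1 ?addr0.
    rewrite fvZ !fv_mkf eqxx /=; have [k0|k0] := posnP (K m n).
      by rewrite mulr0 z0.
    by rewrite mulr1; apply: z1; rewrite krepP.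
  move=> c hc; rewrite fvZ !fv_mkf; case: eqP => [E|_]; last by rewrite mulr0.
  by case/eqP: hc; apply/val_inj; rewrite /= E.
elim/big_ind: _ => [|x y hx hy|c _].
- exact: (oc0 (clos_opclosed oG)).
- exact: (ocD (clos_opclosed oG)).
- exact: closZ.
Qed.

Lemma le_evt (x : C) (y : nat -> C) (d : R) : (forall e0, 0 < e0 -> evt (fun k => cn (y k - x) <= e0)) ->
  evt (fun k => cn (y k) <= d) -> cn x <= d.
Proof.
move=> hy hd; apply/ler_addgt0Pr => e0 h0; have [k0 hk] := evt_and (hy _ h0) hd.
have [h1 h2] := hk k0 (leqnn _).
rewrite -(subrK (y k0) x); apply: (le_trans (cnD _ _)); rewrite cnB; lra.
Qed.

Section DatPres.
Variables (s : nat -> nat -> nat -> nat) (e : nat).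
Hypothesis D : Dat K s e.

Lemma dat_val_ex i n : exists l, forall k, cn (gv (s i k n) - l) <= rv (reps k) *+ 2.
Proof.
have [_ Dc _ _] := D.
have hc k l : (k <= l)%N -> cn (gv (s i l n) - gv (s i k n)) <= rv (reps k).
  by move=> kl; have := Dc i k l n kl; rewrite (cleP R) gv_gadd gv_gneg cnB.
(* The rate 1/(k+1) of the data is too slow for [C_complete]; the subsequence at the indices 2^j has
   rate 2^-j. *)
have [|l hl] := @C_complete R (fun j => gv (s i (2 ^ j)%N n)).
  move=> k m km; apply: (le_trans (hc _ _ (leq_pexp2l _ km))) => //.
  rewrite rv_reps exprVn -natrX lef_pV2 ?posrE ?ltr0n ?expn_gt0 // ler_nat; exact: leqnSn.
exists l => k; apply/ler_addgt0Pr => d d0; have [j hj] := half_pow_small d0.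
have h1 := hl (maxn k j); have h2 : (k <= 2 ^ maxn k j)%N.
  by apply: leq_trans (leq_maxl k j) _; apply/ltnW/ltn_expl.
have h3 : (2^-1 : R) ^+ maxn k j <= 2^-1 ^+ j.
  by apply: ler_wiXn2l; rewrite ?invr_ge0 ?invf_le1 ?ler1n ?leq_maxr.
have h4 := hc _ _ h2; have := reps_gt0 k.
rewrite -(subrK (gv (s i (2 ^ maxn k j)%N n)) (gv (s i k n))) -addrA.
move=> h5; apply: (le_trans (cnD _ _)); rewrite cnB mulr2n; lra.
Qed.
Definition dat_val i n : C := sval (cid (dat_val_ex i n)).
Lemma dat_valP i n k : cn (gv (s i k n) - dat_val i n) <= rv (reps k) *+ 2.
Proof. by rewrite /dat_val; case: cid. Qed.
Lemma dat_val_S i : Sk K (dat_val i).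
Proof.
have [Ds _ _ _] := D.
move=> d d0; have [k hk] := reps_small (divr_gt0 d0 (ltr0n _ 2)).
have [m [s1 s0]] := Ds i k; exists m, (fun n => gv (s i k n)); split.
  by split=> [n n' h|n h]; [rewrite (s1 n n') | rewrite s0 // gv0].
move=> n; rewrite cnB; apply: (le_trans (dat_valP _ _ _)); rewrite mulr2n; lra.
Qed.
Definition dat_pt i : Alg R K := @mkf R (FA_S R K) _ (dat_val_S i).

Lemma dat_cval p n d : 0 < d ->
  evt (fun k => cn (cval (fun i => gv (s i k n)) p - cval (fun i => fv (dat_pt i) n) p) <= d).
Proof.
apply: (@cval_cont R (fun k i => gv (s i k n))) => i d' d0.
have [k0 hk] := reps_small (divr_gt0 d0 (ltr0n _ 2)); exists k0 => k kk.
apply: (le_trans (dat_valP _ _ _)); have := reps_mono kk; rewrite mulr2n; lra.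
Qed.

Lemma dat_pres : is_presentation dat_pt /\ indexes dat_pt e.
Proof.
have [_ _ Dd Di] := D; split.
  apply: pres_ind => m c c0 d d0; have [j hj] := reps_small d0.
  have [_ [/num_isp [p <-] hp]] := Dd m c c0 j; exists p => n.
  apply: le_trans (ltW hj); have [k0 hk] := hp n.
  apply: (@le_evt _ (fun k => cval (fun i => gv (s i k n)) p - (K m n == c)%:R)).
    move=> d' /(dat_cval p n) [k1 h1]; exists k1 => k /h1.
    by rewrite opprB addrA subrK.
  exists k0 => k /hk; rewrite (cleP R) gv_gadd gv_gneg gv_evalp.
  by case: eqP => _; rewrite ?gv_gone ?gv0.
move=> p; have [r [h1 h2 h3 h4]] := Di _ (ispoly_num p); exists r; split=> //.
  by apply/decreasing_seqP => k; rewrite ltNge (rn_le R) -rleP.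
have dec k k' : (k <= k')%N -> rv (r k') <= rv (r k).
  move=> /subnK <-; elim: (k' - k)%N => // i IH; apply: le_trans IH.
  by have := h2 (i + k)%N; rewrite (rleP R) -ltNge => /ltW.
have lo k : N (star_poly_val dat_pt p) <= rv (r k).
  apply: alg_norm_le => n; apply/ler_addgt0Pr => d d0; have [j hj] := reps_small d0.
  have [k0 hk] := h3 n k j; rewrite fv_poly.
  apply: (@le_trans _ _ (rv (radd (r k) (reps j)))); last by rewrite rv_radd lerD2l ltW.
  apply: (le_evt (dat_cval p n)); exists k0 => k' /hk.
  by rewrite (cleP R) gv_evalp.
apply/cvg_ballP => d d0; have d2 : 0 < d / 2 by rewrite divr_gt0.
have [j hj] := reps_small d2; have [k [n [k0 hk]]] := h4 j.
have [k1 hk1] := @dat_cval p n _ d2.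
exists k => // k' /= kk'; rewrite -ball_normE /=.
have hh := hk (maxn k0 k1) (leq_maxl _ _); have hh1 := hk1 (maxn k0 k1) (leq_maxr _ _).
rewrite (cgeP R) gv_evalp rv_radd rv_rneg in hh.
have e1 : cn (cval (fun i => fv (dat_pt i) n) p) <= N (star_poly_val dat_pt p).
  by rewrite -fv_poly; apply: alg_norm_ub.
have e2 : cn (cval (fun i => gv (s i (maxn k0 k1) n)) p) <=
   cn (cval (fun i => fv (dat_pt i) n) p) + d / 2.
  rewrite -{1}(subrK (cval (fun i => fv (dat_pt i) n) p) (cval _ p)) addrC.
  by apply: (le_trans (cnD _ _)); rewrite lerD2l.
have e3 := lo k'; have e4 := dec _ _ kk'; rewrite -/(rv (r k')) distrC ger0_norm; last by lra.
have e5 : cval (gv \o (fun i => s i (maxn k0 k1) n)) p = cval (fun i => gv (s i (maxn k0 k1) n)) p by [].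
rewrite e5 in hh; lra.
Qed.
End DatPres.

Lemma pres_dat (a : nat -> Alg R K) e : is_presentation a -> indexes a e -> exists s, Dat K s e.
Proof.
move=> /presP da ia.
(* One quarter is spent on a simple function and one on Gaussian rational values. The result lies
   within half of [reps k] of the special point, and two such approximations are as close as
   [dat_cauchy] asks. *)
pose del k : R := rv (reps k) / 4.
have del0 k : 0 < del k by rewrite divr_gt0 ?reps_gt0.
have ex i k : exists y : nat -> C, (exists m, Fk K m y) /\ forall n, cn (fv (a i) n - y n) <= del k.
  have [m [z hz]] := Alg_approx (a i) (del0 k).
  exists (fv z); split; first by exists m; exact: (fvP z).
  by move=> n; apply: le_trans (ltW hz); apply: (alg_norm_ub (a i - inS z)).
pose y i k := sval (cid (ex i k)).
have hy i k : (exists m, Fk K m (y i k)) /\ forall n, cn (fv (a i) n - y i k n) <= del k.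
  by rewrite /y; case: cid.
have gd k (w : C) : exists g, cn (w - gv g) < del k by apply: gauss_dense.
(* Where the simple function vanishes the code 0 is forced, because [dat_simple] asks for this very
   code on class 0. *)
pose s i k n := if y i k n == 0 then 0%N else sval (cid (gd k (y i k n))).
have sE i k n : cn (y i k n - gv (s i k n)) <= del k.
  rewrite /s; case: eqP => [->|_]; first by rewrite gv0 subrr cn0 ltW.
  by case: cid => /= g /ltW.
have sA i k n : cn (gv (s i k n) - fv (a i) n) <= rv (reps k) / 2.
  have -> : gv (s i k n) - fv (a i) n = (gv (s i k n) - y i k n) + (y i k n - fv (a i) n).
    by rewrite addrA subrK.
  apply: (le_trans (cnD _ _)); rewrite (cnB (gv _)) (cnB _ (fv _ _)).
  by have := sE i k n; have := (hy i k).2 n; rewrite /del; lra.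
have scv p n d : 0 < d ->
    evt (fun k => cn (cval (fun i => gv (s i k n)) p - cval (fun i => fv (a i) n) p) <= d).
  apply: (@cval_cont R (fun k i => gv (s i k n))) => i d' d0.
  have [k0 hk] := reps_small d0; exists k0 => k kk.
  by apply: (le_trans (sA _ _ _)); have := reps_mono kk; have := reps_gt0 k; lra.
exists s; split.
- move=> i k; have [[m [y1 y0]] _] := hy i k; exists m; split=> n.
    by move=> n' h; rewrite /s (y1 n n').
  by move=> h; rewrite /s y0 // eqxx.
- move=> i k l n kl; rewrite (cleP R) gv_gadd gv_gneg.
  have -> : gv (s i k n) - gv (s i l n) = (gv (s i k n) - fv (a i) n) + (fv (a i) n - gv (s i l n)).
    by rewrite addrA subrK.
  apply: (le_trans (cnD _ _)); rewrite (cnB (fv _ _)).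
  have := sA i k n; have := sA i l n; have := reps_mono kl; lra.
- move=> m c c0 j.
  have hI : Fk (R:=R) K m (fun n => (K m n == c)%:R).
    split=> [n n' -> //|n ->]; by case: eqP c0 => // <-.
  have d2 : 0 < rv (reps j) / 2 by rewrite divr_gt0 ?reps_gt0.
  have [p hp] := da (@mkf R (FA_S R K) _ (Fk_Sk hI)) _ d2.
  exists (star_poly_num p); split=> [|n]; first exact: ispoly_num.
  have [k0 hk] := scv p n _ d2; exists k0 => k /hk.
  rewrite (cleP R) gv_gadd gv_gneg gv_evalp => h.
  have h1 := alg_norm_ub (@mkf R (FA_S R K) _ (Fk_Sk hI) - star_poly_val a p) n.
  rewrite fvD fvN fv_poly fv_mkf in h1.
  have -> : gv (if K m n == c then gone else 0%N) = (K m n == c)%:R.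
    by case: eqP => _; rewrite ?gv_gone ?gv0.
  rewrite cnB -(subrK (cval (fun i => fv (a i) n) p) (_ - _)).
  have -> : (K m n == c)%:R - cval (gv \o (fun i => s i k n)) p - cval (fun i => fv (a i) n) p +
     cval (fun i => fv (a i) n) p = ((K m n == c)%:R - cval (fun i => fv (a i) n) p) +
     (cval (fun i => fv (a i) n) p - cval (fun i => gv (s i k n)) p).
    by rewrite subrK addrA subrK.
  apply: (le_trans (cnD _ _)); rewrite (cnB (cval (fun i => fv (a i) n) p)).
  have := lt_le_trans hp (lexx _); move: h1 h; lra.
- move=> q /num_isp [p <-]; have [r [h1 h2 h3]] := ia p; exists r.
  have dec k k' : (k <= k')%N -> rv (r k') <= rv (r k).
    by move=> kk; rewrite -rn_le; have /= -> := h2 k k'.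
  have lo k : N (star_poly_val a p) <= rv (r k).
    apply/ler_addgt0Pr => d d0; have /cvg_ballP/(_ d d0) [k0 _ hk] := h3.
    have := hk (maxn k k0) (leq_maxr _ _); rewrite -ball_normE /= -/(rv _).
    have := dec _ _ (leq_maxl k k0); rewrite ltr_norml => e1 /andP[e2 e3]; lra.
  have up n : cn (cval (fun i => fv (a i) n) p) <= N (star_poly_val a p).
    by rewrite -fv_poly; apply: alg_norm_ub.
  split=> //.
  + move=> k; rewrite (rleP R) -ltNge.
    have : ~~ (rat_of_nat (r k) <= rat_of_nat (r k.+1)) by have /= -> := h2 k.+1 k; rewrite -ltnNge.
    by rewrite (rn_le R) -ltNge.
  + move=> n k j; have [k0 hk] := scv p n _ (reps_gt0 j); exists k0 => k' /hk.
    rewrite (cleP R) gv_evalp rv_radd => h.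
    rewrite -(subrK (cval (fun i => fv (a i) n) p) (cval _ p)).
    apply: (le_trans (cnD _ _)); have := up n; have := lo k; move: h.
    rewrite -[cval (gv \o _) p]/(cval (fun i => gv (s i k' n)) p); lra.
  + move=> j; have d3 : 0 < rv (reps j) / 3 by rewrite divr_gt0 ?reps_gt0.
    have /cvg_ballP/(_ _ d3) [k _ hk] := h3.
    have [n hn] := alg_norm_adh (star_poly_val a p) d3.
    have [k0 hk0] := scv p n _ d3; exists k, n, k0 => k' /hk0.
    rewrite (cgeP R) gv_evalp rv_radd rv_rneg.
    have := hk k (leqnn _); rewrite -ball_normE /= -/(rv _) ltr_norml => /andP[e1 e2].
    rewrite fv_poly in hn; move=> h.
    have : cn (cval (fun i => fv (a i) n) p) <=
       cn (cval (fun i => fv (a i) n) p - cval (fun i => gv (s i k' n)) p) +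
       cn (cval (fun i => gv (s i k' n)) p).
      by apply: le_trans (cnD _ _); rewrite subrK.
    rewrite cnB -[cval (gv \o _) p]/(cval (fun i => gv (s i k' n)) p); lra.
Qed.
End DataPres.

(** * The upper bound *)

Section SigData.
Local Open Scope nat_scope.
#[local] Hint Resolve cmp_evalp : cmp.

Lemma Sig_eq A B : cmp A -> cmp B -> Sig (fun f x => A f x = B f x).
Proof.
move=> hA hB; apply: (@Sig_ext (fun f x => A f x == B f x)); first by move=> f x; split=> /eqP.
by apply: Sig_bool; cmp.
Qed.
Lemma Sig_impl_eq A B Q : cmp A -> cmp B -> Sig Q -> Sig (fun f x => A f x = B f x -> Q f x).
Proof.
move=> hA hB hQ; apply: (@Sig_ext (fun f x => A f x == B f x -> Q f x)).
  by move=> f x; split=> h /eqP; apply: h.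
by apply: Sig_impl; cmp.
Qed.

Ltac sig := repeat first [apply: Sig_all | apply: Sig_ex | apply: Sig_and | apply: Sig_impl_eq; [by cmp | by cmp |]
  | apply: Sig_impl; [by cmp |] | apply: Sig_eq; [by cmp | by cmp] | apply: Sig_bool; by cmp | apply: Sig_phi; by cmp].

(* The function h codes K (in its part <0, <1, _>>) and s (in its part <1, _>). *)
Definition KK (h : nat -> nat) m n := h (pairn 0 (pairn 1 (pairn m n))).
Definition SS (h : nat -> nat) i k n := h (pairn 1 (pairn i (pairn k n))).

Lemma Sig_simple : Sig (fun h e => dat_simple (KK h) (SS h)).
Proof. rewrite /dat_simple /KK /SS; sig. Qed.
Lemma Sig_cauchy : Sig (fun h e => dat_cauchy (SS h)).
Proof. rewrite /dat_cauchy /SS; sig. Qed.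
Lemma Sig_dense : Sig (fun h e => dat_dense (KK h) (SS h)).
Proof. rewrite /dat_dense /KK /SS; sig. Qed.
Lemma Sig_index : Sig (fun h e => dat_index (SS h) e).
Proof.
pose Q (h : nat -> nat) z := [/\ forall k, phi (p1 z) (pairn (p2 z) k) (h (pairn 1 k)),
  forall k, ~~ rle (h (pairn 1 k)) (h (pairn 1 k.+1)),
  forall n k j, exists k0, forall k', k0 <= k' ->
    cle (evalp (fun i => SS (fun q => h (pairn 0 q)) i k' n) (p2 z)) (radd (h (pairn 1 k)) (reps j)) &
  forall j, exists k n k0, forall k', k0 <= k' ->
    cge (evalp (fun i => SS (fun q => h (pairn 0 q)) i k' n) (p2 z)) (radd (h (pairn 1 k)) (rneg (reps j)))].
have hQ : Sig Q.
  apply: (@Sig_ext (fun h z => (forall k, phi (p1 z) (pairn (p2 z) k) (h (pairn 1 k))) /\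
   ((forall k, ~~ rle (h (pairn 1 k)) (h (pairn 1 k.+1))) /\
   ((forall n k j, exists k0, forall k', k0 <= k' ->
    cle (evalp (fun i => SS (fun q => h (pairn 0 q)) i k' n) (p2 z)) (radd (h (pairn 1 k)) (reps j))) /\
   (forall j, exists k n k0, forall k', k0 <= k' ->
    cge (evalp (fun i => SS (fun q => h (pairn 0 q)) i k' n) (p2 z)) (radd (h (pairn 1 k)) (rneg (reps j)))))))).
    by move=> h z; split=> [[? [? [? ?]]]|[? ? ? ?]].
  rewrite /SS; sig.
apply: (@Sig_ext (fun h e => forall p, ispoly p -> (fun h z => exists r, Q (jn h r) z) h (pairn e p))).
  move=> h e; split=> H p /H [r hr]; exists r; move: hr; rewrite /Q !pE;
  rewrite -[fun q => jn h r (pairn 0 q)]/(col _ 0) -?[fun q => jn h r (pairn 1 q)]/(col _ 1) !col_jn0 //;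
  have E k : jn h r (pairn 1 k) = r k by rewrite -[LHS]/(col (jn h r) 1 k) col_jn1.
  - move=> [a b c d]; split.
    + by move=> k; move: (a k); rewrite E.
    + by move=> k; move: (b k); rewrite !E.
    + by move=> n k j; move: (c n k j); rewrite !E.
    + by move=> j; have [k [n H']] := d j; exists k, n; move: H'; rewrite !E.
  - move=> [a b c d]; split.
    + by move=> k; move: (a k); rewrite E.
    + by move=> k; move: (b k); rewrite !E.
    + by move=> n k j; move: (c n k j); rewrite !E.
    + by move=> j; have [k [n H']] := d j; exists k, n; move: H'; rewrite !E.
apply: Sig_all; apply: Sig_impl; first by cmp.
by apply: (Sig_subst (Sig_exf hQ)); cmp.
Qed.
Lemma Sig_Dat : Sig (fun h e => Dat (KK h) (SS h) e).
Proof.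
apply: (@Sig_ext (fun h e => dat_simple (KK h) (SS h) /\ (dat_cauchy (SS h) /\
   (dat_dense (KK h) (SS h) /\ dat_index (SS h) e)))).
  by move=> h e; split=> [[? [? []]]|[]].
apply: Sig_and Sig_simple _; apply: Sig_and Sig_cauchy _; exact: Sig_and Sig_dense Sig_index.
Qed.

(** The place of K before s is joined: the join moves column 1 of h to <0, <1, _>>, where [KK] looks
    for it. *)
Definition KF (h : nat -> nat) m n := h (pairn 1 (pairn m n)).
Definition is_kappa (K : nat -> nat -> nat) := (forall m, exists M, forall n, K m n < M) /\
  ((forall m n n', K m.+1 n = K m.+1 n' -> K m n = K m n') /\ (forall m n, K m.+1 n = 0 -> K m n = 0)).
Lemma Sig_is_kappa : Sig (fun h e => is_kappa (KF h)).
Proof. rewrite /is_kappa /KF; sig. Qed.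

Lemma Sig_upper : Sig (fun f x => exists K, is_kappa K /\
  ((exists s, Dat K s (p1 x)) /\ (exists s, Dat K s (p2 x)))).
Proof.
have hD : Sig (fun h e => exists s, Dat (KF h) s e).
  apply: Sig_ext (Sig_exf Sig_Dat) => h e; split=> [[g hg]|[s hs]].
    exists (SS (jn h g)); suff -> : KF h = KK (jn h g) by [].
    by apply/funext => m; apply/funext => n; rewrite /KF /KK -[RHS]/(col (jn h g) 0 _) col_jn0.
  exists (fun q => s (p1 q) (p1 (p2 q)) (p2 (p2 q))).
  set g := (fun q => _).
  have -> : KK (jn h g) = KF h.
    by apply/funext => m; apply/funext => n; rewrite /KF /KK -[LHS]/(col (jn h g) 0 _) col_jn0.
  suff -> : SS (jn h g) = s by [].
  apply/funext => i; apply/funext => k; apply/funext => n.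
  by rewrite /SS -[LHS]/(col (jn h g) 1 _) col_jn1 /g !pE.
have h1 : Sig (fun h x => exists s, Dat (KF h) s (p1 x)).
  by apply: (@Sig_subst (fun h e => exists s, Dat (KF h) s e) (fun f x => p1 x)) => //; cmp.
have h2 : Sig (fun h x => exists s, Dat (KF h) s (p2 x)).
  by apply: (@Sig_subst (fun h e => exists s, Dat (KF h) s e) (fun f x => p2 x)) => //; cmp.
apply: Sig_ext (Sig_exf (Sig_and Sig_is_kappa (Sig_and h1 h2))) => f x; split=> [[g hg]|[K hK]].
  by exists (KF (jn f g)).
exists (fun q => K (p1 q) (p2 q)); set g := (fun q => _).
suff -> : KF (jn f g) = K by [].
apply/funext => m; apply/funext => n.
by rewrite /KF -[LHS]/(col (jn f g) 1 _) col_jn1 /g !pE.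
Qed.
End SigData.

Lemma indexes_iso (R : realType) (A B : cstar_alg R) (u : A -> B) (a : nat -> A) e :
  is_star_hom u -> (forall x, cs_norm (u x) = cs_norm x) -> indexes a e -> indexes (u \o a) e.
Proof. by move=> hu iu ia p; have [r hr] := ia p; exists r; rewrite -(hom_poly hu) iu. Qed.

Lemma pres_iso (R : realType) (A B : cstar_alg R) (u : A -> B) (a : nat -> A) :
  is_star_hom u -> (forall x, cs_norm (u x) = cs_norm x) -> bijective u ->
  is_presentation a -> is_presentation (u \o a).
Proof.
move=> hu iu [g ug gu] /presP da; apply/presP => y eps e0.
have [p hp] := da (g y) eps e0; exists p.
by rewrite -(hom_poly hu) -{1}(gu y) -(homB hu) iu.
Qed.

Lemma iso_upper (R : realType) (e : nat * nat) : comm_AF_iso_problem R e <->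
  exists K, is_kappa K /\ ((exists s, Dat K s e.1) /\ (exists s, Dat K s e.2)).
Proof.
split=> [[A [B [a [b [[cA fA] [cB fB] [pa ia] [pb ib] [h hh bh]]]]]]|[K [[K1 [K2 K3]] [[s Ds] [t Dt]]]]].
  have [K [u [hu bu]]] := AF_kappa cA fA.
  (* The inverse isomorphism is isometric by [Alg_iso_isometric], so the transported special points
     keep the same index. *)
  have push (A' : cstar_alg R) (v : Alg R K -> A') (c : nat -> A') e' : is_star_hom v -> bijective v ->
      is_presentation c -> indexes c e' -> exists s, Dat K s e'.
    move=> hv bv pc ic; have [g [hg vg gv]] := star_iso_inv hv bv.
    have ig x : cs_norm (g x) = cs_norm x by rewrite -(Alg_iso_isometric hv bv) gv.
    apply: (@pres_dat R K (g \o c)); last exact: indexes_iso.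
    by apply: pres_iso => //; exists v.
  exists K; split; first by split; [exact: kap_fin | split; [exact: kap_ref | exact: kap_ref0]].
  split; first exact: (push A u a).
  apply: (push B (h \o u) b) => //; first exact: star_hom_comp.
  exact: bij_comp.
pose KP := Kappa K1 K2 K3.
have [pa ia] := @dat_pres R KP s e.1 Ds; have [pb ib] := @dat_pres R KP t e.2 Dt.
have cA : cs_commutative (Alg R KP) by exact: alg_comm.
have fA : is_AF (Alg R KP) by exact: Alg_AF.
by exists (Alg R KP), (Alg R KP), (@dat_pt R KP s _ Ds), (@dat_pt R KP t _ Dt); split=> //; exists id; [split | exists id].
Qed.

Lemma iso_problem_Sigma11 (R : realType) : Sigma11 (coded_pairs (comm_AF_iso_problem R)).
Proof.
have -> : coded_pairs (comm_AF_iso_problem R) = [set x | (fun (f : nat -> nat) x => exists K, is_kappa K /\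
  ((exists s, Dat K s (p1 x)) /\ (exists s, Dat K s (p2 x)))) (fun=> 0%N) x].
  by apply/seteqP; split=> x; rewrite /coded_pairs /= iso_upper.
exact: (Sig_Sigma11 Sig_upper).
Qed.

Local Close Scope ring_scope.

(** * Forests and their clopen sets *)

Section Anc.
(** The prefix order on coded sequences. Since [par] decreases positive codes, n steps already reach
    the empty sequence. *)
Definition anc v n := bex n.+1 (fun k => iter k par n == v).
Lemma iter_par0 k : iter k par 0 = 0. Proof. by elim: k => //= k ->. Qed.
Lemma ancP v n : reflect (exists k, iter k par n = v) (anc v n).
Proof.
apply: (iffP (bexP _ _)) => [[k _ /eqP<-]|[k <-]]; first by exists k.
have [kn|kn] := ltnP k n.+1; first by exists k.
exists n => //; apply/eqP.
have h j m : m <= j -> iter j par m = 0.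
  elim: j m => [|j IH] m; first by case: m.
  case: m => [|m] mj; first exact: iter_par0.
  by rewrite iterSr; apply: IH; rewrite -ltnS; apply: leq_trans (par_lt _) _.
by rewrite !h // ltnW.
Qed.
Lemma anc_refl n : anc n n. Proof. by apply/ancP; exists 0. Qed.
Lemma anc_trans u v n : anc u v -> anc v n -> anc u n.
Proof. by move=> /ancP [j <-] /ancP [k <-]; apply/ancP; exists (j + k); rewrite iterD. Qed.
Lemma anc_le v n : anc v n -> v <= n.
Proof. by move=> /ancP [k <-]; elim: k => //= k; apply: leq_trans (par_le _). Qed.
Lemma anc0 v : anc v 0 -> v = 0. Proof. by move=> /anc_le; case: v. Qed.
Lemma anc_par n : anc (par n) n. Proof. by apply/ancP; exists 1. Qed.
Lemma anc_step v n : anc v n = (v == n) || (anc v (par n)).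
Proof.
apply/idP/orP => [/ancP [[|k] h]|[/eqP->|h]]; first by left; apply/eqP.
- by right; apply/ancP; exists k; rewrite -iterSr.
- exact: anc_refl.
- exact: anc_trans h (anc_par _).
Qed.
Lemma anc_snoc v s a : anc v (snoc s a) = (v == snoc s a) || anc v s.
Proof. by rewrite anc_step par_snoc. Qed.
Lemma anc_snocr s a : anc s (snoc s a). Proof. by rewrite anc_snoc anc_refl orbT. Qed.
Lemma anc_chain u v n : anc u n -> anc v n -> anc u v \/ anc v u.
Proof.
move=> /ancP [j <-] /ancP [k <-]; have [jk|kj] := leqP j k.
  by right; apply/ancP; exists (k - j); rewrite -iterD subnK.
by left; apply/ancP; exists (j - k); rewrite -iterD subnK // ltnW.
Qed.
Lemma anc_child v n : anc v n -> v <> n -> exists a, anc (snoc v a) n.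
Proof.
elim/ltn_ind: n => n IH; rewrite anc_step => /orP[/eqP//|h] vn.
have n0 : 0 < n.
  by case: n IH h vn => //= _ /anc_le; case: v.
have [e|ne] := eqVneq v (par n).
  by exists (lst n); rewrite e snoc_eta ?anc_refl.
have [a ha] := IH _ (par_lt n0) h (elimN eqP ne).
by exists a; apply: anc_trans ha (anc_par _).
Qed.
Lemma snoc_gt s a : s < snoc s a.
Proof. by rewrite ltnS; apply: leq_trans (pairn_ge _ _); apply: leq_addl. Qed.
Lemma snoc_gtl s a : a < snoc s a.
Proof. by rewrite ltnS; apply: leq_trans (pairn_ge _ _); apply: leq_addr. Qed.
Lemma snoc_inj s a s' a' : snoc s a = snoc s' a' -> s = s' /\ a = a'.
Proof. by move=> /succn_inj /pairn_inj. Qed.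
Lemma anc_disj s a b n : anc (snoc s a) n -> anc (snoc s b) n -> a = b.
Proof.
move=> h h'; have [] := anc_chain h h'; rewrite anc_snoc => /orP[/eqP/snoc_inj[]//|/anc_le];
by rewrite leqNgt snoc_gt.
Qed.
Lemma cmp_anc F G : cmp F -> cmp G -> cmp (fun f x => anc (F f x) (G f x)).
Proof. by move=> hF hG; apply: (@cmp_app2 (fun v n => anc v n)) => //; rewrite /anc; cmp. Qed.
End Anc.
#[global] Hint Resolve cmp_anc : cmp.

Section Clop.
Variable K : nat -> nat -> nat.
(** These are the sets whose indicators belong to some level; they correspond to the compact open
    subsets of the spectrum. *)
Definition clop (U : set nat) := exists m, (forall n n', K m n = K m n' -> U n -> U n') /\
  forall n, K m n = 0 -> ~ U n.
End Clop.

Section ClopK.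
Variable K : kappa.
Lemma clop_lift U : clop K U -> exists m, forall m', m <= m' ->
  (forall n n', K m' n = K m' n' -> U n -> U n') /\ forall n, K m' n = 0 -> ~ U n.
Proof.
move=> [m [h1 h2]]; exists m => m' mm; split=> [n n' h|n h]; first exact/h1/(kap_refle mm).
exact/h2/(kap_ref0le mm).
Qed.
Lemma clop0 : clop K set0. Proof. by exists 0; split=> // n _ []. Qed.
Lemma clop2 U V : clop K U -> clop K V -> exists m,
  [/\ forall n n', K m n = K m n' -> U n -> U n', forall n n', K m n = K m n' -> V n -> V n',
  forall n, K m n = 0 -> ~ U n & forall n, K m n = 0 -> ~ V n].
Proof.
move=> /clop_lift [m h] /clop_lift [m' h']; exists (maxn m m').
by have [a b] := h _ (leq_maxl m m'); have [c d] := h' _ (leq_maxr m m'); split.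
Qed.
Lemma clopI U V : clop K U -> clop K V -> clop K (U `&` V).
Proof.
move=> hU hV; have [m [a b c d]] := clop2 hU hV; exists m; split=> [n n' h [u v]|n h [u _]].
  by split; [apply: a u | apply: b v].
exact: c u.
Qed.
Lemma clopU U V : clop K U -> clop K V -> clop K (U `|` V).
Proof.
move=> hU hV; have [m [a b c d]] := clop2 hU hV; exists m; split=> [n n' h [u|u]|n h [u|u]].
- by left; apply: a u.
- by right; apply: b u.
- exact: c u.
- exact: d u.
Qed.
Lemma clopD U V : clop K U -> clop K V -> clop K (U `\` V).
Proof.
move=> hU hV; have [m [a b c d]] := clop2 hU hV; exists m; split=> [n n' h [u v]|n h [u _]].
  by split; [apply: a u | move=> v'; apply/v/(b n')].
exact: c u.
Qed.
End ClopK.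

Section Forest.
Variables (lt : nat -> nat -> bool) (N0 : nat).
(* A node is a finite sequence of entries <l, i>, where l is the label and i makes each
   label occur infinitely often. Labels of valid nodes descend in lt, starting from one
   of N0 roots labelled 0. *)
Definition lab v := p1 (lst v).
Definition okc u a := if u == 0 then (p1 a == 0) && (p2 a < N0) else lt (p1 a) (lab u).
Definition valid v := bal v.+1 (fun u => [|| u == 0, ~~ anc u v | okc (par u) (lst u)]).
Lemma validP v : reflect (forall u, 0 < u -> anc u v -> okc (par u) (lst u)) (valid v).
Proof.
apply: (iffP (balP _ _)) => h u.
  by move=> u0 uv; have := h u; rewrite ltnS (anc_le uv) uv -[u == 0]negbK -lt0n u0; apply.
move=> _; have [//|u0] := eqVneq u 0; case: (boolP (anc u v)) => //= uv.
by apply: h => //; rewrite lt0n.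
Qed.
Lemma valid_anc u v : anc u v -> valid v -> valid u.
Proof. by move=> uv /validP h; apply/validP => w w0 wu; apply: h w0 (anc_trans wu uv). Qed.
Lemma valid_snoc s a : valid (snoc s a) = valid s && okc s a.
Proof.
apply/idP/andP => [h|[/validP h1 h2]].
  split; first exact: valid_anc (anc_snocr s a) h.
  by move/validP: h => /(_ (snoc s a) isT (anc_refl _)); rewrite par_snoc lst_snoc.
by apply/validP => u u0; rewrite anc_snoc => /orP[/eqP->|]; [rewrite par_snoc lst_snoc | apply: h1].
Qed.
Definition coneb v n := [&& 0 < v, valid v & anc v n].
Definition cone v : set nat := [set n | coneb v n].
Lemma cone_self v : 0 < v -> valid v -> cone v v.
Proof. by rewrite /cone /= /coneb => -> ->; rewrite anc_refl. Qed.

(** The largest node below m whose cone contains n, or 0. The nodes that are prefixes of n form a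
    chain, so this single number records membership of n in all cones with index below m, as
    [kapf_eqP] states. *)
Fixpoint kapf m n := if m is m'.+1 then (if coneb m' n then m' else kapf m' n) else 0.
Lemma kapf_cone m n : 0 < kapf m n -> kapf m n < m /\ cone (kapf m n) n.
Proof.
elim: m => //= m IH; case: ifP => [h _|_ /IH [h1 h2]]; first by split.
by split=> //; apply: ltnW.
Qed.
Lemma kapf_lt m n : 0 < m -> kapf m n < m.
Proof.
move=> m0; case: (posnP (kapf m n)) => [->//|]; by case/kapf_cone.
Qed.
Lemma kapf_le m n : kapf m n <= m.
Proof. by case: (posnP (kapf m n)) => [->//|] /kapf_cone [/ltnW]. Qed.
Lemma kapf_max m n v : v < m -> cone v n -> anc v (kapf m n) /\ 0 < kapf m n.
Proof.
elim: m => // m IH; rewrite ltnS leq_eqVlt => /orP[/eqP->|vm] h.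
  by move: (h); rewrite /cone /= => ->; rewrite anc_refl; case/and3P: h.
have /= [h1 h2] := IH vm h; case: ifP => // hm; split; last by case/and3P: hm.
case/and3P: h => v0 _ vn; case/and3P: hm => _ _ mn.
by have [//|/anc_le] := anc_chain vn mn; rewrite leqNgt vm.
Qed.
Lemma kapf_pattern m n v : v < m -> coneb v (kapf m n) = coneb v n.
Proof.
move=> vm; apply/idP/idP => h.
  case/and3P: h => v0 vv vk; have k0 : 0 < kapf m n by apply: leq_trans (anc_le vk).
  by have [_ /and3P[_ _ hk]] := kapf_cone k0; rewrite /coneb v0 vv (anc_trans vk hk).
by have [h1 h2] := kapf_max vm h; case/and3P: h => v0 vv _; rewrite /coneb v0 vv.
Qed.
Lemma pattern_kapf m n n' : (forall v, v < m -> coneb v n = coneb v n') -> kapf m n = kapf m n'.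
Proof.
elim: m => //= m IH h; rewrite h // IH // => v vm; apply: h; exact: ltnW.
Qed.
Lemma kapf_eqP m n n' : kapf m n = kapf m n' <-> forall v, v < m -> coneb v n = coneb v n'.
Proof.
split; last exact: pattern_kapf.
by move=> h v vm; rewrite -(kapf_pattern n vm) h kapf_pattern.
Qed.
Lemma kapf0P m n : kapf m n = 0 <-> forall v, v < m -> coneb v n = false.
Proof.
have e : kapf m 0 = 0 by have := kapf_cone (m := m) (n := 0); case: (kapf m 0) => // k /(_ isT) [_ /and3P[_ _ /anc0]].
rewrite -{1}e kapf_eqP; split=> h v vm; rewrite h //.
  by apply/negbTE/negP => /and3P[v0 _ /anc0 e0]; rewrite e0 in v0.
by apply/esym/negbTE/negP => /and3P[v0 _ /anc0 e0]; rewrite e0 in v0.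
Qed.
Definition kapF : kappa.
Proof.
refine (@Kappa kapf _ _ _) => m.
- by exists m.+1 => n; rewrite ltnS kapf_le.
- by move=> n n' /kapf_eqP h; apply/kapf_eqP => v vm; apply: h; apply: ltnW.
- by move=> n /kapf0P h; apply/kapf0P => v vm; apply: h; apply: ltnW.
Defined.

Lemma cone_clop v : clop kapF (cone v).
Proof.
exists v.+1; split=> [n n' /kapf_eqP /(_ v (ltnSn v)) h|n /kapf0P /(_ v (ltnSn v)) h]; rewrite /cone /=.
  by rewrite h.
by rewrite h.
Qed.
(** Level m tests only cones of nodes below m. An entry a >= m makes the child and everything beyond
    it larger than m, so these points have the pattern of s itself. *)
Lemma clop_fresh U s : clop kapF U -> U s -> exists M, forall a, M <= a -> forall n, anc (snoc s a) n -> U n.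
Proof.
move=> [m [h1 h2]] us; exists m => a ma n an; apply: h1 us; apply/kapf_eqP => v vm.
rewrite /coneb; case: (0 < v) => //=; case: (valid v) => //=.
have sn : anc s n by apply: anc_trans (anc_snocr s a) an.
apply/idP/idP => [h|h]; first exact: anc_trans h sn.
have [//|h'] := anc_chain h an; first by rewrite anc_snoc => /orP[/eqP e|//];
  move: vm; rewrite e ltnNge (leq_trans ma) // ltnW // snoc_gtl.
by move: vm; rewrite ltnNge (leq_trans ma) // (leq_trans _ (anc_le h')) // ltnW // snoc_gtl.
Qed.
(** If U separates n from s, then some node v < m beyond s does so, and the child of s on the way to
    v has a code at most v. *)
Lemma clop_children U s : clop kapF U -> exists M, forall n, anc s n -> ~ (U s <-> U n) ->
  exists c, [/\ c < M, 0 < c, par c = s, valid c & anc c n].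
Proof.
move=> [m [h1 h2]]; exists m => n sn hU.
have [v vm hv] : exists2 v, v < m & coneb v n && ~~ coneb v s.
  apply: contrapT => hn; apply: hU.
  have e : kapf m s = kapf m n.
    apply/kapf_eqP => v vm; apply/idP/idP => [/and3P[a b c]|h].
      by rewrite /coneb a b (anc_trans c sn).
    by case: (boolP (coneb v s)) => // h'; case: hn; exists v; rewrite ?h.
  by split; apply: h1.
case/andP: hv => /and3P[v0 vv vn]; rewrite /coneb v0 vv /= => vs.
have [//|sv] := anc_chain vn sn; first by rewrite (negbTE vs).
have [|a ha] := anc_child sv; first by move=> e; rewrite e anc_refl in vs.
exists (snoc s a); split=> //; first exact: leq_ltn_trans (anc_le ha) vm.
- exact: par_snoc.
- exact: valid_anc ha vv.
- exact: anc_trans ha vn.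
Qed.
(** The class of n at level m is represented by the node [kapf m n], which has the same pattern as n
    and therefore lies in U. *)
Lemma clop_cover U : clop kapF U -> exists s : seq nat,
  (forall v, v \in s -> [/\ 0 < v, valid v & U v]) /\ forall n, U n -> exists2 v, v \in s & anc v n.
Proof.
move=> [m [h1 h2]]; exists [seq v <- iota 0 m | `[< [/\ 0 < v, valid v & U v] >]]; split.
  by move=> v; rewrite mem_filter => /andP[/asboolP].
move=> n un; have k0 : 0 < kapf m n by case: (posnP (kapf m n)) => // /h2 /(_ un).
have [km /and3P[_ vk kn]] := kapf_cone k0; exists (kapf m n) => //.
rewrite mem_filter mem_iota km !andbT; apply/asboolP; split=> //.
apply: h1 un; apply: pattern_kapf => v vm; by rewrite kapf_pattern.
Qed.
End Forest.

(** * The well-founded case *)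

Section Atoms.
Variables (K : nat -> nat -> nat) (lt : nat -> nat -> bool).
(* An analogue of the Cantor-Bendixson analysis: At m D says that every clopen
   partition of D into two pieces has an m-small piece, where m-small sets are
   those covered by finitely many atoms of labels below m. *)
Inductive At : nat -> set nat -> Prop :=
| AtI m D : clop K D -> (forall U, clop K U -> Sm m (D `&` U) \/ Sm m (D `\` U)) -> At m D
with Sm : nat -> set nat -> Prop :=
| Sm0 m : Sm m set0
| SmS m l D E : lt l m -> At l D -> Sm m (E `\` D) -> Sm m E.

Lemma At_clop m D : At m D -> clop K D. Proof. by case. Qed.
Lemma At_split m D U : At m D -> clop K U -> Sm m (D `&` U) \/ Sm m (D `\` U).
Proof. by case=> {}m {}D _ h; apply: h. Qed.
Lemma Sm_sub m E E' : E' `<=` E -> Sm m E -> Sm m E'.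
Proof.
move=> h hE; elim: hE E' h => [{}m|{}m l D {}E lm hD _ IH] E' h.
  by rewrite (_ : E' = set0); [exact: Sm0 | apply/seteqP; split].
by apply: (SmS lm hD); apply: IH => n [a b]; split=> //; apply: h.
Qed.
Lemma Sm_mem m E n : Sm m E -> E n -> exists l D, [/\ lt l m, At l D & D n].
Proof.
elim=> // {}m l D {}E lm hD _ IH En; have [Dn|Dn] := EM (D n); first by exists l, D.
by apply: IH.
Qed.
End Atoms.

Section AtomCone.
Variables (lt : nat -> nat -> bool) (N0 : nat).
Local Notation K := (kapF lt N0).
Local Notation cone := (cone lt N0).
Local Notation valid := (valid lt N0).
Lemma Sm_cover m (s : seq nat) E : (forall c, c \in s -> lt (lab c) m /\ At K lt (lab c) (cone c)) ->
  (forall n, E n -> exists2 c, c \in s & cone c n) -> Sm K lt m E.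
Proof.
elim: s E => [|c s IH] E hs hE.
  rewrite (_ : E = set0); [exact: Sm0 | apply/seteqP; split=> // n /hE [c]]; by rewrite in_nil.
have [a b] := hs c (mem_head _ _); apply: (SmS a b); apply: IH => [d ds|n [En cn]].
  by apply: hs; rewrite in_cons ds orbT.
by have [d] := hE n En; rewrite in_cons => /orP[/eqP->//|ds dn]; exists d.
Qed.

(** By [clop_children], the part of the cone that U separates from s lies in finitely many child
    cones, which are atoms of smaller label by induction. *)
Lemma cone_atom m : Acc lt m -> forall s, 0 < s -> valid s -> lab s = m -> At K lt m (cone s).
Proof.
elim=> {}m _ IH s s0 vs ls; apply: AtI => [|U hU]; first exact: cone_clop.
have [M hM] := clop_children s hU.
have main (E : set nat) : (forall n, E n -> anc s n /\ ~ (U s <-> U n)) -> Sm K lt m E.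
  move=> hE; apply: (@Sm_cover _ [seq c <- iota 0 M | (0 < c) && (par c == s) && valid c]).
    move=> c; rewrite mem_filter => /andP[/andP[/andP[c0 /eqP pc] vc] _].
    have lm : lt (lab c) m.
      by move/validP: vc => /(_ c c0 (anc_refl c)); rewrite /okc pc eqn0Ngt s0 /= ls.
    by split=> //; apply: IH lm _ c0 vc erefl.
  move=> n /hE [h1 h2]; have [c [cM c0 pc vc cn]] := hM n h1 h2.
  by exists c; [rewrite mem_filter c0 pc eqxx vc mem_iota | rewrite /cone /= /coneb c0 vc].
have [us|us] := EM (U s).
  by right; apply: main => n [/and3P[_ _ sn] Un]; split=> // -[/(_ us)].
by left; apply: main => n [/and3P[_ _ sn] Un]; split=> // -[_ /(_ Un)].
Qed.

(** In a finite cover by smaller atoms, one atom D of some label l contains s, and so two disjoint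
    child cones of s labelled l; here the repetition of labels is used. Splitting D along the first
    makes one of the two l-small, against the induction hypothesis. *)
Lemma cone_not_small m : Acc lt m -> forall s, 0 < s -> valid s -> lab s = m -> ~ Sm K lt m (cone s).
Proof.
elim=> {}m _ IH s s0 vs ls hS.
have [l [D [lm hD Ds]]] := Sm_mem hS (cone_self s0 vs).
have [M hM] := clop_fresh (At_clop hD) Ds.
pose t j := snoc s (pairn l (M + j)).
have tM j : M <= pairn l (M + j).
  by apply: leq_trans (pairn_ge _ _); rewrite -addnA leq_addr.
have vt j : valid (t j) by rewrite valid_snoc vs /okc eqn0Ngt s0 /= p1_pair ls.
have lt_t j : lab (t j) = l by rewrite /lab lst_snoc p1_pair.
have [hs|hs] := At_split hD (cone_clop _ _ (t 0)).
  apply: (IH l lm (t 0) isT (vt 0) (lt_t 0)); apply: Sm_sub hs => n h; split=> //.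
  by apply: hM (tM 0) _ _; case/and3P: h.
apply: (IH l lm (t 1) isT (vt 1) (lt_t 1)); apply: Sm_sub hs => n /and3P[_ _ h]; split.
  exact: hM (tM 1) _ h.
move=> /and3P[_ _ h']; have /pairn_inj [_] := anc_disj h h'; lia.
Qed.
End AtomCone.

Section AtomTransport.
Variables (K K' : kappa) (lt : nat -> nat -> bool) (F : set nat -> set nat).
Hypothesis Fclop : forall U, clop K U -> clop K' (F U).
Hypothesis FI : forall U V, clop K U -> clop K V -> F (U `&` V) = F U `&` F V.
Hypothesis FD : forall U V, clop K U -> clop K V -> F (U `\` V) = F U `\` F V.
Hypothesis F0 : F set0 = set0.
Hypothesis Fsurj : forall V, clop K' V -> exists2 U, clop K U & F U = V.

Lemma Sm_transport m : (forall l D, lt l m -> At K lt l D -> At K' lt l (F D)) ->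
  forall E, clop K E -> Sm K lt m E -> Sm K' lt m (F E).
Proof.
move=> h E cE hE; elim: hE h cE => [{}m|{}m l D {}E lm hD _ IH] h cE.
  by rewrite F0; apply: Sm0.
have cD := At_clop hD; apply: (SmS lm (h _ _ lm hD)); rewrite -FD //; apply: IH => //.
exact: clopD.
Qed.
(** Atoms and small sets are defined from the operations on clopen sets alone, so an isomorphism
    carries them over. *)
Lemma At_transport m : Acc lt m -> forall D, At K lt m D -> At K' lt m (F D).
Proof.
elim=> {}m _ IH D hD; have cD := At_clop hD; apply: AtI => [|V /Fsurj [U cU <-]]; first exact: Fclop.
have hS := @Sm_transport m (fun l D' lm => IH l lm D').
have [h|h] := At_split hD cU.
  by left; rewrite -FI //; apply: hS h; apply: clopI.
by right; rewrite -FD //; apply: hS h; apply: clopD.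
Qed.
End AtomTransport.

(** With one root the whole space is an atom of label 0. Pulling back the cones of the two roots and
    splitting along the first makes one of these cones 0-small, contrary to [cone_not_small]. *)
Lemma not_iso_clop (lt : nat -> nat -> bool) (F : set nat -> set nat) : Acc lt 0 ->
  (forall U, clop (kapF lt 1) U -> clop (kapF lt 2) (F U)) ->
  (forall U V, clop (kapF lt 1) U -> clop (kapF lt 1) V -> F (U `&` V) = F U `&` F V) ->
  (forall U V, clop (kapF lt 1) U -> clop (kapF lt 1) V -> F (U `\` V) = F U `\` F V) ->
  F set0 = set0 ->
  ~ (forall V, clop (kapF lt 2) V -> exists2 U, clop (kapF lt 1) U & F U = V).
Proof.
move=> acc Fc FI FD F0 Fs.
pose r i := snoc 0 (pairn 0 i).
have vr N0 i : i < N0 -> valid lt N0 (r i).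
  move=> iN; apply/validP => u u0; rewrite anc_snoc => /orP[/eqP->|/anc0 e]; last by rewrite e in u0.
  by rewrite par_snoc lst_snoc /okc eqxx !pE eqxx.
have lr i : lab (r i) = 0 by rewrite /lab lst_snoc p1_pair.
have ns i : i < 2 -> ~ Sm (kapF lt 2) lt 0 (cone lt 2 (r i)).
  by move=> i2; exact: (@cone_not_small lt 2 0 acc (r i) isT (vr _ _ i2) (lr i)).
have [U cU eU] := Fs _ (cone_clop lt 2 (r 0)).
have [W cW eW] := Fs _ (cone_clop lt 2 (r 1)).
have sub V : clop (kapF lt 1) V -> V `<=` cone lt 1 (r 0).
  move=> [m [_ h]] n Vn; have k0 : 0 < kapf lt 1 m n by case: posnP => // /h.
  have [_ /and3P[v0 vv vn]] := kapf_cone k0.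
  rewrite /cone /= /coneb (vr 1 0) //=.
  have [//|[v hv]] : anc (r 0) n \/ exists v, [/\ 0 < v, valid lt 1 v, anc v n & par v = 0].
    right; elim/ltn_ind: (kapf lt 1 m n) v0 vv vn => v IH v0 vv vn.
    have [e|p0] := posnP (par v); first by exists v.
    apply: IH p0 _ (anc_trans (anc_par v) vn); first exact: par_lt.
    exact: valid_anc (anc_par v) vv.
  case: hv => v1 vv1 vn1 pv; move/validP: vv1 => /(_ v v1 (anc_refl v)).
  rewrite /okc pv eqxx => /andP[/eqP a b].
  rewrite (_ : r 0 = v) // -(snoc_eta v1) pv -(pair_p (lst v)) a.
  by case: (p2 (lst v)) b.
have hA := @cone_atom lt 1 0 acc (r 0) isT (vr 1 0 isT) (lr 0).
have tr := @Sm_transport (kapF lt 1) (kapF lt 2) lt F FD F0 0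
  (fun l D l0 => @At_transport (kapF lt 1) (kapF lt 2) lt F Fc FI FD F0 Fs l (Acc_inv acc l0) D).
have [h|h] := At_split hA cU.
  apply: (ns 0 isT); rewrite -eU; apply: tr => //.
  by apply: Sm_sub h => n Un; split=> //; apply: sub Un.
apply: (ns 1 isT); rewrite (_ : cone _ _ _ = F (W `\` U)).
  apply: tr; first exact: clopD.
  by apply: Sm_sub h => n [Wn Un]; split=> //; apply: sub Wn.
rewrite FD // eU eW; apply/seteqP; split=> [n h1|n []//]; split=> // h2.
case/and3P: h1 => _ _ h1; case/and3P: h2 => _ _ h2.
by have /pairn_inj [] := anc_disj h1 h2.
Qed.

(** * The ill-founded case *)

Section Append.
Definition app s (w : seq nat) := foldl snoc s w.
Lemma app_rcons s w a : app s (rcons w a) = snoc (app s w) a.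
Proof. by rewrite /app -cats1 foldl_cat. Qed.
Lemma app_cat s w z : app s (w ++ z) = app (app s w) z.
Proof. by rewrite /app foldl_cat. Qed.
Lemma app_gt s w a : s < app s (rcons w a).
Proof.
elim/last_ind: w a => [|w b IH] a; first exact: snoc_gt.
by rewrite app_rcons; apply: ltn_trans (IH b) (snoc_gt _ _).
Qed.
Lemma app_inj s : injective (app s).
Proof.
move=> w; elim/last_ind: w => [|w a IH] w'; case: (lastP w') => [//|z b] h.
- by have := app_gt s z b; rewrite -h ltnn.
- by have := app_gt s w a; rewrite h ltnn.
- by move: h; rewrite !app_rcons => /snoc_inj [/IH -> ->].
Qed.
Lemma app_anc s n : anc s n <-> exists w, n = app s w.
Proof.
split=> [|[w ->]]; last first.
  elim/last_ind: w => [|w a IH]; first exact: anc_refl.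
  by rewrite app_rcons; apply: anc_trans IH (anc_snocr _ _).
elim/ltn_ind: n => n IH h; have [<-|ne] := eqVneq s n; first by exists [::].
move: h; rewrite anc_step (negbTE ne) /= => h.
have n0 : 0 < n by case: n ne h {IH} => //= ne /anc_le; rewrite leqn0 (negbTE ne).
have [w hw] := IH _ (par_lt n0) h; exists (rcons w (lst n)).
by rewrite app_rcons -hw snoc_eta.
Qed.
Lemma anc_app s u w : anc (app s u) (app s w) <-> exists z, w = u ++ z.
Proof.
rewrite app_anc; split=> -[z]; last by move=> ->; exists z; rewrite app_cat.
by rewrite -app_cat => /app_inj; exists z.
Qed.
(* Replaces the prefix s of n by t. *)
Definition tr s t n := if pselect (exists w, n = app s w) is left h then app t (sval (cid h)) else 0.
Lemma trE s t w : tr s t (app s w) = app t w.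
Proof.
rewrite /tr; case: pselect => [h|[]]; last by exists w.
by case: cid => u /= /app_inj ->.
Qed.
End Append.

Section Homeo.
Variable lt : nat -> nat -> bool.
Local Notation K N := (kapF lt N).
Local Notation cone := (cone lt).
Local Notation coneb := (coneb lt).
Local Notation valid := (valid lt).

Definition homeo N M (A B : set nat) := exists t t' : nat -> nat, [/\
  forall n, A n -> B (t n) /\ t' (t n) = n, forall n, B n -> A (t' n) /\ t (t' n) = n,
  forall V, clop (K M) V -> clop (K N) (A `&` t @^-1` V) &
  forall U, clop (K N) U -> clop (K M) (B `&` t' @^-1` U)].

Lemma homeo_sym N M A B : homeo N M A B -> homeo M N B A.
Proof. by move=> [t [t' [h1 h2 h3 h4]]]; exists t', t; split. Qed.

Lemma homeo_split N M A B U : homeo N M A B -> clop (K N) U -> exists V, [/\ clop (K M) V,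
  homeo N M (A `&` U) (B `&` V) & homeo N M (A `\` U) (B `\` V)].
Proof.
move=> [t [t' [h1 h2 h3 h4]]] cU; have cV := h4 _ cU.
exists (B `&` t' @^-1` U); split=> //; exists t, t'; split.
- by move=> n [a u]; have [b e] := h1 n a; rewrite /= /preimage /= e.
- by move=> n [_ [b u]]; have [a e] := h2 n b.
- move=> W cW; rewrite setIAC; apply: clopI => //; exact: h3.
- move=> W cW; rewrite setIAC; apply: clopI => //; exact: h4.
- move=> n [a u]; have [b e] := h1 n a; split=> //; split=> // -[_].
  by rewrite /preimage /= e.
- move=> n [b u]; have [a e] := h2 n b; split=> //; split=> // h; exact: u.
- move=> W cW; rewrite setDE setIAC -setDE; apply: clopD => //; exact: h3.
- move=> W cW; rewrite setDE setIAC -setDE; apply: clopD => //; exact: h4.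
Qed.

Lemma homeo0 N M : homeo N M set0 set0.
Proof.
exists id, id; split=> //.
- by move=> V _; rewrite set0I; apply: clop0.
- by move=> V _; rewrite set0I; apply: clop0.
Qed.

Lemma homeo_union N M A B A' B' : homeo N M A B -> homeo N M A' B' ->
  A `&` A' = set0 -> B `&` B' = set0 -> homeo N M (A `|` A') (B `|` B').
Proof.
move=> [t [t' [h1 h2 h3 h4]]] [s [s' [k1 k2 k3 k4]]] dA dB.
have nA n : A n -> A' n -> False by move=> a a'; have : (A `&` A') n by []; rewrite dA.
have nB n : B n -> B' n -> False by move=> a a'; have : (B `&` B') n by []; rewrite dB.
exists (fun n => if `[< A n >] then t n else s n), (fun n => if `[< B n >] then t' n else s' n).
have e1 n : A n -> (if `[< A n >] then t n else s n) = t n by move=> a; case: asboolP.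
have e2 n : A' n -> (if `[< A n >] then t n else s n) = s n by move=> a; case: asboolP => // /nA /(_ a).
have f1 n : B n -> (if `[< B n >] then t' n else s' n) = t' n by move=> a; case: asboolP.
have f2 n : B' n -> (if `[< B n >] then t' n else s' n) = s' n by move=> a; case: asboolP => // /nB /(_ a).
split.
- move=> n [a|a]; first by rewrite (e1 n a); have [b e] := h1 n a; rewrite (f1 _ b); split=> //; left.
  by rewrite (e2 n a); have [b e] := k1 n a; rewrite (f2 _ b); split=> //; right.
- move=> n [a|a]; first by rewrite (f1 n a); have [b e] := h2 n a; rewrite (e1 _ b); split=> //; left.
  by rewrite (f2 n a); have [b e] := k2 n a; rewrite (e2 _ b); split=> //; right.
- move=> V cV; have := clopU (h3 V cV) (k3 V cV); congr clop; apply/seteqP; split=> n.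
    by move=> [[a v]|[a v]]; split; [left| |right|]; rewrite // /preimage /= ?(e1 n a) ?(e2 n a).
  by move=> [[a|a]]; rewrite /preimage /= ?(e1 n a) ?(e2 n a); [left|right].
- move=> V cV; have := clopU (h4 V cV) (k4 V cV); congr clop; apply/seteqP; split=> n.
    by move=> [[a v]|[a v]]; split; [left| |right|]; rewrite // /preimage /= ?(f1 n a) ?(f2 n a).
  by move=> [[a|a]]; rewrite /preimage /= ?(f1 n a) ?(f2 n a); [left|right].
Qed.

Section ConeHomeo.
Variables (N M s t : nat).
Hypotheses (s0 : 0 < s) (t0 : 0 < t) (vs : valid N s) (vt : valid M t) (lst_ : lab s = lab t).
Lemma app_valid w : [/\ 0 < app s w, 0 < app t w, lab (app s w) = lab (app t w) &
  valid N (app s w) = valid M (app t w)].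
Proof.
elim/last_ind: w => [|w a [a1 a2 a3 a4]]; first by rewrite vs vt.
rewrite !app_rcons !valid_snoc /lab !lst_snoc; split=> //.
by rewrite a4 /okc !eqn0Ngt a1 a2 /= a3.
Qed.
(** A cone meeting the cone of t either belongs to a prefix of t and contains all of it, or belongs
    to a node beyond t and is the translate of a cone beyond s. *)
Lemma cone_tr v w : coneb M v (app t w) = [&& 0 < v, valid M v & anc v t]
  || anc t v && coneb N (tr t s v) (app s w).
Proof.
have [vt'|nvt] := boolP (anc v t).
  have h : anc v (app t w) by apply: anc_trans vt' _; apply/app_anc; exists w.
  rewrite /coneb h andbT; case: (boolP (0 < v)) => v0 /=; last first.
    by move: v0; rewrite -eqn0Ngt => /eqP->; apply/esym/negbTE/negP => /andP[/anc0 e _]; have := t0; rewrite e.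
  by rewrite (valid_anc vt' vt).
rewrite !andbF /=; apply/idP/andP => [/and3P[v0 vv vn]|[tv]].
  have [//|tv] := anc_chain vn (proj2 (app_anc t (app t w)) (ex_intro _ w erefl)).
    by rewrite (negbTE nvt).
  split=> //; have [u e] := proj1 (app_anc _ _) tv; rewrite e trE.
  have [a1 _ _ a4] := app_valid u; rewrite /coneb a1 a4 -e vv /=; apply/anc_app/(anc_app t).
  by rewrite -e.
have [u e] := proj1 (app_anc _ _) tv; rewrite e trE => /and3P[_ vv /anc_app an].
by have [_ a1 _ a4] := app_valid u; rewrite /coneb a1 -a4 vv; apply/anc_app.
Qed.
Lemma cone_tr_clop V : clop (K M) V -> clop (K N) (cone N s `&` tr s t @^-1` V).
Proof.
(* The level must decide membership in the cone of s and in the translates of all cones with index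
   below m. *)
move=> [m [h1 h2]]; pose L := maxn s.+1 (\max_(v < m) (tr t s v).+1).
have sL : s < L by rewrite leq_max leqnn.
have vL v : v < m -> tr t s v < L.
  by move=> vm; rewrite leq_max; apply/orP; right; apply: (@leq_bigmax _ (fun v : 'I_m => (tr t s v).+1) (Ordinal vm)).
exists L; split=> [n n' /kapf_eqP h [c]|n /kapf0P h [c _]]; last first.
  by move: c; rewrite /cone /= h.
move=> hV; have c' : cone N s n' by rewrite /cone /= -h.
split=> //; move: hV; rewrite /preimage /=; apply: h1; apply/kapf_eqP => v vm.
have [_ _ /app_anc [w e]] := and3P c; have [_ _ /app_anc [w' e']] := and3P c'.
by rewrite e e' !trE !cone_tr -e -e' h // vL.
Qed.
Lemma cone_tr_mem n : cone N s n -> cone M t (tr s t n) /\ tr t s (tr s t n) = n.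
Proof.
move=> /and3P[_ vn /app_anc [w e]]; rewrite e !trE; split=> //.
by rewrite /cone /= /coneb t0 vt; apply/app_anc; exists w.
Qed.
End ConeHomeo.

(** The label of a nonempty node alone decides which continuations are valid, so exchanging the
    prefix is a homeomorphism. *)
Lemma homeo_cone N M s t : 0 < s -> 0 < t -> valid N s -> valid M t -> lab s = lab t ->
  homeo N M (cone N s) (cone M t).
Proof.
move=> s0 t0 vs vt e; exists (tr s t), (tr t s); split.
- exact: cone_tr_mem.
- exact: cone_tr_mem.
- exact: cone_tr_clop.
- exact: cone_tr_clop.
Qed.
End Homeo.

Section BackForth.
Variable lt : nat -> nat -> bool.
Local Notation K N := (kapF lt N).
Local Notation cone := (cone lt).
Local Notation coneb := (coneb lt).
Local Notation valid := (valid lt).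
Local Notation homeo := (homeo lt).
Hypothesis nacc0 : ~ Acc lt 0.
(** This is the form in which totality of the order is used. The clause on u keeps w inside the
    field of the order, as every accessible label of a valid nonempty node is by [lab_pred]. *)
Hypothesis acc_lt : forall l w, ~ Acc lt l -> Acc lt w -> (exists u, lt w u) -> lt w l.

Definition It N (A : set nat) := exists s, [/\ A s, 0 < s, valid N s & ~ Acc lt (lab s)].
Lemma It_sub N A B : A `<=` B -> It N A -> It N B.
Proof. by move=> h [s [a b c d]]; exists s; split=> //; apply: h. Qed.

Lemma nacc_pred l : ~ Acc lt l -> exists2 l', lt l' l & ~ Acc lt l'.
Proof.
move=> h; apply: contrapT => hn; apply: h; split=> l' hl; apply: contrapT => hl'.
by apply: hn; exists l'.
Qed.
Lemma lab_pred N v : 0 < v -> valid N v -> Acc lt (lab v) -> exists u, lt (lab v) u.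
Proof.
move=> v0 /validP /(_ v v0 (anc_refl v)); rewrite /okc; case: eqP => [_ /andP[/eqP e _]|_ h _].
  by rewrite /lab e.
by exists (lab (par v)).
Qed.
Lemma fresh_child N B s l : clop (K N) B -> B s -> 0 < s -> valid N s -> lt l (lab s) ->
  exists t, [/\ 0 < t, valid N t, lab t = l, cone N t `<=` B & ~ cone N t s].
Proof.
move=> cB Bs s0 vs ll; have [M hM] := clop_fresh cB Bs.
exists (snoc s (pairn l M)); split=> //.
- by rewrite valid_snoc vs /okc eqn0Ngt s0 /= p1_pair.
- by rewrite /lab lst_snoc p1_pair.
- move=> n /and3P[_ _]; apply: hM; apply: leq_trans (pairn_ge _ _); exact: leq_addr.
- by move=> /and3P[_ _ /anc_le]; rewrite leqNgt snoc_gt.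
Qed.

(* H lies in finitely many cones with accessible labels; by acc_lt, copies of these
   occur among the child cones of a node of B with inaccessible label. *)
Lemma embed N M H B : clop (K N) H -> ~ It N H -> clop (K M) B -> It M B ->
  exists V, [/\ clop (K M) V, V `<=` B, homeo N M H V & It M (B `\` V)].
Proof.
move=> cH nH cB tB; have [vs [h1 h2]] := clop_cover cH.
have {}h1 v : v \in vs -> [/\ 0 < v, valid N v & Acc lt (lab v)].
  move=> /h1 [a b c]; have [h|h] := EM (Acc lt (lab v)); first by split.
  by case: nH; exists v.
elim: vs H cH {nH} h1 h2 B cB tB => [|v vs IH] H cH h1 h2 B cB tB.
  have -> : H = set0 by apply/seteqP; split=> // n /h2 [v]; rewrite in_nil.
  exists set0; split=> //; [exact: clop0|exact: homeo0|by rewrite setD0].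
have [v0 vv av] := h1 v (mem_head _ _).
have [s [Bs s0 vs' ns]] := tB.
(* The copy of the cone of v is placed at a fresh child of s, so s survives in the remainder and
   serves for the next cone. *)
have [t [t0 vt lt_t tB' nts]] := fresh_child cB Bs s0 vs' (acc_lt ns av (lab_pred v0 vv av)).
have [V [cV hV _]] := homeo_split (homeo_cone v0 t0 vv vt (esym lt_t)) cH.
have cB' : clop (K M) (B `\` cone M t) by apply: clopD => //; apply: cone_clop.
have cH' : clop (K N) (H `\` cone N v) by apply: clopD => //; apply: cone_clop.
have [|||V2 [cV2 sV2 hV2 tV2]] := IH _ cH' _ _ _ cB'.
- by move=> u uv; apply: h1; rewrite in_cons uv orbT.
- move=> n [Hn nv]; have [u] := h2 n Hn; rewrite in_cons => /orP[/eqP-> vn|]; last by exists u.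
  by case: nv; rewrite /cone /= /coneb v0 vv.
- by exists s.
have -> : H = (cone N v `&` H) `|` (H `\` cone N v).
  apply/seteqP; split=> [n h|n [[]|[]]//]; have [c|c] := EM (cone N v n); [by left|by right].
exists ((cone M t `&` V) `|` V2); split.
- by apply: clopU => //; apply: clopI => //; apply: cone_clop.
- by move=> n [[/tB' //]|/sV2 []].
- apply: homeo_union => //.
    by apply/seteqP; split=> // n [[a _] [_ b]]; apply: b.
  by apply/seteqP; split=> // n [[a _] /sV2 [_ b]]; apply: b.
- by apply: It_sub tV2 => n [[a b] c]; split=> // -[[d _]|d]; [apply: b|apply: c].
Qed.

Definition rel N M A B := (It N A /\ It M B) \/ homeo N M A B.
Lemma rel_sym N M A B : rel N M A B -> rel M N B A.
Proof. by move=> [[a b]|/homeo_sym h]; [left|right]. Qed.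

(** If both parts of A are ill-founded, B is split along a fresh child cone of inaccessible label.
    If just one is, the other part is copied into B by [embed]. They cannot both be well-founded,
    since A contains a node of inaccessible label. *)
Lemma rel_step N M A B U : clop (K N) A -> clop (K M) B -> rel N M A B -> clop (K N) U ->
  exists V, [/\ clop (K M) V, rel N M (A `&` U) (B `&` V) & rel N M (A `\` U) (B `\` V)].
Proof.
move=> cA cB [[tA tB]|h] cU; last first.
  by have [V [cV h1 h2]] := homeo_split h cU; exists V; split=> //; right.
have [t1|n1] := EM (It N (A `&` U)); have [t2|n2] := EM (It N (A `\` U)).
- have [s [Bs s0 vs ns]] := tB; have [l ll nl] := nacc_pred ns.
  have [t [t0 vt e tB' nts]] := fresh_child cB Bs s0 vs ll.
  exists (cone M t); split; first exact: cone_clop.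
    left; split=> //; exists t; split=> //; last by rewrite e.
    by split; [apply: tB'|]; apply: cone_self.
  by left; split=> //; exists s.
- have [V [cV sV hV tV]] := embed (clopD cA cU) n2 cB tB.
  exists (B `\` V); split; first exact: clopD.
    by left; split=> //; apply: It_sub tV => n []; split.
  right; rewrite (_ : B `\` (B `\` V) = V) //; apply/seteqP; split=> [n [b h]|n v].
    by apply: contrapT => v; apply: h.
  by split; [exact: sV|move=> [_]].
- have [V [cV sV hV tV]] := embed (clopI cA cU) n1 cB tB.
  exists V; split=> //; last by left.
  by right; rewrite (_ : B `&` V = V) //; apply/seteqP; split=> [n []//|n v]; split=> //; apply: sV.
- have [s [As s0 vs ns]] := tA; have [u|u] := EM (U s).
    by case: n1; exists s.
  by case: n2; exists s.
Qed.

(** The listed pairs are the sets matched so far; each cell of the partition cut out by the first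
    components is related to its counterpart on the other side. *)
Fixpoint good N M (s : seq (set nat * set nat)) P Q : Prop :=
  if s is UV :: s then [/\ clop (K N) UV.1, clop (K M) UV.2,
    good N M s (P `&` UV.1) (Q `&` UV.2) & good N M s (P `\` UV.1) (Q `\` UV.2)]
  else [/\ clop (K N) P, clop (K M) Q & rel N M P Q].

Lemma good_sym N M s P Q : good N M s P Q -> good M N [seq (x.2, x.1) | x <- s] Q P.
Proof.
elim: s P Q => [|x s IH] P Q /=; first by move=> [a b c]; split=> //; apply: rel_sym.
by move=> [a b c d]; split=> //; apply: IH.
Qed.

Lemma good_ext N M s P Q U V V' : Q `&` V = Q `&` V' -> clop (K M) V' ->
  good N M (rcons s (U, V)) P Q -> good N M (rcons s (U, V')) P Q.
Proof.
move=> h cV'; elim: s P Q h => [|x s IH] P Q h /=.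
  move=> [a b c d]; split=> //; first by rewrite -h.
  rewrite (_ : Q `\` V' = Q `\` V) //; apply/seteqP; split=> n [q v]; split=> // v'; apply: v.
    by have [] : (Q `&` V') n by rewrite -h.
  by have [] : (Q `&` V) n by rewrite h.
move=> [a b c d]; split=> //; apply: IH => //.
  by rewrite setIAC h setIAC.
by rewrite !setDE setIAC h setIAC.
Qed.

Lemma good_step N M s P Q U : clop (K N) U -> good N M s P Q ->
  exists V, good N M (rcons s (U, V)) P Q.
Proof.
move=> cU; elim: s P Q => [|x s IH] P Q /=.
  move=> [a b c]; have [V [h1 h2 h3]] := rel_step a b c cU; exists V; split=> //; split=> //.
  - exact: (@clopI (K N)).
  - exact: (@clopI (K M)).
  - exact: (@clopD (K N)).
  - exact: (@clopD (K M)).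
move=> [a b /IH [V1 h1] /IH [V2 h2]].
have cl s' P' Q' V : good N M (rcons s' (U, V)) P' Q' -> clop (K M) V.
  by elim: s' P' Q' => [|y s' IH'] P' Q' /= [] // _ _ /IH'.
have c1 := cl _ _ _ _ h1; have c2 := cl _ _ _ _ h2.
(* The answers found on the two sides of x.2 are glued; by [good_ext] only their traces on the
   respective cells count. *)
have cV : clop (K M) ((V1 `&` x.2) `|` (V2 `\` x.2)) by apply: clopU; [apply: clopI|apply: clopD].
exists ((V1 `&` x.2) `|` (V2 `\` x.2)); split=> //.
  apply: good_ext h1 => //; apply/seteqP; split=> n.
    by move=> [[q y] v]; split=> //; left.
  by move=> [[q y] [[v _]|[_ //]]].
apply: good_ext h2 => //; apply/seteqP; split=> n.
  by move=> [[q y] v]; split=> //; right.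
by move=> [[q y] [[_ //]|[v _]]].
Qed.

(** Related cells are nonempty together, so a membership pattern realised on one side is realised on
    the other. *)
Lemma good_mem N M s P Q n : good N M s P Q -> P n ->
  exists2 m, Q m & forall i, i < size s -> (nth (set0, set0) s i).1 n <-> (nth (set0, set0) s i).2 m.
Proof.
elim: s P Q => [|x s IH] P Q /=.
  move=> [_ _ h] Pn; have [m Qm] : exists m, Q m.
    case: h => [[_ [m [Qm _ _ _]]]|[t [t' [h _ _ _]]]]; first by exists m.
    by have [? _] := h n Pn; exists (t n).
  by exists m.
move=> [_ _ h1 h2] Pn; have [u|u] := EM (x.1 n).
  have [m [q y] hm] := IH _ _ h1 (conj Pn u); exists m => // -[|i] //=; exact: hm.
have [m [q y] hm] := IH _ _ h2 (conj Pn u); exists m => // -[|i] //=; exact: hm.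
Qed.

Lemma back_forth N M P Q : good N M [::] P Q -> exists A B : nat -> set nat,
  [/\ forall k, clop (K N) (A k) /\ clop (K M) (B k),
      forall k, A k.*2 = cone N k, forall k, B k.*2.+1 = cone M k,
      forall k n, P n -> exists2 m, Q m & forall i, i < k -> A i n <-> B i m &
      forall k m, Q m -> exists2 n, P n & forall i, i < k -> A i n <-> B i m].
Proof.
move=> g0; pose T := {s | good N M s P Q}.
have step (kx : nat * T) : exists y : T, exists UV, sval y = rcons (sval kx.2) UV /\
    if odd kx.1 then UV.2 = cone M kx.1./2 else UV.1 = cone N kx.1./2.
  case: kx => k [s gs] /=; case: (odd k); last first.
    have [V h] := good_step (cone_clop lt N k./2) gs.
    by exists (exist (fun s => good N M s P Q) _ h), (cone N k./2, V).
  (* Odd stages exchange the two sides, so that the cones of both forests are eventually listed. *)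
  have [V h] := good_step (cone_clop lt M k./2) (good_sym gs).
  have h' : good N M (rcons s (V, cone M k./2)) P Q.
    have := good_sym h; rewrite map_rcons -map_comp /=.
    by rewrite (@eq_map _ _ _ id) ?map_id // => -[].
  by exists (exist (fun s => good N M s P Q) _ h'), (V, cone M k./2).
have [f hf] := choice step.
pose st := fix st k : T := if k is k'.+1 then f (k', st k') else exist (fun s => good N M s P Q) _ g0.
pose p k := last (set0, set0) (sval (st k.+1)).
have stE k : sval (st k) = mkseq p k.
  elim: k => // k IH; rewrite /mkseq -addn1 iotaD map_cat /= cats1 -/(mkseq p k) -IH add0n addn1 /=.
  by have [UV [e _]] := hf (k, st k); rewrite /p /= e last_rcons.
have pE' k : if odd k then (p k).2 = cone M k./2 else (p k).1 = cone N k./2.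
  by have [UV [e h]] := hf (k, st k); rewrite /p /= e last_rcons.
have cl s P' Q' i : good N M s P' Q' -> i < size s ->
    clop (K N) (nth (set0, set0) s i).1 /\ clop (K M) (nth (set0, set0) s i).2.
  elim: s P' Q' i => // y s IH P' Q' [|i] /= [a b c _] //; exact: IH c.
exists (fun k => (p k).1), (fun k => (p k).2); split.
- move=> k; have := cl _ _ _ k (svalP (st k.+1)); rewrite stE size_mkseq nth_mkseq //; exact.
- by move=> k; have := pE' k.*2; rewrite odd_double doubleK.
- by move=> k; have := pE' k.*2.+1; rewrite /= odd_double /= uphalf_double.
- move=> k n Pn; have [m Qm hm] := good_mem (svalP (st k)) Pn; exists m => // i ik.
  by have := hm i; rewrite stE size_mkseq nth_mkseq //; exact.
- move=> k m Qm; have [n Pn hn] := good_mem (good_sym (svalP (st k))) Qm; exists n => // i ik.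
  have := hn i; rewrite size_map stE size_mkseq (nth_map (set0, set0)) ?size_mkseq // nth_mkseq //=.
  by move=> /(_ ik) [a b]; split.
Qed.
End BackForth.

Section Whole.
Variable lt : nat -> nat -> bool.
Definition root i := snoc 0 (pairn 0 i).
Definition whole N : set nat := [set n | exists v, coneb lt N v n].
Lemma lab_root i : lab (root i) = 0. Proof. by rewrite /lab lst_snoc p1_pair. Qed.
Lemma valid_root N i : i < N -> valid lt N (root i).
Proof.
move=> iN; rewrite valid_snoc (_ : okc _ _ _ _) ?andbT; last by rewrite /okc eqxx !pE eqxx.
by apply/validP => u u0 /anc0 e; rewrite e in u0.
Qed.
Lemma cone_root N v n : coneb lt N v n -> exists2 i, i < N & coneb lt N (root i) n.
Proof.
move=> /and3P[v0 vv vn]; elim/ltn_ind: v v0 vv vn => v IH v0 vv vn.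
have [e|p0] := posnP (par v).
  move/validP: (vv) => /(_ v v0 (anc_refl v)); rewrite /okc e eqxx => /andP[/eqP a b].
  exists (p2 (lst v)) => //; rewrite /coneb valid_root //=.
  by rewrite /root -{2}a pair_p -{1}e snoc_eta.
apply: IH p0 _ (anc_trans (anc_par v) vn); first exact: par_lt.
exact: valid_anc (anc_par v) vv.
Qed.
Lemma whole_clop N : clop (kapF lt N) (whole N).
Proof.
pose L := \max_(i < N) (root i).+1.
have hL i : i < N -> root i < L by move=> iN; apply: (@leq_bigmax _ (fun i : 'I_N => (root i).+1) (Ordinal iN)).
exists L; split=> [n n' /kapf_eqP h|n /kapf0P h] [v /cone_root [i iN hi]].
  by exists (root i); rewrite -h // hL.
by move: hi; rewrite h // hL.
Qed.
Lemma whole_sub N U : clop (kapF lt N) U -> U `<=` whole N.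
Proof.
move=> [m [_ h]] n Un; have k0 : 0 < kapf lt N m n by case: posnP => // /h.
by have [_ c] := kapf_cone k0; exists (kapf lt N m n).
Qed.

Lemma matching_indicators N M : 0 < N -> 0 < M -> ~ Acc lt 0 ->
  (forall l w, ~ Acc lt l -> Acc lt w -> (exists u, lt w u) -> lt w l) ->
  exists A B : nat -> set nat,
  [/\ forall k, clop (kapF lt N) (A k) /\ clop (kapF lt M) (B k),
      forall v, exists k, A k = cone lt N v, forall v, exists k, B k = cone lt M v,
      forall k n, exists m, forall i, i < k -> A i n <-> B i m &
      forall k m, exists n, forall i, i < k -> A i n <-> B i m].
Proof.
move=> N0 M0 n0 hlt; have g0 : good lt N M [::] (whole N) (whole M).
  split; [exact: whole_clop|exact: whole_clop|left; split].
    exists (root 0); split; rewrite ?lab_root ?valid_root //; exists (root 0); apply: cone_self => //.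
    exact: valid_root.
  exists (root 0); split; rewrite ?lab_root ?valid_root //; exists (root 0); apply: cone_self => //.
  exact: valid_root.
have [A [B [h1 h2 h3 h4 h5]]] := back_forth n0 hlt g0.
(* The empty sequence lies in no cone and is the partner of every point outside the forest. *)
have z N' : ~ whole N' 0 by move=> [v /and3P[v0 _ /anc0 e]]; rewrite e in v0.
exists A, B; split=> //.
- by move=> v; exists v.*2.
- by move=> v; exists v.*2.+1.
- move=> k n; have [w|w] := EM (whole N n); first by have [m _ hm] := h4 k n w; exists m.
  by exists 0 => i _; have [a b] := h1 i; split=> [/(whole_sub a)|/(whole_sub b) /z].
- move=> k n; have [w|w] := EM (whole M n); first by have [m _ hm] := h5 k n w; exists m.
  by exists 0 => i _; have [a b] := h1 i; split=> [/(whole_sub a) /z|/(whole_sub b)].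
Qed.
End Whole.

Lemma anc_zero n : anc 0 n.
Proof.
elim/ltn_ind: n => -[|n] IH; first exact: anc_refl.
by rewrite anc_step IH // par_lt.
Qed.

(** * The reduction *)

Section KleeneBrouwer.
Variable T : nat -> bool.
Definition lexlt s t := bex s.+1 (fun u => bex t.+1 (fun v =>
  [&& 0 < u, 0 < v, anc u s, anc v t, par u == par v & lst u < lst v])).
(* The Kleene-Brouwer order: extensions come first. *)
Definition kb s t := [&& T s, T t, s != t & anc t s || lexlt s t].
Lemma lexltP s t : reflect (exists u v, [/\ 0 < u, 0 < v, anc u s, anc v t & par u = par v /\ lst u < lst v])
  (lexlt s t).
Proof.
apply: (iffP (bexP _ _)) => [[u _ /bexP [v _ /and5P[a b c d /andP[/eqP e f]]]]|[u [v [a b c d [e f]]]]].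
  by exists u, v.
exists u; first by rewrite ltnS anc_le.
by apply/bexP; exists v; [rewrite ltnS anc_le | rewrite a b c d e eqxx].
Qed.
Lemma kb_total s t : T s -> T t -> s <> t -> kb s t \/ kb t s.
Proof.
move=> Ts Tt /eqP st; rewrite /kb Ts Tt st eq_sym st /=.
suff [h|[h|[u [v [a b c d [e f]]]]]] : anc t s \/ anc s t \/ exists u v,
    [/\ 0 < u, 0 < v, anc u s, anc v t & par u = par v /\ lst u <> lst v].
- by left; rewrite h.
- by right; rewrite h.
- move/eqP: f; rewrite neq_ltn => /orP[f|f]; [left|right]; apply/orP; right; apply/lexltP.
    by exists u, v.
  by exists v, u.
elim/ltn_ind: s {Ts st} => s IH; have [->|s0] := posnP s; first by right; left; apply: anc_zero.
have [h|[h|[u [v [a b c d e]]]]] := IH _ (par_lt s0).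
- by left; apply: anc_trans h (anc_par _).
- have [e|ne] := eqVneq (par s) t; first by left; rewrite -e anc_par.
  have [a ha] := anc_child h (elimN eqP ne).
  have [e|na] := eqVneq a (lst s); first by right; left; rewrite e snoc_eta in ha.
  right; right; exists s, (snoc (par s) a); rewrite par_snoc lst_snoc; split=> //; first exact: anc_refl.
  by split=> // e; case/eqP: na.
- by right; right; exists u, v; split=> //; apply: anc_trans c (anc_par _).
Qed.

Hypothesis T0 : T 0.
Hypothesis Tpar : forall s u, anc u s -> T s -> T u.
Fixpoint initseg (f : nat -> nat) k := if k is k'.+1 then snoc (initseg f k') (f k') else 0.

Lemma path_not_acc f : (forall k, T (initseg f k)) -> ~ Acc kb 0.
Proof.
move=> hf; suff H v : Acc kb v -> forall k, v <> initseg f k by move=> /H /(_ 0).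
elim=> {}v _ IH k e; apply: (IH (initseg f k.+1) _ k.+1 erefl).
by rewrite e /kb !hf gtn_eqF ?snoc_gt ?anc_snocr.
Qed.

(** Together with the failure of [cone_acc] this is the invariant of the leftmost path: all to the
    left of s is accessible, but not all beyond s. *)
Definition left_acc s := forall r, T r -> lexlt r s -> Acc kb r.
Definition cone_acc s := forall r, T r -> anc s r -> Acc kb r.
Lemma lexlt_snoc r s a : lexlt r (snoc s a) -> lexlt r s \/ exists2 b, b < a & anc (snoc s b) r.
Proof.
move=> /lexltP [u [v [u0 v0 ur]]]; rewrite anc_snoc => /orP[/eqP->|vs] [e l]; last first.
  by left; apply/lexltP; exists u, v.
by right; exists (lst u); [rewrite lst_snoc in l | rewrite par_snoc in e; rewrite -e snoc_eta].
Qed.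
(** The least a whose child cone is not accessible keeps the invariant. If there were none, every
    predecessor of s would lie to the left or beyond a child, making s and then its whole cone
    accessible. *)
Lemma bar_step s : left_acc s -> ~ cone_acc s -> exists a, left_acc (snoc s a) /\ ~ cone_acc (snoc s a).
Proof.
move=> hl hc; apply: contrapT => hn; apply: hc.
have H a : cone_acc (snoc s a).
  elim/ltn_ind: a => a IH; apply: contrapT => h; apply: hn; exists a; split=> [r Tr /lexlt_snoc [|[b ba]]|]; last exact: h.
    exact: hl.
  exact: IH.
have As : Acc kb s.
  split=> r /and4P[Tr _ ne /orP[sr|]]; last exact: hl.
  by have [|a ha] := anc_child sr; [move=> e; rewrite e eqxx in ne | apply: H ha].
move=> r Tr sr; have [<-//|ne] := EM (s = r).
by have [a ha] := anc_child sr ne; apply: H ha.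
Qed.
Lemma not_acc_path : ~ Acc kb 0 -> exists f, forall k, T (initseg f k).
Proof.
move=> n0; pose S := {s | left_acc s /\ ~ cone_acc s}.
have g0 : left_acc 0 /\ ~ cone_acc 0.
  split=> [r _ /lexltP [u [v [_ v0 _ /anc0 e _]]]|h]; first by rewrite e in v0.
  by apply: n0; apply: h => //; apply: anc_refl.
have step (x : S) : exists y : S, exists a, sval y = snoc (sval x) a.
  case: x => s [h1 h2]; have [a h] := bar_step h1 h2.
  by exists (exist (fun s => left_acc s /\ ~ cone_acc s) _ h), a.
have [F hF] := choice step.
pose st k := iter k F (exist (fun s => left_acc s /\ ~ cone_acc s) _ g0).
exists (fun k => lst (sval (st k.+1))) => k.
have -> : initseg (fun k => lst (sval (st k.+1))) k = sval (st k).
  elim: k => //= k ->; have [a e] := hF (st k); rewrite -[F _]/(st k.+1) in e *.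
  by rewrite {1}e lst_snoc.
have [_ h] := svalP (st k); apply: contrapT => hT; apply: h => r Tr sr.
by case: hT; apply: Tpar sr Tr.
Qed.
Lemma kb_acc_lt l w : ~ Acc kb l -> Acc kb w -> (exists u, kb w u) -> kb w l.
Proof.
move=> nl aw [u /and4P[Tw _ _ _]].
have Tl : T l.
  apply: contrapT => h; apply: nl; split=> r /and4P[_ Tl _ _]; by case: h.
have wl : w <> l by move=> e; apply: nl; rewrite -e.
by have [//|lw] := kb_total Tw Tl wl; case: nl; apply: Acc_inv lw.
Qed.
End KleeneBrouwer.

(** * The tree of unrefuted initial segments *)

Section Tree.
Variable c : Defs.code.
Definition len s := natrec 0 (fun k r => (iter k par s != 0) + r) s.
(** The sequence s as a finite partial oracle in the coding of [ev]; entries are stored from the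
    end, hence the reversed index. *)
Definition nodeoracle s q := if q < len s then (lookup s (len s - q.+1)).+1 else 0.
(* No computation of c on <x, y> that queries only the sequence s rejects. *)
Definition unrefuted x s := bal (len s) (fun y => ev (nodeoracle s) (len s) c (pairn x y) != 1).
(** Closure under prefixes is built in, because the clock grows with the length and the test at s
    does not mention shorter clocks. *)
Definition tree x s := bal s.+1 (fun u => ~~ anc u s || unrefuted x u).
Lemma treeP x s : reflect (forall u, anc u s -> unrefuted x u) (tree x s).
Proof.
apply: (iffP (balP _ _)) => h u us; first by have := h u; rewrite ltnS anc_le // us; apply.
by case: (boolP (anc u s)) => //= /h.
Qed.
Lemma tree0 x : tree x 0.
Proof. by apply/treeP => u /anc0 ->; apply/balP. Qed.
Lemma tree_anc x s u : anc u s -> tree x s -> tree x u.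
Proof. by move=> us /treeP h; apply/treeP => v vu; apply: h; apply: anc_trans vu us. Qed.

Lemma iter_initseg f j k : iter j par (initseg f k) = initseg f (k - j).
Proof.
elim: j k => [|j IH] k; first by rewrite subn0.
by case: k => [|k]; rewrite iterSr; [rewrite [par _]/= -[0]/(initseg f 0) IH sub0n | rewrite par_snoc IH subSS].
Qed.
Lemma initseg_ge f k : k <= initseg f k.
Proof. by elim: k => //= k IH; apply: leq_ltn_trans IH (snoc_gt _ _). Qed.
Lemma len_initseg f k : len (initseg f k) = k.
Proof.
have H B : natrec 0 (fun j r => (iter j par (initseg f k) != 0) + r) B = minn B k.
  elim: B => [|B IH]; first by rewrite min0n.
  rewrite [LHS]/= IH iter_initseg; case: (ltnP B k) => Bk.
    have : initseg f (k - B) != 0 by rewrite -lt0n (leq_trans _ (initseg_ge _ _)) // subn_gt0.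
    by move=> ->; lia.
  have -> : k - B = 0 by lia.
  by rewrite /= add0n; lia.
by rewrite /len H; apply/minn_idPr/initseg_ge.
Qed.
Lemma nodeoracle_initseg f k q : nodeoracle (initseg f k) q = if q < k then (f q).+1 else 0.
Proof.
rewrite /nodeoracle len_initseg; case: ltnP => // qk.
by rewrite /lookup iter_initseg (_ : k - (k - q.+1) = q.+1) ?lst_snoc //; lia.
Qed.

Variable P : nat -> (nat -> nat) -> nat -> bool.
Hypothesis hc : forall x f y, runs f c (pairn x y) (P x f y).
(** A rejecting computation uses a finite part of f, so a long initial segment refutes it;
    conversely a refuting segment of f is sound for f. *)
Lemma tree_path x f : (forall k, tree x (initseg f k)) <-> forall y, P x f y.
Proof.
split=> [h y|h k].
  apply: contrapT => /negP/negbTE hP; have hr := hc x f y; rewrite hP in hr.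
  (* Length B suffices for the clock and the queries, and length y.+1 brings y within the range that
     [unrefuted] tests. *)
  have [B hB] := ev_complete hr; pose s := maxn B y.+1.
  have /treeP /(_ _ (anc_refl _)) /balP := h s.
  rewrite len_initseg => /(_ y); rewrite /s leq_max leqnn orbT => /(_ isT) /eqP; apply.
  by apply: hB => [|q qs]; [apply: leq_maxl | rewrite nodeoracle_initseg qs].
apply/treeP => u /ancP [j <-]; rewrite iter_initseg; apply/balP => y _; rewrite len_initseg.
apply/negP => /eqP e.
have hr : runs f c (pairn x y) 0.
  apply: ev_sound e => q v; rewrite nodeoracle_initseg; case: ifP => // _ []; exact.
by have := runs_det hr (hc x f y); rewrite h.
Qed.

Definition tkb x := kb (tree x).
Lemma tree_acc x : ~ Acc (tkb x) 0 <-> exists f, forall y, P x f y.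
Proof.
split=> [/(not_acc_path (tree0 x) (@tree_anc x)) [f hf]|[f hf]]; first by exists f; apply/tree_path.
by apply: (@path_not_acc _ f); apply/tree_path.
Qed.

Lemma cmp_len F : cmp F -> cmp (fun f z => len (F f z)).
Proof.
apply: (@cmp_comp (fun f z => len z)); rewrite /len; apply: (@cmp_rec (fun _ _ => 0) (fun f z k r => (iter k par z != 0) + r)); by cmp.
Qed.
Lemma cmp_unrefuted : cmp (fun f z => unrefuted (p1 z) (p2 z)).
Proof.
have cl := cmp_len; rewrite /unrefuted.
apply: (@cmp_bal (fun f z y => ev (nodeoracle (p2 z)) (len (p2 z)) c (pairn (p1 z) y) != 1)); last by apply: cl; cmp.
apply: cmp_not; apply: cmp_eq; last by cmp.
apply: (@cmp_ext (fun f z => (fun g w => ev (fun q => g q) (p1 w) c (p2 w)) (fun q => nodeoracle (p2 (p1 z)) q)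
  (pairn (len (p2 (p1 z))) (pairn (p1 (p1 z)) (p2 z))))); first by move=> f z; rewrite /= !pE.
apply: (@cmp_subst _ (fun f z q => nodeoracle (p2 (p1 z)) q) _ (cmp_evS c)).
  rewrite /nodeoracle; apply: cmp_if; [apply: cmp_leq; [by cmp|by apply: cl; cmp]| |by cmp].
  apply: cmp_S; apply: cmp_lookup; first by cmp.
  by apply: cmp_sub; [apply: cl; cmp | cmp].
by apply: cmp_pair; [apply: cl; cmp | cmp].
Qed.
Lemma cmp_tree X S : cmp X -> cmp S -> cmp (fun f z => tree (X f z) (S f z)).
Proof.
apply: (@cmp_app2 (fun x s => tree x s)); rewrite /tree.
apply: (@cmp_bal (fun f z u => ~~ anc u (p2 z) || unrefuted (p1 z) u)); last by cmp.
apply: cmp_or; first by cmp.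
by apply: (@cmp_comp2 (fun f x u => unrefuted x u)); [exact: cmp_unrefuted | cmp | cmp].
Qed.
Lemma cmp_lexlt S S' : cmp S -> cmp S' -> cmp (fun f z => lexlt (S f z) (S' f z)).
Proof.
apply: (@cmp_app2 (fun s t => lexlt s t)); rewrite /lexlt.
apply: (@cmp_bex (fun f z u => bex (p2 z).+1 (fun v =>
  [&& 0 < u, 0 < v, anc u (p1 z), anc v (p2 z), par u == par v & lst u < lst v]))); last by cmp.
apply: (@cmp_bex (fun f z v => [&& 0 < (p2 z), 0 < v, anc (p2 z) (p1 (p1 z)), anc v (p2 (p1 z)),
  par (p2 z) == par v & lst (p2 z) < lst v])); by cmp.
Qed.
Lemma cmp_tkb X S S' : cmp X -> cmp S -> cmp S' -> cmp (fun f z => tkb (X f z) (S f z) (S' f z)).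
Proof.
apply: (@cmp_comp3 (fun f x s t => tkb x s t)); rewrite /tkb /kb.
apply: cmp_and; first by apply: cmp_tree; cmp.
apply: cmp_and; first by apply: cmp_tree; cmp.
apply: cmp_and; first by cmp.
by apply: cmp_or; [cmp | apply: cmp_lexlt; cmp].
Qed.

Section ForestCmp.
Variable N : nat.
Lemma cmp_valid X V : cmp X -> cmp V -> cmp (fun f z => valid (tkb (X f z)) N (V f z)).
Proof.
apply: (@cmp_app2 (fun x v => valid (tkb x) N v)); rewrite /valid.
apply: (@cmp_bal (fun f z u => [|| u == 0, ~~ anc u (p2 z) | okc (tkb (p1 z)) N (par u) (lst u)])); last by cmp.
apply: cmp_or; first by cmp.
apply: cmp_or; first by cmp.
rewrite /okc; apply: cmp_ifb; [by cmp | by cmp |].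
by rewrite /lab; apply: cmp_tkb; cmp.
Qed.
Lemma cmp_coneb X V W : cmp X -> cmp V -> cmp W -> cmp (fun f z => coneb (tkb (X f z)) N (V f z) (W f z)).
Proof.
move=> hX hV hW; rewrite /coneb; apply: cmp_and; first by cmp.
by apply: cmp_and; [apply: cmp_valid | cmp].
Qed.

Definition conevar x n i := if coneb (tkb x) N i n then gone else 0.
(** The squared norm is a finite maximum: the variables of p have indices at most p, and every
    pattern of membership in the cones up to p is realised by a point at most p. *)
Definition nsq x p := natrec 0 (fun n r =>
  if rle r (gn2 (evalp (conevar x n) p)) then gn2 (evalp (conevar x n) p) else r) p.+1.
Lemma cmp_nsq X V : cmp X -> cmp V -> cmp (fun f z => nsq (X f z) (V f z)).
Proof.
apply: (@cmp_app2 (fun x p => nsq x p)); rewrite /nsq.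
have h : cmp (fun f z => gn2 (evalp (conevar (p1 (p1 z)) (p1 (p2 z))) (p2 (p1 z)))).
  apply: cmp_gn2; apply: (@cmp_evalp (fun f z i => conevar (p1 (p1 z)) (p1 (p2 z)) i)); last by cmp.
  by rewrite /conevar; apply: cmp_if; [apply: cmp_coneb; cmp | cmp | cmp].
apply: (@cmp_rec (fun _ _ => 0) (fun f z n r =>
  if rle r (gn2 (evalp (conevar (p1 z) n) (p2 z))) then gn2 (evalp (conevar (p1 z) n) (p2 z)) else r)).
- by cmp.
- by apply: cmp_if => //; [apply: cmp_rle; [cmp | exact: h] | cmp].
- by cmp.
Qed.
End ForestCmp.
End Tree.

(* an inverse of a for positive values of a only *)
Definition rinv a := mkr (rd a) 0 (rp a - rq a).-1.
(* Newton iteration for the square root of M, strictly decreasing. *)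
Definition rsqrt M k := iter k (fun r => rmul (reps 1) (radd r (rmul M (rinv r)))) (radd M (reps 0)).
Lemma cmp_rsqrt A B : cmp A -> cmp B -> cmp (fun f z => rsqrt (A f z) (B f z)).
Proof.
apply: (@cmp_app2 (fun M k => rsqrt M k)); rewrite /rsqrt.
apply: (@cmp_iter (fun f z r => rmul (reps 1) (radd r (rmul (p1 z) (rinv r))))); last 2 first.
- by cmp.
- by apply: cmp_radd; [cmp | apply: cmp_reps; cmp].
apply: cmp_rmul; first by apply: cmp_reps; cmp.
apply: cmp_radd; first by cmp.
apply: cmp_rmul; first by cmp.
rewrite /rinv; apply: cmp_mkr; [apply: cmp_rd; cmp | cmp |].
by apply: cmp_pred; apply: cmp_sub; [apply: cmp_rp; cmp | apply: cmp_rq; cmp].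
Qed.

(** The argument x is supplied by a constant program, whose number is computed from x by
    recursion. *)
Lemma s_m_n (H : nat -> nat -> nat) : cmp (fun f z => H (p1 z) (p2 z)) ->
  exists e : nat -> nat, cmp (fun f x => e x) /\ forall x y, phi (e x) y (H x y).
Proof.
move=> [c0 h0]; pose cst n := iter n (CComp CSucc) CZero.
have hcst f n y : runs f (cst n) y n.
  by elim: n => [|n IH]; [exact: runs_zero | apply: runs_comp IH _; apply: runs_succ].
pose num n := natrec (pairn 0 0) (fun _ r => pairn 6 (pairn (pairn 1 0) r)) n.
have ecst n : code_num (cst n) = num n by elim: n => //= n ->.
pose C x := CComp c0 (CPair (cst x) (CPair CFst CSnd)).
exists (fun x => code_num (C x)); split.
  apply: (@cmp_ext (fun f x => pairn 6 (pairn (code_num c0) (pairn 5 (pairn (num x)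
    (pairn 5 (pairn (code_num CFst) (code_num CSnd)))))))); first by move=> f x; rewrite /= ecst.
  have cn : cmp (fun f x => num x).
    rewrite /num; apply: (@cmp_rec (fun _ _ => pairn 0 0) (fun _ _ _ r => pairn 6 (pairn (pairn 1 0) r))); by cmp.
  by cmp.
move=> x y; exists (C x) => //; apply: (@runs_comp _ _ _ _ (pairn x y)).
  apply: runs_pair; first exact: hcst.
  have := runs_pair (runs_fst (fun=> 0) (p1 y) (p2 y)) (runs_snd (fun=> 0) (p1 y) (p2 y)).
  by rewrite pair_p; apply.
by have := h0 (fun=> 0) (pairn x y); rewrite !pE.
Qed.

Local Open Scope ring_scope.

(** * Projections, clopen sets and isomorphism *)

Section Indicators.
Variables (R : realType).
Local Notation C := R[i].
Section Ind.
Variable K : kappa.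
Definition indf (U : set nat) : nat -> C := fun n => (`[< U n >])%:R.
Lemma indf_Sk U : clop K U -> Sk K (indf U).
Proof.
move=> [m [h1 h2]]; apply: (@Fk_Sk R K m); split=> [n n' e|n e]; rewrite /indf.
  by congr (_%:R); congr nat_of_bool; apply: asbool_equiv_eq; split; apply: h1.
by case: asboolP => // /(h2 n e).
Qed.
Definition ind U : Alg R K := if pselect (clop K U) is left h then @mkf R (FA_S R K) _ (indf_Sk h) else 0.
Lemma fv_ind U n : clop K U -> fv (ind U) n = (`[< U n >])%:R.
Proof. by rewrite /ind; case: pselect. Qed.

Definition supp1 (x : Alg R K) : set nat := [set n | fv x n = 1].
Lemma proj_bool (x : Alg R K) n : cs_mul x x = x -> fv x n = (`[< supp1 x n >])%:R.
Proof.
move=> hx; case: asboolP => [//|h].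
have : fv x n * (fv x n - 1) = 0 by rewrite mulrBr mulr1 -fvM hx subrr.
by move/eqP; rewrite mulf_eq0 subr_eq0 => /orP[/eqP//|/eqP].
Qed.
Lemma proj_clop (x : Alg R K) : cs_mul x x = x -> clop K (supp1 x).
Proof.
(* A simple function within 1/3 of a function with values 0 and 1 has modulus above 1/3 exactly
   where the latter is 1. *)
move=> hx; have e3 : 0 < 3^-1 :> R by rewrite invr_gt0.
have [m [y [[h1 h2] hy]]] := (fvP x : Sk K (fv x)) _ e3; exists m.
have c n : supp1 x n <-> ~ cn (y n) <= 3^-1.
  have := hy n; rewrite (proj_bool n hx); case: asboolP => s; split=> // h; last first.
    by case: h; rewrite -cnN -sub0r; move: H; rewrite /=.
  move=> h'; have := cnD (1 - y n) (y n); rewrite subrK cn1; move: h h' => /=; lra.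
split=> [n n' e /c h|n e /c h]; first by apply/c; rewrite -(h1 n n').
by apply: h; rewrite (h2 n e) cn0 ltW.
Qed.
Lemma proj_ind (x : Alg R K) : cs_mul x x = x -> x = ind (supp1 x).
Proof. by move=> hx; apply: fv_inj => n; rewrite (fv_ind _ (proj_clop hx)) proj_bool. Qed.
Lemma ind_proj U : clop K U -> cs_mul (ind U) (ind U) = ind U.
Proof. by move=> cU; apply: fv_inj => n; rewrite fvM fv_ind //; case: asboolP; rewrite ?mulr1 ?mulr0. Qed.
Lemma supp_ind U : clop K U -> supp1 (ind U) = U.
Proof.
move=> cU; apply/seteqP; split=> n; rewrite /supp1 /= fv_ind //; case: asboolP => // _ /eqP.
by rewrite eq_sym oner_eq0.
Qed.
Lemma indI U V : clop K U -> clop K V -> ind (U `&` V) = cs_mul (ind U) (ind V).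
Proof.
move=> cU cV; apply: fv_inj => n; rewrite fvM !fv_ind //; last exact: clopI.
rewrite -natrM mulnb; congr (_%:R); congr nat_of_bool.
by apply/asboolP/andP => [[a b]|[/asboolP a /asboolP b]]; split=> //; apply/asboolP.
Qed.
Lemma indD U V : clop K U -> clop K V -> ind (U `\` V) = ind U - cs_mul (ind U) (ind V).
Proof.
move=> cU cV; apply: fv_inj => n; rewrite fvD fvN fvM !fv_ind //; last exact: clopD.
have [u|u] := EM (U n); have [v|v] := EM (V n).
- by rewrite (asboolT u) (asboolT v) asboolF ?mulr1 ?subrr // => -[].
- by rewrite (asboolT u) (asboolF v) asboolT ?mulr0 ?subr0.
- by rewrite (asboolF u) (asboolT v) asboolF ?mul0r ?subrr // => -[].
- by rewrite (asboolF u) (asboolF v) asboolF ?mul0r ?subrr // => -[].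
Qed.
Lemma ind0 : ind set0 = 0.
Proof. by apply: fv_inj => n; rewrite fv_ind ?fv0 ?asboolF //; apply: clop0. Qed.
Lemma supp0 : supp1 0 = set0.
Proof.
by apply/seteqP; split=> // n; rewrite /supp1 /= fv0 => /eqP; rewrite eq_sym oner_eq0.
Qed.
End Ind.

Lemma iso_clop (K K' : kappa) : star_isomorphic (Alg R K) (Alg R K') -> exists F : set nat -> set nat,
  [/\ forall U, clop K U -> clop K' (F U),
      forall U V, clop K U -> clop K V -> F (U `&` V) = F U `&` F V,
      forall U V, clop K U -> clop K V -> F (U `\` V) = F U `\` F V,
      F set0 = set0 & forall V, clop K' V -> exists2 U, clop K U & F U = V].
Proof.
move=> [h hh /(star_iso_inv hh) [g [hg gh hK]]]; exists (fun U => supp1 (h (ind K U))).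
have P U : clop K U -> cs_mul (h (ind K U)) (h (ind K U)) = h (ind K U).
  by move=> cU; rewrite -(homM hh) ind_proj.
split.
- by move=> U cU; apply/proj_clop/P.
- move=> U V cU cV; rewrite -[RHS](@supp_ind K'); last by apply: clopI; apply/proj_clop/P.
  by rewrite !indI // ?(homM hh) -?proj_ind //; try (by apply/proj_clop/P); apply: P.
- move=> U V cU cV; rewrite -[RHS](@supp_ind K'); last by apply: clopD; apply/proj_clop/P.
  by rewrite !indD // ?(homB hh) ?(homM hh) -?proj_ind //; try (by apply/proj_clop/P); apply: P.
- by rewrite ind0 (hom0 hh) supp0.
- move=> V cV; have hx : cs_mul (g (ind K' V)) (g (ind K' V)) = g (ind K' V).
    by rewrite -(homM hg) ind_proj.
  exists (supp1 (g (ind K' V))); first exact: proj_clop.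
  by rewrite -proj_ind // hK supp_ind.
Qed.

Lemma not_isomorphic (lt : nat -> nat -> bool) : Acc lt 0%N ->
  ~ star_isomorphic (Alg R (kapF lt 1)) (Alg R (kapF lt 2)).
Proof. by move=> acc /iso_clop [F [h1 h2 h3 h4 h5]]; exact: (not_iso_clop acc h1 h2 h3 h4). Qed.

(** Induction on the level: passing from m to m.+1, the cone of m becomes the class m and is removed
    from every other class, which a polynomial in the indicators expresses. *)
Lemma pres_cones (lt : nat -> nat -> bool) N (A : nat -> set nat) :
  (forall k, clop (kapF lt N) (A k)) -> (forall v, exists k, A k = cone lt N v) ->
  is_presentation (fun k => ind (kapF lt N) (A k)).
Proof.
move=> cA hA; apply: pres_ind => m c c0 eps e0.
suff [p hp] : exists p, forall n,
    cval (fun i => fv (ind (kapF lt N) (A i)) n) p = (kapf lt N m n == c)%:R.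
  by exists p => n; rewrite hp subrr cn0 ltW.
elim: m c c0 => [|m IH] c c0.
  exists (PScale 0 (PVar 0)) => n /=; rewrite (gv0 R) mul0r.
  by case: eqP => // e; rewrite -e in c0.
have [k hk] := hA m; have ek n : fv (ind (kapF lt N) (A k)) n = (coneb lt N m n)%:R.
  by rewrite fv_ind // hk; congr (_%:R); congr nat_of_bool; apply: asboolb.
have [e|ne] := eqVneq c m.
  exists (PVar k) => n /=; rewrite ek e; case: ifP => _; first by rewrite eqxx.
  by rewrite ltn_eqF // kapf_lt // -e.
have [p hp] := IH c c0.
exists (PAdd p (PScale (gneg gone) (PMul p (PVar k)))) => n /=.
rewrite hp ek gv_gneg gv_gone; case: (coneb lt N m n); last by rewrite !mulr0 addr0.
by rewrite mulr1 mulN1r subrr eq_sym (negbTE ne).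
Qed.

Lemma cval_local (z z' : nat -> C) p : (forall i, (i <= star_poly_num p)%N -> z i = z' i) -> cval z p = cval z' p.
Proof.
have l x y : (x <= pairn x y)%N by apply: leq_trans (pairn_ge _ _); apply: leq_addl.
have r x y : (y <= pairn x y)%N by apply: leq_trans (pairn_ge _ _); apply: leq_addr.
elim: p => [i|p hp q hq|p hp q hq|p hp|k p hp] /= h; first exact: h.
- rewrite hp ?hq // => i hi; apply: h; apply: (leq_trans hi); apply: leq_trans (r _ _);
  [exact: r | exact: l].
- rewrite hp ?hq // => i hi; apply: h; apply: (leq_trans hi); apply: leq_trans (r _ _);
  [exact: r | exact: l].
- by rewrite hp // => i hi; apply: h; apply: (leq_trans hi).
- by rewrite hp // => i hi; apply: h; apply: (leq_trans hi); apply: leq_trans (r _ _).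
Qed.

(** The norm of a *-polynomial in indicators depends only on which membership patterns of finitely
    many of them occur, and [matching_indicators] makes these agree. *)
Lemma isomorphic (lt : nat -> nat -> bool) : ~ Acc lt 0%N ->
  (forall l w, ~ Acc lt l -> Acc lt w -> (exists u, lt w u) -> lt w l) ->
  star_isomorphic (Alg R (kapF lt 1)) (Alg R (kapF lt 2)).
Proof.
move=> n0 hlt.
have [A [B [cl hA hB hAB hBA]]] := @matching_indicators lt 1 2 isT isT n0 hlt.
have cA k : clop (kapF lt 1) (A k) by case: (cl k).
have cB k : clop (kapF lt 2) (B k) by case: (cl k).
have pA := proj1 (presP _) (pres_cones cA hA).
have pB := proj1 (presP _) (pres_cones cB hB).
have le (K K' : kappa) (a : nat -> Alg R K) (b : nat -> Alg R K') p :
    (forall k n, exists m, forall i, (i < k)%N -> fv (a i) n = fv (b i) m) ->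
    cs_norm (star_poly_val a p) <= cs_norm (star_poly_val b p).
  move=> h; apply: alg_norm_le => n; have [m hm] := h (star_poly_num p).+1 n.
  apply: le_trans (alg_norm_ub _ m); rewrite !fv_poly.
  by rewrite (@cval_local _ (fun i => fv (b i) m)) // => i; apply: hm.
have [|u [hu bu _]] := norm_equal_iso pA pB; last by exists u.
move=> p; apply/le_anti/andP; split; apply: le => k n.
  have [m hm] := hAB k n; exists m => i /hm h; rewrite !fv_ind //.
  by congr (_%:R); congr nat_of_bool; apply: asbool_equiv_eq.
have [m hm] := hBA k n; exists m => i /hm h; rewrite !fv_ind //.
by congr (_%:R); congr nat_of_bool; apply: asbool_equiv_eq; split=> /h.
Qed.

Lemma indexes_norm (A B : cstar_alg R) (a : nat -> A) (b : nat -> B) e p :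
  indexes a e -> indexes b e -> cs_norm (star_poly_val a p) = cs_norm (star_poly_val b p).
Proof.
move=> /(_ p) [r [h1 _ h3]] /(_ p) [r' [h1' _ h3']].
have e' : r = r' by apply/funext => k; apply: phi_det (h1 k) (h1' k).
rewrite e' in h3; exact: (cvg_unique _ h3 h3').
Qed.
Lemma iso_trans (A B D : cstar_alg R) : star_isomorphic A B -> star_isomorphic B D -> star_isomorphic A D.
Proof.
move=> [h hh bh] [g hg bg]; exists (g \o h); first exact: star_hom_comp.
exact: bij_comp.
Qed.
Lemma indexes_isomorphic (A B : cstar_alg R) (a : nat -> A) (b : nat -> B) e :
  is_presentation a -> is_presentation b -> indexes a e -> indexes b e -> star_isomorphic A B.
Proof.
move=> /presP pa /presP pb ia ib.
have [|u [hu bu _]] := norm_equal_iso pa pb; last by exists u.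
by move=> p; apply: indexes_norm ia ib.
Qed.

(** An index determines all norms of generated points, hence its algebra up to isomorphism; any
    presentations with the given indices may be used to decide membership. *)
Lemma iso_problem_indexed (K K' : kappa) (a : nat -> Alg R K) (b : nat -> Alg R K') e0 e1 :
  is_presentation a -> indexes a e0 -> is_presentation b -> indexes b e1 ->
  comm_AF_iso_problem R (e0, e1) <-> star_isomorphic (Alg R K) (Alg R K').
Proof.
move=> pa ia pb ib; split=> [[A [B [a' [b' [_ _ [pa' ia'] [pb' ib'] hAB]]]]]|h].
  apply: iso_trans (indexes_isomorphic pa pa' ia ia') _.
  exact: iso_trans hAB (indexes_isomorphic pb' pb ib' ib).
exists (Alg R K), (Alg R K'), a, b; split=> //; split; try exact: alg_comm; exact: Alg_AF.
Qed.
End Indicators.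

Section Newton.
Variable R : realType.
Local Notation rv := (rv R).
Lemma rv_rinv a : 0 < rv a -> rv (rinv a) = (rv a)^-1.
Proof.
rewrite (rvE R) /rinv rv_mkr => h.
have d0 : 0 < (rd a)%:R :> R by rewrite ltr0n.
have pq : (rq a < rp a)%N.
  by rewrite pmulr_lgt0 ?invr_gt0 // subr_gt0 ltr_nat in h.
rewrite subr0 prednK ?subn_gt0 // natrB ?(ltnW pq) //.
by rewrite invf_div.
Qed.
Lemma rsqrtS M k : rsqrt M k.+1 = rmul (reps 1) (radd (rsqrt M k) (rmul M (rinv (rsqrt M k)))).
Proof. by []. Qed.

Variables (M : nat) (s : R).
Hypotheses (s0 : 0 <= s) (sM : rv M = s ^+ 2).
Lemma rv_rsqrtS k : s < rv (rsqrt M k) ->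
  rv (rsqrt M k.+1) = (rv (rsqrt M k) + s ^+ 2 / rv (rsqrt M k)) / 2.
Proof.
move=> h; rewrite rsqrtS rv_rmul rv_reps rv_radd rv_rmul sM rv_rinv; last exact: le_lt_trans h.
by rewrite mulrC.
Qed.
(** The new error is (r - s)^2 / (2r). It stays positive and is at most half the old one, also for s
    = 0, the norm of a polynomial that vanishes; strict decrease is what [indexes] requires. *)
Lemma newton_step (r : R) : s < r -> [/\ s < (r + s ^+ 2 / r) / 2, (r + s ^+ 2 / r) / 2 < r &
  (r + s ^+ 2 / r) / 2 - s <= (r - s) / 2].
Proof.
move=> sr; have r0 : 0 < r by apply: le_lt_trans sr.
have rn : r != 0 by rewrite gt_eqF.
have e : (r + s ^+ 2 / r) / 2 - s = (r - s) ^+ 2 / (2 * r) by field.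
have e' : r - (r + s ^+ 2 / r) / 2 = (r - s) * (r + s) / (2 * r) by field.
split.
- by rewrite -subr_gt0 e divr_gt0 ?exprn_gt0 ?mulr_gt0 // subr_gt0.
- by rewrite -subr_gt0 e' divr_gt0 // mulr_gt0 ?subr_gt0 // ltr_wpDr.
- rewrite e ler_pdivrMr ?mulr_gt0 // expr2; have -> : (r - s) / 2 * (2 * r) = (r - s) * r by field.
  by rewrite ler_wpM2l ?subr_ge0 ?(ltW sr) // gerDl oppr_le0.
Qed.
Lemma rsqrt_gt k : s < rv (rsqrt M k).
Proof.
elim: k => [|k IH]; last by rewrite rv_rsqrtS //; case: (newton_step IH).
(* The starting value s^2 + 1 exceeds s because s^2 - s + 1/4 is a square. *)
rewrite /rsqrt /= rv_radd sM rv_reps invr1; have := sqr_ge0 (s - 2^-1).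
have -> : (s - 2^-1) ^+ 2 = s ^+ 2 - s + 4^-1 by field.
lra.
Qed.
Lemma rsqrt_dec k : rv (rsqrt M k.+1) < rv (rsqrt M k).
Proof. by rewrite rv_rsqrtS ?rsqrt_gt //; case: (newton_step (rsqrt_gt k)). Qed.
Lemma rsqrt_close k : rv (rsqrt M k) - s <= (rv (rsqrt M 0) - s) * 2^-1 ^+ k.
Proof.
elim: k => [|k IH]; first by rewrite expr0 mulr1.
rewrite rv_rsqrtS ?rsqrt_gt //; have [_ _ h] := newton_step (rsqrt_gt k).
by apply: (le_trans h); rewrite exprSr mulrA ler_wpM2r // invr_ge0.
Qed.
Lemma rsqrt_cvg : (ratr (rat_of_nat (rsqrt M k)) : R) @[k --> \oo] --> s.
Proof.
apply/cvg_ballP => d d0; have c0 : 0 < rv (rsqrt M 0) - s by rewrite subr_gt0 rsqrt_gt.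
have [k hk] := half_pow_small (divr_gt0 d0 c0); rewrite ltr_pdivlMr // mulrC in hk.
exists k => // k' /= kk'; rewrite -ball_normE /= distrC -/(rv _) ger0_norm; last first.
  by rewrite subr_ge0 ltW // rsqrt_gt.
apply: le_lt_trans (rsqrt_close k') (le_lt_trans _ hk); rewrite ler_wpM2l ?(ltW c0) //.
by rewrite ler_wiXn2l // ?invr_ge0 // invf_le1 // ler1n.
Qed.
Lemma rsqrt_decreasing : decreasing_seq (fun k => rat_of_nat (rsqrt M k)).
Proof. by apply/decreasing_seqP => k; rewrite ltNge (rn_le R) -ltNge rsqrt_dec. Qed.
End Newton.

Section ForestIndex.
Variables (R : realType) (c : Defs.code) (x N : nat).
Local Notation lt := (tkb c x).
Local Notation a := (fun v => ind R (kapF lt N) (cone lt N v)).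
Lemma conevar_val n p : cn (fv (star_poly_val a p) n) ^+ 2 =
  rv R (gn2 (evalp (conevar c N x n) (star_poly_num p))).
Proof.
rewrite rv_gn2 gv_evalp fv_poly; congr (cn _ ^+ 2); apply: cval_ext => i /=.
rewrite fv_ind ?asboolb; last exact: cone_clop.
by rewrite /conevar; case: coneb; rewrite ?gv_gone ?gv0.
Qed.
Lemma nsq_norm p : rv R (nsq c N x (star_poly_num p)) = cs_norm (star_poly_val a p) ^+ 2.
Proof.
pose P := star_poly_num p; pose h n := cn (fv (star_poly_val a p) n).
pose g := natrec 0 (fun n r => if rle r (gn2 (evalp (conevar c N x n) P))
  then gn2 (evalp (conevar c N x n) P) else r).
have H B : (rv R (g B) = 0 \/ exists n, rv R (g B) = h n ^+ 2) /\
    0 <= rv R (g B) /\ forall n, (n < B)%N -> h n ^+ 2 <= rv R (g B).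
  elim: B => [|B [h1 [h2 h3]]]; first by rewrite /= rv0; split; [left|split].
  have -> : g B.+1 = if rle (g B) (gn2 (evalp (conevar c N x B) P)) then gn2 (evalp (conevar c N x B) P) else g B.
    by [].
  rewrite (rleP R) -conevar_val -/(h B).
  have [l|l] := leP (rv R (g B)) (h B ^+ 2).
    rewrite -conevar_val -/(h B); split; [by right; exists B | split; first exact: sqr_ge0].
    move=> n; rewrite ltnS leq_eqVlt => /orP[/eqP->//|nB]; exact: le_trans (h3 n nB) l.
  split=> //; split=> // n; rewrite ltnS leq_eqVlt => /orP[/eqP->|nB]; [exact: ltW | exact: h3].
have [h1 [h2 h3]] := H P.+1; rewrite -/P -[nsq _ _ _ _]/(g P.+1).
have N0 : 0 <= cs_norm (star_poly_val a p) by apply: nrm_ge0.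
apply/le_anti/andP; split.
  case: h1 => [->|[n ->]]; first exact: sqr_ge0.
  by rewrite ler_pXn2r ?nnegrE ?cn_ge0 // alg_norm_ub.
rewrite -[leRHS]sqr_sqrtr // ler_pXn2r ?nnegrE ?sqrtr_ge0 //.
apply: alg_norm_le => n; rewrite -[leLHS]ger0_norm ?cn_ge0 // -sqrtr_sqr ler_sqrt //.
(* The point n is replaced by a node of code at most P that lies in the same cones, as far as the
   variables of p can tell. *)
have -> : cn (fv (star_poly_val a p) n) = h (kapf lt N P.+1 n).
  congr cn; rewrite !fv_poly; apply: cval_local => i iP; rewrite !fv_ind ?asboolb; try exact: cone_clop.
  by rewrite kapf_pattern.
by apply: h3; apply: kapf_lt.
Qed.
Lemma forest_indexes e : (forall p k, phi e (pairn p k) (rsqrt (nsq c N x p) k)) -> indexes a e.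
Proof.
move=> he p; exists (rsqrt (nsq c N x (star_poly_num p))); split=> //.
- exact: rsqrt_decreasing (nrm_ge0 _) (nsq_norm p).
- exact: rsqrt_cvg (nrm_ge0 _) (nsq_norm p).
Qed.
Lemma forest_pres : is_presentation a.
Proof. by apply: pres_cones => [k|v]; [exact: cone_clop | exists v]. Qed.
End ForestIndex.

Lemma forest_index (c : Defs.code) N : exists e : nat -> nat, cmp (fun f x => e x) /\
  forall x p k, phi (e x) (pairn p k) (rsqrt (nsq c N x p) k).
Proof.
have [|e [ce he]] := @s_m_n (fun x y => rsqrt (nsq c N x (p1 y)) (p2 y)).
  by apply: cmp_rsqrt; [apply: cmp_nsq; cmp | cmp].
by exists e; split=> // x p k; have := he x (pairn p k); rewrite !pE.
Qed.

Theorem theorem12p7 (R : realType) :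
  Sigma11_complete (coded_pairs (comm_AF_iso_problem R)).
Proof.
split; first exact: iso_problem_Sigma11.
move=> T [P [c hc] ->].
have [e0 [ce0 he0]] := forest_index c 1; have [e1 [ce1 he1]] := forest_index c 2.
exists (fun x => pairn (e0 x) (e1 x)).
  have [d hd] := cmp_pair ce0 ce1; exists (code_num d) => x; exists d => //; exact: hd.
move=> x; rewrite /coded_pairs /= /unpairn /pairn Cantor.cancel_of_to.
have i0 := forest_indexes R (he0 x); have i1 := forest_indexes R (he1 x).
rewrite (iso_problem_indexed (@forest_pres R c x 1) i0 (@forest_pres R c x 2) i1).
rewrite -(tree_acc hc); split=> [na|iso acc]; last exact: not_isomorphic acc iso.
apply: isomorphic na _; exact: kb_acc_lt.
Qed.
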